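(* Let $d\ge2$ and $k\ge1$. Then $$\sup\{D(\Omega)^2\mu_k(\Omega):\Omega\subset\mathbb{R}^d \text{ bounded, connected, open, Lipschitz}\}=+\infty .$$
   Context: $D(\Omega)$ is the diameter of $\Omega$ and $0=\mu_0(\Omega)<\mu_1(\Omega)\le\mu_2(\Omega)\le\cdots$ are the eigenvalues, counted with multiplicity, of the Neumann Laplacian on $\Omega$. *)

(* Defs.v *)
From HB Require Import structures.
From mathcomp Require Import all_boot all_order all_algebra.
From mathcomp Require Import all_classical all_reals all_analysis.

Set Implicit Arguments.
Unset Strict Implicit.
Unset Printing Implicit Defensive.

Import Order.TTheory GRing.Theory Num.Theory.
Import numFieldNormedType.Exports.

Local Open Scope classical_set_scope.
Local Open Scope ring_scope.

(* The sigma-algebra on R^n is the one generated by the coordinate maps, i.e.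
   the product of n copies of the Borel sigma-algebra of R; since R is second
   countable, it is the Borel sigma-algebra of R^n. *)
Section measurable_rV.
Context {R : realType} (n : nat).

Definition rV_coord (i : 'I_n) (x : 'rV[R]_n) : R := x ord0 i.

Let rV_set0 : g_sigma_preimage rV_coord set0.
Proof. exact: sigma_algebra0. Qed.

Let rV_setC A : g_sigma_preimage rV_coord A -> g_sigma_preimage rV_coord (~` A).
Proof. exact: sigma_algebraC. Qed.

Let rV_bigcup (F : _^nat) : (forall i, g_sigma_preimage rV_coord (F i)) ->
  g_sigma_preimage rV_coord (\bigcup_i F i).
Proof. exact: sigma_algebra_bigcup. Qed.

HB.instance Definition _ := @isMeasurable.Build default_measure_display
  'rV[R]_n (g_sigma_preimage rV_coord) rV_set0 rV_setC rV_bigcup.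

Lemma measurable_rV_coord (i : 'I_n) : measurable_fun [set: 'rV[R]_n] (rV_coord i).
Proof.
move=> _ Y mY; rewrite setTI; apply: sub_sigma_algebra => /=.
rewrite -bigcup_seq/=; exists i => /=; first by rewrite mem_index_enum.
by exists Y => //; rewrite setTI.
Qed.

Lemma measurable_fun_rVP d (T : measurableType d) (f : T -> 'rV[R]_n) :
  (forall i, measurable_fun setT (rV_coord i \o f)) -> measurable_fun setT f.
Proof.
move=> mf; suff H : g_sigma_preimage (fun i => rV_coord i \o f) `<=` measurable.
  move=> _ A mA; rewrite setTI; apply: H; rewrite g_sigma_preimage_comp.
  by exists A => //; rewrite setTI.
apply: smallest_sub; first exact: sigma_algebra_measurable.
rewrite -bigcup_seq; apply: bigcup_sub => i _ A [B mB <-]; exact: mf.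
Qed.

End measurable_rV.

(* Lebesgue measure on R^n, by induction on n: the image of
   lebesgue_measure \x lebesgue_rV n under (a, v) |-> (a, v_0, ..., v_n-1). *)
Section lebesgue_rV.
Context {R : realType}.

Definition rV_cons n (p : R * 'rV[R]_n) : 'rV[R]_n.+1 :=
  \row_(i < n.+1) if unlift ord0 i is Some j then p.2 ord0 j else p.1.

Lemma rV_cons0 n (p : R * 'rV[R]_n) : rV_cons p ord0 ord0 = p.1.
Proof. by rewrite mxE unlift_none. Qed.

Lemma rV_consS n (p : R * 'rV[R]_n) (i : 'I_n) :
  rV_cons p ord0 (lift ord0 i) = p.2 ord0 i.
Proof. by rewrite mxE liftK. Qed.

Lemma measurable_rV_cons n : measurable_fun setT (@rV_cons n).
Proof.
apply: measurable_fun_rVP => i; have [->|] := eqVneq i ord0.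
  rewrite (_ : _ \o _ = fst); first exact: measurable_fst.
  by apply/funext => p /=; rewrite /rV_coord rV_cons0.
rewrite eq_sym => /unlift_some[j -> _].
rewrite (_ : _ \o _ = rV_coord j \o snd).
  by apply: measurableT_comp; [exact: measurable_rV_coord|exact: measurable_snd].
by apply/funext => p /=; rewrite /rV_coord rV_consS.
Qed.

Definition rV_uncons n (x : 'rV[R]_n.+1) : R * 'rV[R]_n :=
  (x ord0 ord0, \row_j x ord0 (lift ord0 j)).

Lemma rV_consK n : cancel (@rV_cons n) (@rV_uncons n).
Proof.
move=> [a v]; rewrite /rV_uncons rV_cons0; congr pair.
by apply/rowP => j; rewrite mxE rV_consS.
Qed.

Lemma measurable_rV_uncons n : measurable_fun setT (@rV_uncons n).
Proof.
apply: measurable_fun_pair; first exact: measurable_rV_coord.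
apply: measurable_fun_rVP => i.
rewrite (_ : _ \o _ = rV_coord (lift ord0 i)); last first.
  by apply/funext => x /=; rewrite /rV_coord mxE.
exact: measurable_rV_coord.
Qed.

Section step.
Context n (m : {sigma_finite_measure set 'rV[R]_n -> \bar R}).

Definition lebesgue_rV_step : set 'rV[R]_n.+1 -> \bar R :=
  pushforward (@lebesgue_measure R \x m)%E (@rV_cons n).

HB.instance Definition _ := Measure.copy lebesgue_rV_step
  (measure_function_pushforward__canonical__measure_function_Measure
     (@lebesgue_measure R \x m)%E (@measurable_rV_cons n)).

Let lebesgue_rV_step_sigma_finite : sigma_finite setT lebesgue_rV_step.
Proof.
have /sigma_finiteP[F [FT ndF Foo]] := sigma_finiteT (@lebesgue_measure R).
have /sigma_finiteP[G [GT ndG Goo]] := sigma_finiteT m.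
exists (fun k => @rV_uncons n @^-1` (F k `*` G k)).
  apply/esym/seteqP; split=> // x _.
  have [i _ Fi] : (\bigcup_k F k) (rV_uncons x).1 by rewrite -FT.
  have [j _ Gj] : (\bigcup_k G k) (rV_uncons x).2 by rewrite -GT.
  exists (maxn i j) => //; split.
    by move: Fi; exact/subsetPset/ndF/leq_maxl.
  by move: Gj; exact/subsetPset/ndG/leq_maxr.
move=> k; have [mF Fk] := Foo k; have [mG Gk] := Goo k; split.
  rewrite -[X in measurable X]setTI; apply: measurable_rV_uncons => //.
  exact: measurableX.
rewrite /lebesgue_rV_step /pushforward -comp_preimage.
rewrite (_ : _ \o _ = id); last by apply/funext => p /=; rewrite rV_consK.
by rewrite preimage_id product_measure1E// lte_mul_pinfty// ge0_fin_numE.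
Qed.

HB.instance Definition _ := Measure_isSigmaFinite.Build _ _ _ lebesgue_rV_step
  lebesgue_rV_step_sigma_finite.

End step.

Fixpoint lebesgue_rV n : {sigma_finite_measure set 'rV[R]_n -> \bar R} :=
  match n with
  | 0%N => @dirac _ 'rV[R]_0 0 R
  | n'.+1 => lebesgue_rV_step (lebesgue_rV n')
  end.

Lemma lebesgue_rV_box n (A : 'I_n -> set R) : (forall i, measurable (A i)) ->
  lebesgue_rV n [set x : 'rV[R]_n | forall i, A i (x ord0 i)] =
  (\prod_(i < n) lebesgue_measure (A i))%E.
Proof.
elim: n A => [|n IH] A mA.
  by rewrite big_ord0 /= diracE mem_set// => -[].
rewrite big_ord_recl /= /lebesgue_rV_step /pushforward.
pose C := \bigcap_(i in setT) (rV_coord i @^-1` A (lift ord0 i)) : set 'rV[R]_n.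
have CE : C = [set x : 'rV[R]_n | forall i, A (lift ord0 i) (x ord0 i)].
  by apply/seteqP; split=> x /= H i; [exact: (H i I)|move=> _; exact: H].
have mC : measurable C.
  apply: fin_bigcap_measurable => // i _.
  by rewrite -[X in measurable X]setTI; exact: measurable_rV_coord.
transitivity ((@lebesgue_measure R \x lebesgue_rV n)%E (A ord0 `*` C)).
  congr product_measure1; rewrite CE.
  apply/seteqP; split=> [[a v]/= H|[a v]/= [H0 H] i].
    split=> [|i]; first by have := H ord0; rewrite rV_cons0.
    by have := H (lift ord0 i); rewrite rV_consS.
  have [->|] := eqVneq i ord0; first by rewrite rV_cons0.
  by rewrite eq_sym => /unlift_some[j -> _]; rewrite rV_consS.
transitivity (lebesgue_measure (A ord0) * lebesgue_rV n C)%E.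
  exact (product_measure1E (@lebesgue_measure R) (lebesgue_rV n) (mA ord0) mC).
congr (_ * _)%E; by rewrite CE; exact: IH.
Qed.

End lebesgue_rV.

Section euclidean.
Context {R : realType} (d : nat).
Implicit Types x y : 'rV[R]_d.

Definition dotp x y : R := \sum_(i < d) x ord0 i * y ord0 i.

(* The norm `|x| of the library on 'rV[R]_d is the sup norm. *)
Definition enorm x : R := Num.sqrt (dotp x x).

Definition diameter (Omega : set 'rV[R]_d) : \bar R :=
  ereal_sup [set (enorm (z.1 - z.2))%:E | z in Omega `*` Omega].

(* Near each boundary point, and after a rotation taking the unit vector nu to
   the last basis vector, Omega is the part of a ball above the graph of a
   Lipschitz function gamma. The variable of gamma is the orthogonal projection
   on the hyperplane normal to nu; defining gamma on the whole space is no
   restriction (compose with the projection). *)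
Definition lipschitz_boundary (Omega : set 'rV[R]_d) : Prop :=
  forall x0, (closure Omega `\` interior Omega) x0 ->
  exists (r L : R) (nu : 'rV[R]_d) (gamma : 'rV[R]_d -> R),
    [/\ 0 < r, enorm nu = 1,
        forall y z, `|gamma y - gamma z| <= L * enorm (y - z)
      & forall x, enorm (x - x0) < r ->
          (Omega x <-> gamma (x - dotp x nu *: nu) < dotp x nu)].

Definition lipschitz_domain : set (set 'rV[R]_d) :=
  [set Omega | [/\ Omega !=set0, bounded_set Omega, connected Omega,
                   open Omega & lipschitz_boundary Omega]].

End euclidean.

Section neumann.
Context {R : realType} (d : nat).
Implicit Types (Omega : set 'rV[R]_d) (u v f phi : 'rV[R]_d -> R)
  (g h : 'rV[R]_d -> 'rV[R]_d).

Local Notation leb := (lebesgue_rV d : set 'rV[R]_d -> \bar R).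
Local Notation e_ i := (delta_mx ord0 i : 'rV[R]_d).

(* Elements of L^2(Omega) are represented by functions on the whole space, whose
   values outside Omega are irrelevant. *)
Definition L2 Omega u : Prop :=
  measurable_fun Omega u /\ (\int[leb]_(x in Omega) (u x ^+ 2)%:E < +oo)%E.

(* C^1 functions with compact support in Omega. *)
Definition C1c Omega phi : Prop :=
  [/\ continuous phi,
      forall i, (forall x, derivable phi x (e_ i)) /\ continuous ('D_(e_ i) phi)
    & exists K, [/\ compact K, K `<=` Omega & forall x, ~ K x -> phi x = 0]].

(* u is in H^1(Omega), with weak gradient g; for first-order weak derivatives,
   C^1 test functions are enough. *)
Definition H1_grad Omega u g : Prop :=
  [/\ L2 Omega u, forall i, L2 Omega (fun x => g x ord0 i)
    & forall phi, C1c Omega phi -> forall i,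
        \int[leb]_(x in Omega) (u x * 'D_(e_ i) phi x) =
        - \int[leb]_(x in Omega) (g x ord0 i * phi x)].

(* The graph of the Neumann Laplacian (the nonnegative self-adjoint operator of
   L^2(Omega) associated with the form \int_Omega <grad u, grad v> on
   H^1(Omega)): u is in its domain and is mapped to f. *)
Definition neumann_laplacian Omega u f : Prop :=
  L2 Omega f /\
  exists2 g, H1_grad Omega u g &
    forall v h, H1_grad Omega v h ->
      \int[leb]_(x in Omega) dotp (g x) (h x) =
      \int[leb]_(x in Omega) (f x * v x).

(* The eigenspace for lambda, zero function included. *)
Definition neumann_eigenspace Omega (lambda : R) u : Prop :=
  neumann_laplacian Omega u (fun x => lambda * u x).

Definition lin_indep_ae Omega n (u : 'I_n -> 'rV[R]_d -> R) : Prop :=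
  forall c : 'I_n -> R,
    {ae leb, forall x, Omega x -> \sum_(j < n) c j * u j x = 0} ->
    forall j, c j = 0.

(* mu_k, with indices starting from 0: the least t such that there are at least
   k + 1 eigenvalues, counted with multiplicity, in ]-oo, t]; the number of these
   eigenvalues is the dimension of the sum of their eigenspaces. On a bounded
   Lipschitz domain the spectrum is discrete and unbounded, so the infimum is a
   finite minimum; the convention inf of the empty set = +oo plays no role. *)
Definition neumann_eigenvalue Omega (k : nat) : \bar R :=
  ereal_inf [set t%:E | t in [set t : R |
    exists (lambda : 'I_k.+1 -> R) (u : 'I_k.+1 -> 'rV[R]_d -> R),
      (forall j, lambda j <= t /\ neumann_eigenspace Omega (lambda j) (u j)) /\
      lin_indep_ae Omega u]].

End neumann.

(* Main.v *)
(* The domain is a horn of length N + 1 over the unit cube: along the coordinate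
   i0 it has width profile N (x_i0) in the direction i1, equal to 1 for x_i0 <= 1
   and then decaying exponentially. Its diameter is at least N, but it satisfies a
   Poincare inequality with a constant K depending only on d: averaging over
   points at distance between 1/2 and 1 to the left, then over the upper half of the
   section, a fixed fraction of the mass of (v - c)^2 moves towards the cube,
   because the width halves on every step of length 1/2. So a large deviation
   from c on the horn is paid for on the cube or by the gradient.
   A combination v of two eigenfunctions with mean 0 then gives mu_1 >= 1/K,
   hence D^2 mu_k >= N^2 / K.
   The gradient is only a weak one; the difference v(x) - v(x') of two points on
   a line parallel to an axis is written as an integral of the weak derivative,
   for almost all such pairs. *)

From HB Require Import structures.
Require Import Defs.
From mathcomp Require Import all_boot all_order all_algebra.
From mathcomp Require Import all_classical all_reals all_analysis.
From mathcomp Require Import measurable_realfun.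
From mathcomp Require Import ring lra.

Set Implicit Arguments.
Unset Strict Implicit.
Unset Printing Implicit Defensive.

Import Order.TTheory GRing.Theory Num.Theory.
Import numFieldNormedType.Exports.

Local Open Scope classical_set_scope.
Local Open Scope ring_scope.

(** * Integration along coordinate lines *)

(** Let I, Q and L be the integrals of (u - c)^2 over the horn, over its part in the cube, and over
    the lower halves of its sections. Each point outside the cube is compared with points to its
    left. Outside the cube, a point can serve as such a partner only if it lies in the lower half of
    its section, since the points compared with it sit in sections at most half as wide. Hence I - Q
    <= 9/8 (Q + L) up to gradient terms. Comparing lower with upper halves gives L <= 9/8 (I - L),
    that is L <= 9/17 I, up to gradient terms. As 9/8 * 9/17 < 1, the integral I is absorbed. This
    dictates the constant 9/8: the usual (a - c)^2 <= 2 (b - c)^2 + 2 (a - b)^2 would produce 2 *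
    2/3 > 1. The price is a factor 9 on the squared differences, which is harmless because compared
    points are at distance at most 1, so that no constant sees N. For the weak gradient, the useful
    feature of the horn is that a line parallel to an axis meets it in an interval starting at 0:
    the gradient can be integrated from 0, and what is left of u is shown to be constant along the
    line. *)

Section coordinate_update.
Context {R : realType} {d : nat}.
Implicit Types (i j : 'I_d) (x : 'rV[R]_d).

Definition upd i (s : R) x : 'rV[R]_d :=
  \row_j (if j == i then s else x ord0 j).

Lemma updE i s x j : upd i s x ord0 j = if j == i then s else x ord0 j.
Proof. by rewrite mxE. Qed.

Lemma upd_eq i s x : upd i s x ord0 i = s.
Proof. by rewrite updE eqxx. Qed.

Lemma upd_neq i s x j : j != i -> upd i s x ord0 j = x ord0 j.
Proof. by rewrite updE => /negbTE ->. Qed.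

Lemma upd_upd i s t x : upd i s (upd i t x) = upd i s x.
Proof. by apply/rowP => j; rewrite !updE; case: eqP. Qed.

Lemma upd_id i x : upd i (x ord0 i) x = x.
Proof. by apply/rowP => j; rewrite updE; case: eqP => // ->. Qed.

Lemma updC i j s t x : i != j -> upd i s (upd j t x) = upd j t (upd i s x).
Proof.
move=> ij; apply/rowP => k; rewrite !updE.
by case: (eqVneq k i) => // ->; rewrite (negbTE ij).
Qed.

(* Preserves lebesgue_measure \x lebesgue_rV: averaging over pairs of points of a
   line parallel to the axis i is symmetric in the two points. *)
Definition cswap i (z : measurableTypeR R * 'rV[R]_d) : measurableTypeR R * 'rV[R]_d :=
  (z.2 ord0 i, upd i z.1 z.2).

Lemma measurable_coord dT (T : measurableType dT) (f : T -> 'rV[R]_d) i :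
  measurable_fun setT f -> measurable_fun setT (fun z => f z ord0 i).
Proof.
by move=> mf; apply: (@measurableT_comp _ _ _ _ _ _ (rV_coord i)) => //;
  exact: measurable_rV_coord.
Qed.

Lemma measurable_upd dT (T : measurableType dT) i (s : T -> R) (f : T -> 'rV[R]_d) :
  measurable_fun setT s -> measurable_fun setT f ->
  measurable_fun setT (fun z => upd i (s z) (f z)).
Proof.
move=> ms mf; apply: measurable_fun_rVP => j; rewrite /rV_coord /comp.
have [->|ji] := eqVneq j i.
  by under eq_fun do rewrite upd_eq.
by under eq_fun do rewrite upd_neq//; exact: measurable_coord.
Qed.

Lemma measurable_cswap i : measurable_fun setT (cswap i).
Proof.
apply: measurable_fun_pair; first by apply: measurable_coord; exact: measurable_snd.
by apply: measurable_upd; [exact: measurable_fst|exact: measurable_snd].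
Qed.

End coordinate_update.

Section swap_integral.
Context {R : realType} {d : nat}.
Local Notation leb := (lebesgue_rV d : {sigma_finite_measure set 'rV[R]_d -> \bar R}).
Local Notation lam := (@lebesgue_measure R).

Definition rbox (A : 'I_d -> set R) := [set x : 'rV[R]_d | forall i, A i (x ord0 i)].

Lemma measurable_rbox A : (forall i, measurable (A i)) -> measurable (rbox A).
Proof.
move=> mA; rewrite (_ : rbox A = \bigcap_(i in setT) (rV_coord i @^-1` A i)).
  apply: fin_bigcap_measurable => // i _.
  by rewrite -[X in measurable X]setTI; exact: measurable_rV_coord.
by apply/seteqP; split=> x /= H i; [move=> _; exact: H|exact: (H i I)].
Qed.

Let boxes := [set AB : set (measurableTypeR R * 'rV[R]_d) |
  exists A B, [/\ measurable A, forall i, measurable (B i) & AB = A `*` rbox B]].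

Let measurable_boxes : @measurable _ (measurableTypeR R * 'rV[R]_d)%type = <<s boxes >>.
Proof.
apply/seteqP; split; last first.
  apply: smallest_sub; first exact: sigma_algebra_measurable.
  by move=> _ [A [B [mA mB ->]]]; apply: measurableX => //; exact: measurable_rbox.
have mid : measurable_fun setT (idfun : g_sigma_algebraType boxes -> measurableTypeR R * 'rV[R]_d).
  apply/measurable_fun_pairP; split.
    move=> _ A mA; rewrite setTI; apply: sub_sigma_algebra.
    exists A, (fun=> setT); split => //.
    by apply/seteqP; split=> [[s x]|[s x] []] //=.
  apply: measurable_fun_rVP => i _ A mA; rewrite setTI; apply: sub_sigma_algebra.
  exists setT, (fun j => if j == i then A else setT); split => //.
    by move=> j; case: ifP.
  apply/seteqP; split=> [[s x] /= Ax|[s x] [_ /=] /(_ i)]; last by rewrite eqxx.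
  by split => //= j; case: eqP => // ->.
by move=> A mA; rewrite -[A]setTI; exact: mid.
Qed.

Let boxesI : setI_closed boxes.
Proof.
move=> _ _ [A [B [mA mB ->]]] [A' [B' [mA' mB' ->]]].
exists (A `&` A'), (fun i => B i `&` B' i); split; first exact: measurableI.
  by move=> i; exact: measurableI.
rewrite -setXI; congr (_ `*` _); apply/seteqP; split=> x /=.
  by move=> [H H'] i.
by move=> H; split=> i; case: (H i).
Qed.

Let measure_box (A : set (measurableTypeR R)) B :
  measurable A -> (forall i, measurable (B i)) ->
  (lam \x leb)%E (A `*` rbox B) = (lam A * \prod_(i < d) lam (B i))%E.
Proof.
move=> mA mB; rewrite -lebesgue_rV_box//.
by apply: product_measure1E => //; exact: measurable_rbox.
Qed.

(** The preimage of a box is the box with the free factor and the [i]-th factor exchanged, so both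
    measures give the same product. Boxes are stable under intersection, generate the sigma-algebra,
    and those with sides ]-n, n[ exhaust the space with finite measure. *)
Lemma swap_invariant i (A : set (measurableTypeR R * 'rV[R]_d)) : measurable A ->
  (lam \x leb)%E A = (lam \x leb)%E (cswap i @^-1` A).
Proof.
move=> mA; pose m2 : {measure set (measurableTypeR R * 'rV[R]_d) -> \bar R} :=
  measure_function_pushforward__canonical__measure_function_Measure
     (lam \x leb)%E (@measurable_cswap R d i).
change ((lam \x leb)%E A = m2 A).
refine (@measure_unique _ _ _ boxes
  (fun n => `]-n%:R, n%:R[%classic `*` rbox (fun=> `]-n%:R, n%:R[%classic))
  measurable_boxes boxesI _ _ (lam \x leb)%E m2 _ _ A mA).
- by move=> n; eexists; eexists; split; [ | |reflexivity]; move=> *; exact: measurable_itv.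
- apply/seteqP; split => // -[s x] _.
  pose M := `|s| + \sum_j `|x ord0 j|.
  exists (Num.trunc M).+1 => //; split => /=.
    rewrite in_itv/= -ltr_norml; apply: le_lt_trans (truncnS_gt _).
    by rewrite lerDl sumr_ge0.
  move=> j /=; rewrite in_itv/= -ltr_norml; apply: le_lt_trans (truncnS_gt _).
  by rewrite /M (bigD1 j)//= addrCA lerDl addr_ge0// sumr_ge0.
- move=> _ [B0 [B [mB0 mB ->]]]; rewrite /m2 /= /pushforward.
  pose B' j := if j == i then B0 else B j.
  have mB' j : measurable (B' j) by rewrite /B'; case: ifP => _; [exact: mB0|exact: mB].
  have -> : cswap i @^-1` (B0 `*` rbox B) = B i `*` rbox B'.
    apply/seteqP; split=> -[s x] [/= H1 H2].
      split => /=; first by have := H2 i; rewrite upd_eq.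
      move=> j; rewrite /B'; case: eqP => [->//|/eqP ji].
      by have := H2 j; rewrite upd_neq.
    split; first by have := H2 i; rewrite /B' eqxx.
    by move=> j; rewrite updE; have := H2 j; rewrite /B'; case: eqP => [->|].
  transitivity (lam B0 * \prod_(i < d) lam (B i))%E; first exact: measure_box.
  transitivity (lam (B i) * \prod_(i < d) lam (B' i))%E; last first.
    by apply/esym; apply: measure_box => //; exact: mB.
  rewrite (bigD1 i)//= [in RHS](bigD1 i)//= /B' eqxx muleCA.
  do 2 congr (_ * _)%E.
  by apply: eq_bigr => j /negbTE ->.
- move=> n; refine (eq_ind_r (fun z => z < +oo)%E _ (measure_box _ _)).
  2,3: by move=> *; exact: measurable_itv.
  under eq_bigr do rewrite lebesgue_measure_itv/=.
  rewrite lebesgue_measure_itv/=.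
  set c := (if _ then _ else _); have [r ->] : exists r, c = r%:E.
    by rewrite /c; case: ifP => _; eexists; [rewrite -EFinB|].
  by rewrite prodEFin -EFinM ltry.
Qed.


Local Notation Z := (measurableTypeR R * 'rV[R]_d)%type.
Local Open Scope ereal_scope.

Lemma ge0_integral_cswap i (F : Z -> \bar R) : measurable_fun setT F ->
  (forall z, 0 <= F z) ->
  \int[lam \x leb]_z F z = \int[lam \x leb]_z F (cswap i z).
Proof.
move=> mF F0; transitivity (\int[pushforward (lam \x leb) (@cswap R d i)]_z F z).
  apply: eq_measure_integral => [|? A mA _]; first exact: measurable_cswap.
  exact (swap_invariant i mA).
rewrite ge0_integral_pushforward//; exact: measurable_cswap.
Qed.

(** Typical use: an integrand containing h (upd i s x) becomes one containing h x, which then leaves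
    the inner integral. *)
Lemma tonelli_swap i (F : Z -> \bar R) : measurable_fun setT F ->
  (forall z, 0 <= F z) ->
  \int[leb]_x \int[lam]_s F (s, x) = \int[leb]_x \int[lam]_s F (x ord0 i, upd i s x).
Proof.
move=> mF F0; rewrite -(fubini_tonelli2 F mF F0) (ge0_integral_cswap i)//.
rewrite (fubini_tonelli2 (F \o cswap i)); [by []| |by move=> z; exact: F0].
by apply: measurableT_comp => //; exact: measurable_cswap.
Qed.

Lemma integrable_cswap i (F : Z -> \bar R) :
  (lam \x leb).-integrable setT F -> (lam \x leb).-integrable setT (F \o cswap i).
Proof.
move=> /integrableP[mF iF]; apply/integrableP; split.
  by apply: measurableT_comp => //; exact: measurable_cswap.
rewrite -(ge0_integral_cswap i (F := abse \o F)); [exact: iF| |by move=> z; exact: abse_ge0].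
by apply: measurableT_comp => //; exact: measurable_abse.
Qed.

Lemma fubini_swap i (F : Z -> \bar R) : (lam \x leb).-integrable setT F ->
  \int[leb]_x \int[lam]_s F (s, x) = \int[leb]_x \int[lam]_s F (x ord0 i, upd i s x).
Proof.
move=> iF; have mF := measurable_int _ iF.
rewrite -[LHS]/(\int[leb]_x fubini_G lam F x) integral21_prod_meas1//.
transitivity (\int[pushforward (lam \x leb) (@cswap R d i)]_z F z).
  apply: eq_measure_integral => [|? A mA _]; first exact: measurable_cswap.
  exact (swap_invariant i mA).
rewrite integral_pushforward//; last 2 first.
- exact: measurable_cswap.
- by rewrite preimage_setT; exact: integrable_cswap.
rewrite preimage_setT -integral21_prod_meas1//; exact: integrable_cswap.
Qed.

Definition ray (b : 'I_d -> R) := rbox (fun i => `]-oo, b i[%classic).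

Lemma rayE b x : ray b x <-> forall i, (x ord0 i < b i)%R.
Proof. by split=> H i; have := H i; rewrite /= in_itv. Qed.

Lemma measurable_ray b : measurable (ray b).
Proof. by apply: measurable_rbox => i; exact: measurable_itv. Qed.

Let rays := [set A | exists b, A = ray b].

Lemma measurable_raysE : @measurable _ 'rV[R]_d = <<s rays >>.
Proof.
apply/seteqP; split; last first.
  apply: smallest_sub; first exact: sigma_algebra_measurable.
  by move=> _ [b ->]; exact: measurable_ray.
have mid : measurable_fun setT (idfun : g_sigma_algebraType rays -> 'rV[R]_d).
  apply: measurable_fun_rVP => i; apply: (measurability _ (RGenInftyO.measurableE R)).
  move=> _ [_ [b ->] <-]; rewrite setTI.
  (* A half-space is the increasing union of the rays whose other bounds are n. *)
  rewrite (_ : _ @^-1` _ = \bigcup_(n : nat) ray (fun j => if j == i then b else n%:R%R)).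
    apply: bigcupT_measurable => n; apply: sub_sigma_algebra.
    by exists (fun j => if j == i then b else n%:R%R).
  apply/seteqP; split=> [x /=|x [n _ /(_ i)]]; last by rewrite /= eqxx.
  rewrite in_itv/= => xb; pose M := (\sum_j `|x ord0 j|)%R.
  exists (Num.trunc M).+1 => // j /=; rewrite in_itv/=.
  case: eqP => [->//|_]; apply: le_lt_trans (truncnS_gt _).
  by rewrite /M (bigD1 j)//= (le_trans (ler_norm _))// lerDl sumr_ge0.
by move=> A mA; rewrite -[A]setTI; exact: mid.
Qed.

(** Dynkin induction: rays are stable under intersection and generate the sigma-algebra, so all
    integrals of [F] vanish. The support condition makes the integral over the whole space vanish,
    which is what complements require. *)
Lemma integral_rays_eq0 (F : 'rV[R]_d -> R) :
  leb.-integrable setT (EFin \o F) ->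
  (exists M, forall x, ~ ray M x -> F x = 0%R) ->
  (forall b, \int[leb]_(x in ray b) (F x)%:E = 0) ->
  {ae leb, forall x, F x = 0%R}.
Proof.
move=> iF [M FM] F0; have iFS A : measurable A -> leb.-integrable A (EFin \o F).
  by move=> mA; exact: integrableS iF.
have F0T : \int[leb]_x (F x)%:E = 0.
  rewrite -[RHS](F0 M) [RHS]integral_mkcond; apply: eq_integral => x _.
  by rewrite patchE; case: ifPn => //; rewrite notin_setE => /FM ->.
have H A : measurable A -> \int[leb]_(x in A) (F x)%:E = 0.
  rewrite measurable_raysE; move: A; apply: (@dynkin_induction _ _ rays
    (fun A => \int[leb]_(x in A) (F x)%:E = 0)) => //.
  - exact: measurable_raysE.
  - move=> _ _ [b ->] [b' ->]; exists (fun i => Num.min (b i) (b' i)).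
    apply/seteqP; split=> x.
      by move=> [/rayE H /rayE H']; apply/rayE => i; rewrite lt_min H H'.
    by move=> /rayE H; split; apply/rayE => i; have := H i; rewrite lt_min => /andP[].
  - by move=> _ [b ->]; exact: F0.
  - move=> S mS F0S; rewrite -F0T -(setUv S) integral_setU//.
    + by rewrite F0S add0e.
    + exact: measurableC.
    + by rewrite setUv; exact: measurable_int iF.
    + by rewrite disj_set2E setICr.
  - move=> G mG tG G0; rewrite integral_bigcup//.
      by rewrite eseries0.
    by apply: iFS; exact: bigcupT_measurable.
have : ae_eq leb setT (EFin \o F) (cst 0).
  apply: integral_ae_eq => // E _ mE; rewrite H// integral0 //.
by apply: filterS => x /(_ I) [].
Qed.

End swap_integral.

(** * Test functions *)

Section bump.
Context {R : realType}.
Implicit Types (a b t : R) (n : nat).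

(** The square makes it of class C^1, the regularity that [C1c] asks of test functions. *)
Definition ramp t : R := Num.max 0 t ^+ 2.
Definition dramp t : R := 2 * Num.max 0 t.

Lemma ramp_ge0 t : 0 <= ramp t.
Proof. exact: sqr_ge0. Qed.

Lemma continuous_dramp : continuous dramp.
Proof.
move=> t; apply: cvgM; first exact: cvg_cst.
by apply: continuous_max; [exact: cvg_cst|exact: cvg_id].
Qed.

Lemma is_derive_ramp t : is_derive t 1 ramp (dramp t).
Proof.
suff H : (fun h => h^-1 *: (ramp (h *: 1 + t) - ramp t)) @ 0^' --> dramp t.
  split; first by apply/cvg_ex; exists (dramp t).
  exact: cvg_lim.
apply/cvgrPdist_le => e e0; near=> h.
have h0 : h != 0 by near: h; exact: nbhs_dnbhs_neq.
have he : `|h| <= e by near: h; exact: dnbhs0_le.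
(* The first-order remainder of [ramp] is at most h^2, whatever the signs of t and t + h. *)
apply: le_trans he; rewrite (_ : _ - _ = (dramp t * h - (ramp (h *: 1 + t) - ramp t)) / h).
  rewrite normrM normfV ler_pdivrMr ?normr_gt0// -expr2 -normrX [leRHS]ger0_norm ?sqr_ge0//.
  rewrite /GRing.scale/= mulr1 ler_norml /ramp /dramp.
  have [t0|t0] := leP 0 t; have [ht0|ht0] := leP 0 (h + t);
    apply/andP; split; nra.
by rewrite /GRing.scale/=; field.
Unshelve. all: end_near. Qed.

(* Nonzero exactly on ]a, b[ when n > 0; tends to its indicator as n grows. *)
Definition smooth_bump n a b t : R :=
  let z := n%:R * (ramp (t - a) * ramp (b - t)) in z / (1 + z).

Definition dbump n a b t : R :=
  let z := n%:R * (ramp (t - a) * ramp (b - t)) in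
  let dz := n%:R * (dramp (t - a) * ramp (b - t) - ramp (t - a) * dramp (b - t)) in
  dz / (1 + z) ^+ 2.

Let z_ge0 n a b t : 0 <= n%:R * (ramp (t - a) * ramp (b - t)).
Proof. by apply: mulr_ge0 => //; apply: mulr_ge0; exact: ramp_ge0. Qed.

Let den_gt0 n a b t : 0 < 1 + n%:R * (ramp (t - a) * ramp (b - t)).
Proof. by rewrite ltr_pwDl. Qed.

Lemma smooth_bump_ge0 n a b t : 0 <= smooth_bump n a b t.
Proof. by rewrite /smooth_bump divr_ge0// ?z_ge0// ltW// den_gt0. Qed.

Lemma smooth_bump_le1 n a b t : smooth_bump n a b t <= 1.
Proof. by rewrite /smooth_bump ler_pdivrMr ?den_gt0// mul1r lerDr. Qed.

Lemma ramp_gt0 t : 0 < t -> 0 < ramp t.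
Proof. by move=> t0; rewrite /ramp max_r ?ltW// exprn_gt0. Qed.

Lemma ramp_eq0 t : t <= 0 -> ramp t = 0.
Proof. by move=> t0; rewrite /ramp max_l// expr0n. Qed.

Lemma smooth_bump_eq0 n a b t : ~ (a < t < b) -> smooth_bump n a b t = 0.
Proof.
move=> /negP; rewrite negb_and -!leNgt => /orP[ta|bt]; rewrite /smooth_bump.
  by rewrite (@ramp_eq0 (t - a)) ?subr_le0// mul0r mulr0 mul0r.
by rewrite (@ramp_eq0 (b - t)) ?subr_le0// mulr0 mulr0 mul0r.
Qed.

Lemma smooth_bump_gt0 n a b t : (0 < n)%N -> a < t < b -> 0 < smooth_bump n a b t.
Proof.
move=> n0 /andP[at_ tb]; rewrite /smooth_bump divr_gt0 ?den_gt0//.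
by apply: mulr_gt0; [rewrite ltr0n|apply: mulr_gt0; apply: ramp_gt0; rewrite subr_gt0].
Qed.

Lemma cvg_smooth_bump a b t :
  (fun n => smooth_bump n a b t) @ \oo --> (\1_(`]a, b[%classic) t : R).
Proof.
rewrite indicE; case: (boolP (t \in _)) => [|tab].
  rewrite inE/= in_itv/= => tab; set z := ramp (t - a) * ramp (b - t).
  have z0 : 0 < z.
    by case/andP: tab => ? ?; apply: mulr_gt0; apply: ramp_gt0; rewrite subr_gt0.
  apply/cvgrPdist_le => e e0.
  near=> n; rewrite /smooth_bump -/z/=.
  have nz : 0 <= n%:R * z by rewrite mulr_ge0// ltW.
  have -> : 1 - n%:R * z / (1 + n%:R * z) = (1 + n%:R * z)^-1 by field; lra.
  rewrite ger0_norm ?invr_ge0; last by lra.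
  rewrite -[e]invrK lef_pV2 ?posrE ?invr_gt0//; last by lra.
  have : (e^-1 / z <= n%:R) by near: n; exact: nbhs_infty_ger.
  by rewrite ler_pdivrMr// => ?; lra.
rewrite (_ : (fun n => _) = fun=> 0); first exact: cvg_cst.
apply/funext => n; apply: smooth_bump_eq0.
by move=> H; move/negP: tab; apply; rewrite inE/= in_itv.
Unshelve. all: end_near. Qed.

Lemma is_derive_smooth_bump n a b t : is_derive t 1 (smooth_bump n a b) (dbump n a b t).
Proof.
have d1 : is_derive t 1 (fun t => ramp (t - a)) (dramp (t - a)).
  apply: is_derive_eq; first apply: (@is_derive1_comp _ ramp (fun t => t - a)).
    exact: is_derive_ramp.
  by rewrite subr0 mulr1.
have d2 : is_derive t 1 (fun t => ramp (b - t)) (- dramp (b - t)).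
  apply: is_derive_eq; first apply: (@is_derive1_comp _ ramp (fun t => b - t)).
    exact: is_derive_ramp.
  by ring.
pose z t := n%:R * (ramp (t - a) * ramp (b - t)).
pose dz t := n%:R * (dramp (t - a) * ramp (b - t) - ramp (t - a) * dramp (b - t)).
have dzt : is_derive t 1 z (dz t).
  have d3 := is_deriveM (is_derive_cst (n%:R : R) (t : R) (1 : R)) (is_deriveM d1 d2).
  refine (is_derive_eq d3 _).
  by rewrite /dz /GRing.scale/=; ring.
have d1z : is_derive t 1 (fun t => 1 + z t) (dz t).
  have d4 := is_deriveD (is_derive_cst (1 : R) (t : R) (1 : R)) dzt.
  by refine (is_derive_eq d4 _); rewrite add0r.
have z0 : 1 + z t != 0 by rewrite gt_eqF// den_gt0.
have dV : is_derive t 1 (fun t => (1 + z t)^-1) (- (1 + z t) ^- 2 * dz t).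
  case: d1z => d1z <-; apply: DeriveDef; first exact: derivableV.
  by rewrite deriveV.
refine (is_derive_eq (is_deriveM dzt dV) _).
by rewrite /dbump -/(z t) -/(dz t) /GRing.scale/=; field.
Qed.

Lemma continuous_dbump n a b : continuous (dbump n a b).
Proof.
have crc (c : R -> R) : continuous c ->
    continuous (fun t => dramp (c t)) /\ continuous (fun t => ramp (c t)).
  move=> cc; split=> t; first by apply: (continuous_comp (cc t)); exact: continuous_dramp.
  apply: (continuous_comp (cc t)); have := is_derive_ramp (c t).
  by move=> [/derivable1_diffP/differentiable_continuous].
have ca : continuous (fun t => t - a) by move=> t; apply: cvgB; [exact: cvg_id|exact: cvg_cst].
have cb : continuous (fun t => b - t) by move=> t; apply: cvgB; [exact: cvg_cst|exact: cvg_id].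
have [da ra] := crc _ ca; have [db rb] := crc _ cb.
move=> t; apply: cvgM.
  apply: cvgM; first exact: cvg_cst.
  by apply: cvgB; apply: cvgM; [exact: da|exact: rb|exact: ra|exact: db].
apply: cvgV; first by rewrite expf_neq0// gt_eqF// den_gt0.
rewrite expr2; under eq_fun do rewrite expr2.
have c1 : (1 + n%:R * (ramp (u - a) * ramp (b - u))) @[u --> t] -->
  1 + n%:R * (ramp (t - a) * ramp (b - t)).
  apply: cvgD; first exact: cvg_cst.
  apply: cvgM; first exact: cvg_cst.
  by apply: cvgM; [exact: ra|exact: rb].
exact: cvgM.
Qed.

End bump.

Section tensor_test_function.
Context {R : realType} {d : nat}.
Variables f f' : 'I_d -> R -> R.
Hypothesis df : forall j (t : R), is_derive t (1 : R) (f j) (f' j t).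
Hypothesis cf' : forall j, continuous (f' j).

Local Notation e_ i := (delta_mx ord0 i : 'rV[R]_d).

Definition tensor (x : 'rV[R]_d) : R := \prod_j f j (x ord0 j).

Definition dtensor i (x : 'rV[R]_d) : R :=
  f' i (x ord0 i) * \prod_(j | j != i) f j (x ord0 j).

Lemma tensorE i x : tensor x = f i (x ord0 i) * \prod_(j | j != i) f j (x ord0 j).
Proof. by rewrite /tensor (bigD1 i). Qed.

Lemma is_derive_tensor i x : is_derive x (e_ i) tensor (dtensor i x).
Proof.
suff H : (fun h => h^-1 *: ((tensor \o shift x) (h *: e_ i) - tensor x)) @ 0^' -->
    dtensor i x.
  split; first by apply/cvg_ex; exists (dtensor i x).
  exact: cvg_lim.
have [dfi fiE] := df i (x ord0 i).
have : (fun h => h^-1 *: ((f i \o shift (x ord0 i)) (h *: 1) - f i (x ord0 i)))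
  @ 0^' --> f' i (x ord0 i) by rewrite -fiE.
move=> cvf.
rewrite (_ : (fun h => _) = (fun h => (h^-1 *: ((f i \o shift (x ord0 i)) (h *: 1)
    - f i (x ord0 i))) * \prod_(j | j != i) f j (x ord0 j))).
  by apply: cvgM => //; exact: cvg_cst.
apply/funext => h; rewrite /= !(tensorE i) !mxE eqxx /= /GRing.scale/= -mulrA.
rewrite eqxx; congr (_ * _); rewrite mulrBl; congr (_ * _ - _).
by apply: eq_bigr => j ji; rewrite !mxE eqxx /= (negbTE ji) mulr0 add0r.
Qed.

Lemma continuous_prod_coord (g : 'I_d -> R -> R) (P : pred 'I_d) :
  (forall j, continuous (g j)) ->
  continuous (fun x : 'rV[R]_d => \prod_(j | P j) g j (x ord0 j)).
Proof.
move=> cg; elim: (index_enum _) => [|j s IH] x.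
  rewrite (_ : (fun x => _) = fun=> 1); first exact: cst_continuous.
  by apply/funext => y; rewrite big_nil.
have [Pj|/negbTE Pj] := boolP (P j); last first.
  rewrite (_ : (fun x => _) = fun x : 'rV[R]_d => \prod_(j <- s | P j) g j (x ord0 j)).
    exact: (IH x).
  by apply/funext => y; rewrite big_cons Pj.
rewrite (_ : (fun x => _) = fun x : 'rV[R]_d =>
    g j (x ord0 j) * \prod_(j <- s | P j) g j (x ord0 j)); last first.
  by apply/funext => y; rewrite big_cons Pj.
apply: continuousM; last exact: (IH x).
have cgj : continuous (g j \o (fun y : 'rV[R]_d => y ord0 j)).
  by move=> y; apply: continuous_comp; [exact: coord_continuous|exact: cg].
exact: (cgj x).
Qed.

Let cf j : continuous (f j).
Proof.
move=> t; have [/derivable1_diffP/differentiable_continuous] := df j t.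
by [].
Qed.

Lemma tensor_C1c (Omega : set 'rV[R]_d) (a b : 'I_d -> R) :
  (forall x : 'rV[R]_d, (forall j, a j <= x ord0 j <= b j) -> Omega x) ->
  (forall j (t : R), ~ (a j <= t <= b j) -> f j t = 0) ->
  C1c Omega tensor.
Proof.
move=> abO f0; split.
- exact: continuous_prod_coord.
- move=> i; split => [x|]; first by have [] := is_derive_tensor i x.
  have -> : 'D_(e_ i) tensor = dtensor i.
    by apply/funext => x; have [] := is_derive_tensor i x.
  move=> x; apply: continuousM; last exact: continuous_prod_coord.
  have cfi : continuous (f' i \o (fun y : 'rV[R]_d => y ord0 i)).
    by move=> y; apply: continuous_comp; [exact: coord_continuous|exact: cf'].
  exact: (cfi x).
- exists [set v : 'rV[R]_d | forall i, `[a i, b i]%classic (v ord0 i)]; split.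
  + by apply: (@rV_compact _ _ (fun i => `[a i, b i]%classic)) => i; exact: segment_compact.
  + by move=> x /= H; apply: abO => j; have := H j; rewrite in_itv.
  + move=> x; rewrite -existsNE => -[j]; rewrite /= in_itv/= => H.
    by rewrite (tensorE j) f0// mul0r.
Qed.

End tensor_test_function.

Lemma integral_indic_itvoo {R : realType} (a b : R) :
  (\int[@lebesgue_measure R]_s (\1_(`]a, b[%classic) s)%:E = (Num.max 0 (b - a))%:E)%E.
Proof.
rewrite integral_indic// setIT.
transitivity (@lebesgue_measure R `]a, b[%classic); first by [].
rewrite lebesgue_measure_itv/= lte_fin; case: ltP => ab.
  by rewrite -EFinB max_r// subr_ge0 ltW.
by rewrite max_l// subr_le0.
Qed.

(** * Absolute continuity on lines *)

Section fibre_operator.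
Context {R : realType} {d : nat}.
Local Notation leb := (lebesgue_rV d : {sigma_finite_measure set 'rV[R]_d -> \bar R}).
Local Notation lam := (@lebesgue_measure R).
Local Notation Z := (measurableTypeR R * 'rV[R]_d)%type.
Variables (i : 'I_d) (M C : R) (k : R -> R -> R) (gam : 'rV[R]_d -> R).
Hypothesis M0 : 0 <= M.
Hypothesis mk : measurable_fun setT (fun z : Z => k z.1 (z.2 ord0 i)).
Hypothesis kC : forall r s, `|k r s| <= C.
Hypothesis kM : forall r s, ~ (0 < s < M) -> k r s = 0.
Hypothesis igam : leb.-integrable setT (EFin \o gam).

Let mgam : measurable_fun setT gam.
Proof. by move/measurable_int: igam => /measurable_EFinP. Qed.

Let C0 : 0 <= C.
Proof. exact: le_trans (kC 0 0). Qed.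

(** One form for the two operators needed below: the primitive along a line (kernel [kG]) and the
    weighted average over a line (kernel [kw]). *)
Definition fibre_op (x : 'rV[R]_d) : R :=
  \int[lam]_r (k r (x ord0 i) * gam (upd i r x)).

Let mupd : measurable_fun setT (fun z : Z => upd i z.1 z.2).
Proof. by apply: measurable_upd; [exact: measurable_fst|exact: measurable_snd]. Qed.

Let mF : measurable_fun setT
  (fun z : Z => k z.1 (z.2 ord0 i) * gam (upd i z.1 z.2)).
Proof. by apply: measurable_funM => //; exact: measurableT_comp. Qed.

(** The dominating function is C times the indicator of 0 < x_i < M times |gam (upd i r x)|. After
    the swap the indicator is integrated alone and gives M, so the total is C M times the L^1 norm
    of [gam]. *)
Lemma fibre_op_integrable2 : (lam \x leb)%E.-integrable setT
  (fun z : Z => (k z.1 (z.2 ord0 i) * gam (upd i z.1 z.2))%:E).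
Proof.
pose H (z : Z) := (C * \1_(`]0, M[%classic) (z.2 ord0 i) * `|gam (upd i z.1 z.2)|)%:E.
have mH : measurable_fun setT H.
  apply/measurable_EFinP; apply: measurable_funM.
    apply: measurable_funM; first exact: measurable_cst.
    apply: measurableT_comp; first exact: measurable_indic.
    by apply: measurable_coord; exact: measurable_snd.
  by apply: measurableT_comp => //; exact: measurableT_comp.
have H0 z : (0 <= H z)%E by rewrite lee_fin !mulr_ge0.
apply: (@le_integrable _ _ _ _ _ _ _ H) => //.
- exact/measurable_EFinP.
- move=> [s x] _; rewrite [leRHS]gee0_abs// abse_EFin lee_fin normrM ler_wpM2r//= indicE.
  case: (boolP (_ \in _)) => [|H1]; first by rewrite mulr1.
  rewrite kM ?normr0 ?mulr0// => /= H2; move/negP: H1; apply.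
  by rewrite inE/= in_itv.
apply/integrable21ltyP => //.
under eq_integral do under eq_integral do rewrite gee0_abs//.
rewrite (tonelli_swap i)//.
rewrite (_ : (fun x => _) = fun x => (C * M)%:E * `|(gam x)%:E|)%E.
  rewrite ge0_integralZl//; last 2 first.
  - by apply: measurableT_comp => //; exact/measurable_EFinP.
  - by rewrite lee_fin mulr_ge0.
  by rewrite lte_mul_pinfty ?lee_fin ?mulr_ge0//; case/integrableP: igam.
apply/funext => x; rewrite /H/=.
under eq_integral => s _ do rewrite upd_upd upd_id upd_eq mulrAC EFinM.
rewrite ge0_integralZl//; last 2 first.
- by apply/measurable_EFinP; exact: measurable_indic.
- by rewrite lee_fin mulr_ge0.
by rewrite integral_indic_itvoo subr0 max_r// -EFinM mulrAC.
Qed.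

Lemma fibre_op_ae : {ae leb, forall x : 'rV[R]_d, lam.-integrable setT
  (fun r => (k r (x ord0 i) * gam (upd i r x))%:E)}.
Proof. exact: ae_integrable2 fibre_op_integrable2. Qed.

Lemma integrable_fibre_op : leb.-integrable setT (EFin \o fibre_op).
Proof.
pose F (z : Z) := (k z.1 (z.2 ord0 i) * gam (upd i z.1 z.2))%:E.
have iF : (lam \x leb)%E.-integrable setT F := fibre_op_integrable2.
have mFE : measurable_fun setT F by exact: measurable_int iF.
apply/integrableP; split.
  apply/measurable_EFinP.
  rewrite [X in measurable_fun _ X](_ : _ = fine \o fubini_G lam F)//.
  apply: measurableT_comp => //.
  exact: (measurable_fubini_G iF).
apply: le_lt_trans ((integrable21ltyP lam leb mFE).1 iF).
apply: ge0_le_integral => //.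
- apply/measurable_EFinP; apply: measurableT_comp => //.
  rewrite [X in measurable_fun _ X](_ : _ = fine \o fubini_G lam F)//.
  apply: measurableT_comp => //.
  exact: (measurable_fubini_G iF).
- apply: (measurable_fun_fubini_tonelli_G (abse \o F)) => //=.
  exact: measurableT_comp.
move=> x _; apply: le_trans (le_abse_integral _ _ _) => //; last first.
  exact: (measurableT_comp mFE).
rewrite /fibre_op /Rintegral /=.
by case: (integral _ _ _) => [r| |] //=; rewrite normr0 leey.
Qed.

Hypothesis mk1 : forall r, measurable_fun setT (k r).

(** Fubini and the swap move the kernel from [gam] to the test factor [c]; [eta], constant along the
    line, passes through. *)
Lemma fibre_op_dual (c : R -> R) (eta : 'rV[R]_d -> R) :
  measurable_fun setT c -> (exists D, forall s, `|c s| <= D) ->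
  measurable_fun setT eta -> (exists D, forall x, `|eta x| <= D) ->
  (forall s x, eta (upd i s x) = eta x) ->
  \int[leb]_x (fibre_op x * (c (x ord0 i) * eta x)) =
  \int[leb]_x (gam x * (eta x * \int[lam]_s (k (x ord0 i) s * c s))).
Proof.
move=> mc [Dc cD] meta [De etaD] etaE.
pose F (z : Z) := (k z.1 (z.2 ord0 i) * gam (upd i z.1 z.2) *
  (c (z.2 ord0 i) * eta z.2))%:E.
have iF : (lam \x leb)%E.-integrable setT F.
  apply: (@le_integrable _ _ _ _ _ _ _ (fun z : Z =>
      ((Dc * De)%:E * (k z.1 (z.2 ord0 i) * gam (upd i z.1 z.2))%:E)%E)) => //.
  - apply/measurable_EFinP; apply: measurable_funM => //.
    apply: measurable_funM.
      by apply: measurableT_comp => //; apply: measurable_coord; exact: measurable_snd.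
    by apply: measurableT_comp => //; exact: measurable_snd.
  - move=> z _; rewrite -EFinM !abse_EFin lee_fin mulrC !normrM.
    rewrite ler_wpM2r ?mulr_ge0//.
    rewrite ler_pM//; first exact: (le_trans (cD _) (ler_norm _)).
    exact: (le_trans (etaD _) (ler_norm _)).
  - by apply: integrableZl => //; exact: fibre_op_integrable2.
congr fine; transitivity (\int[leb]_x \int[lam]_r F (r, x))%E.
  (* The factor c eta leaves the inner integral only on the lines where the fibre is integrable,
     hence almost everywhere. *)
  apply: ae_eq_integral => //.
  - apply/measurable_EFinP; apply: measurable_funM.
      by have /measurable_int/measurable_EFinP := integrable_fibre_op.
    apply: measurable_funM => //.
    by apply: measurableT_comp => //; exact: measurable_coord.
  - exact: (measurable_fubini_G iF).
  apply: filterS fibre_op_ae => x ix _; rewrite /F /=.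
  under [RHS]eq_integral do rewrite EFinM.
  rewrite integralZr// EFinM; congr (_ * _)%E.
  by rewrite /fibre_op /Rintegral fineK//; exact: integrable_fin_num.
rewrite (fubini_swap i)//; apply: eq_integral => x _; rewrite /F/=.
under eq_integral do rewrite upd_upd upd_id upd_eq etaE.
transitivity (\int[lam]_s ((gam x * eta x)%:E * (k (x ord0 i) s * c s)%:E))%E.
  by apply: eq_integral => s _; rewrite -EFinM; congr EFin; ring.
have ikc : lam.-integrable setT (EFin \o (fun s => k (x ord0 i) s * c s)).
  pose H (s : measurableTypeR R) := ((C * Dc)%:E * (\1_(`]0%R, M[%classic) s)%:E)%E.
  apply: (@le_integrable _ _ _ _ _ _ _ H) => //.
  - by apply/measurable_EFinP; apply: measurable_funM; [exact: mk1|exact: mc].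
  - move=> s _; rewrite /H -EFinM !abse_EFin lee_fin [leLHS]normrM [leRHS]ger0_norm; last first.
      by rewrite !mulr_ge0// (le_trans _ (cD 0)).
    rewrite indicE; case: (boolP (_ \in _)) => [_|H1].
      by rewrite mulr1 ler_pM.
    rewrite kM ?normr0 ?mul0r ?mulr0// => H2; move/negP: H1; apply.
    by rewrite inE/= in_itv.
  - by apply: integrableZl => //; exact: integrable_indic_itv.
rewrite integralZl// [in RHS]mulrA [in RHS]EFinM; congr (_ * _)%E.
by rewrite /Rintegral fineK//; exact: integrable_fin_num.
Qed.

End fibre_operator.

Section primitive.
Context {R : realType}.
Local Notation lam := (@lebesgue_measure R).
Variables (q : R -> R) (lo hi C : R).
Hypothesis cq : continuous q.
Hypothesis qC : forall t, `|q t| <= C.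
Hypothesis q0 : forall t, ~ (lo < t < hi) -> q t = 0.

Lemma measurable_continuous : measurable_fun setT q.
Proof. exact: continuous_measurable_fun. Qed.

Lemma integrable_compact_support : lam.-integrable setT (EFin \o q).
Proof.
pose H (s : measurableTypeR R) := (C%:E * (\1_(`]lo, hi[%classic) s)%:E)%E.
apply: (@le_integrable _ _ _ _ _ _ _ H) => //.
- by apply/measurable_EFinP; exact: measurable_continuous.
- move=> s _; rewrite /H -EFinM !abse_EFin lee_fin normrM indicE.
  case: (boolP (_ \in _)) => [_|H1].
    by rewrite normr1 mulr1 (le_trans (qC _) (ler_norm _)).
  rewrite q0 ?normr0 ?mulr0// => H2; move/negP: H1; apply.
  by rewrite inE/= in_itv.
- by apply: integrableZl => //; exact: integrable_indic_itv.
Qed.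

Hypothesis Iq : \int[lam]_t q t = 0.

Definition primitive t : R := \int[lam]_(s in `]-oo, t]) q s.

Lemma is_derive_primitive (t : R) : is_derive t 1 primitive (q t).
Proof.
have tu : t < t + 1 by rewrite ltrDl.
have iq : lam.-integrable `]-oo, (t + 1)] (EFin \o q).
  by apply: integrableS integrable_compact_support.
have [|d1 d2] := continuous_FTC1 tu iq _ (@cq t); first exact: ltNyr.
split; first exact: d1.
by rewrite -derive1E; exact: d2.
Qed.

(** Since q has integral 0. The adjoint of the primitive integrates over s > t, and this identifies
    it with minus a primitive, as in an integration by parts. *)
Lemma primitive_tail t : \int[lam]_(s in `]t, +oo[) q s = - primitive t.
Proof.
apply/eqP; rewrite -addr_eq0 addrC; apply/eqP; rewrite -Iq.
have iq := integrable_compact_support.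
rewrite -(setUv `]-oo, t]%classic) setCitvl Rintegral_setU//.
- by rewrite -setCitvl setUv.
- rewrite -setCitvl; apply/eqP; exact: setICr.
Qed.

Lemma primitive_eq0 t : ~ (lo <= t <= hi) -> primitive t = 0.
Proof.
have [lot|tlo _] := leP lo t; last first.
  rewrite /primitive; under eq_Rintegral => s.
    rewrite inE/= in_itv/= => st; rewrite q0; last first.
      by move=> /andP[los _]; move: (lt_trans los (le_lt_trans st tlo)); rewrite ltxx.
    over.
  by rewrite Rintegral_cst// mul0r.
have [thi []//|hit _] := leP t hi.
(* To the right of the support, the vanishing total integral is what brings the primitive back to
   0. *)
rewrite -[LHS]opprK -primitive_tail; apply/eqP; rewrite oppr_eq0; apply/eqP.
under eq_Rintegral => s.
  rewrite inE/= in_itv/= andbT => st; rewrite q0; last first.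
    by move=> /andP[_ shi]; move: (lt_trans (lt_trans hit st) shi); rewrite ltxx.
  over.
by rewrite Rintegral_cst// mul0r.
Qed.

Lemma primitive_bounded : exists D, forall t, `|primitive t| <= D.
Proof.
have iq := integrable_compact_support; exists (fine (\int[lam]_s `|(q s)%:E|)%E) => t.
have iqt : lam.-integrable `]-oo, t] (EFin \o q) by exact: integrableS iq.
rewrite -lee_fin EFin_normr_Rintegral// fineK; last first.
  by apply: integrable_fin_num => //; exact: integrable_abse iq.
apply: le_trans (le_abse_integral _ _ _) _ => //; first exact: measurable_int iqt.
apply: ge0_subset_integral => //.
by apply: measurableT_comp => //; exact: measurable_int iq.
Qed.

Lemma measurable_primitive : measurable_fun setT primitive.
Proof.
apply: continuous_measurable_fun => t.
by have [/derivable1_diffP/differentiable_continuous] := is_derive_primitive t.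
Qed.

End primitive.

Lemma measurable_natr_bool {R : realType} dT (T : measurableType dT) (b : T -> bool) :
  measurable_fun setT b -> measurable_fun setT (fun x => (b x)%:R : R).
Proof.
move=> mb; rewrite (_ : (fun x => _) = \1_(b @^-1` [set true])); last first.
  apply/funext => x; rewrite indicE; case E: (b x).
    by rewrite mem_set.
  by rewrite memNset//= E.
apply: measurable_indic; rewrite -[X in measurable X]setTI; exact: mb.
Qed.

Lemma thirds {R : realType} (r : R) : 0 < r ->
  [/\ 0 < r / 3, r / 3 < 2 * r / 3, 0 < 2 * r / 3 & 2 * r / 3 < r].
Proof. by move=> r0; split; lra. Qed.

Lemma measurable_prod_coord {R : realType} {d : nat} (h : 'I_d -> R -> R)
    (P : pred 'I_d) : (forall j, measurable_fun setT (h j)) ->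
  measurable_fun setT (fun x : 'rV[R]_d => \prod_(j | P j) h j (x ord0 j)).
Proof.
move=> mh; elim: (index_enum _) => [|j s IH].
  rewrite (_ : (fun x => _) = fun=> 1); first exact: measurable_cst.
  by apply/funext => y; rewrite big_nil.
have [Pj|/negbTE Pj] := boolP (P j); last first.
  rewrite (_ : (fun x => _) = fun x : 'rV[R]_d => \prod_(j <- s | P j) h j (x ord0 j)) //.
  by apply/funext => y; rewrite big_cons Pj.
rewrite (_ : (fun x => _) = fun x : 'rV[R]_d =>
    h j (x ord0 j) * \prod_(j <- s | P j) h j (x ord0 j)); last first.
  by apply/funext => y; rewrite big_cons Pj.
apply: measurable_funM => //.
by apply: (measurableT_comp (mh j)); exact: measurable_coord.
Qed.

(** * Recovering a Sobolev function from its weak derivative on almost every line *)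

Section absolutely_continuous_on_lines.
Context {R : realType} {d : nat}.
Local Notation leb := (lebesgue_rV d : {sigma_finite_measure set 'rV[R]_d -> \bar R}).
Local Notation lam := (@lebesgue_measure R).
Local Notation Z := (measurableTypeR R * 'rV[R]_d)%type.
Local Notation e_ i := (delta_mx ord0 i : 'rV[R]_d).
Variables (Omega : set 'rV[R]_d) (M kap : R) (i : 'I_d) (u g : 'rV[R]_d -> R).
Hypothesis kap0 : 0 < kap.
Hypothesis M0 : 0 <= M.
Hypothesis OM : forall x, Omega x -> forall j, 0 < x ord0 j < M.
(** With [Olow]: a line parallel to an axis that meets the domain does so in an interval starting at
    0 and containing ]0, kap[, which makes integration from 0 legitimate and gives all these lines a
    common segment to average over. *)
Hypothesis Odown : forall (b x : 'rV[R]_d), Omega b ->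
  (forall j, 0 < x ord0 j <= b ord0 j) -> Omega x.
Hypothesis Olow : forall (x : 'rV[R]_d) j t, Omega x -> 0 < t < kap -> Omega (upd j t x).
Hypothesis Oopen : open Omega.
Hypothesis iu : leb.-integrable setT (EFin \o u).
Hypothesis ig : leb.-integrable setT (EFin \o g).
Hypothesis g0 : forall x, ~ Omega x -> g x = 0.
Hypothesis weak : forall phi, C1c Omega phi ->
  \int[leb]_x (u x * 'D_(e_ i) phi x) = - \int[leb]_x (g x * phi x).

(* fibreG is the primitive of g along the axis i, and W = u - fibreG; W = w almost
   everywhere on Omega says that W does not depend on the coordinate i, w being the average
   of W with the weight rhoJ / cJ, carried by ]0, kap[, on which every line through
   Omega stays inside Omega. *)
Definition kG (r s : R) : R := ((0 < r < s) && (s < M))%R%:R.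

Definition rhoJ : R -> R := smooth_bump 1%N (kap / 3) (2 * kap / 3).

Definition cJ : R := \int[lam]_t rhoJ t.

Definition kw (r s : R) : R := (0 < s < M)%R%:R * (rhoJ r / cJ).

Definition fibreG := fibre_op i kG g.

Definition W x := u x - fibreG x.

Definition w := fibre_op i kw W.

Lemma continuous_smooth_bump n (a b : R) : continuous (smooth_bump n a b).
Proof.
move=> t; have [/derivable1_diffP/differentiable_continuous] := is_derive_smooth_bump n a b t.
by [].
Qed.

Lemma norm_smooth_bump_le1 n (a b t : R) : `|smooth_bump n a b t| <= 1.
Proof. by rewrite ger0_norm ?smooth_bump_ge0// smooth_bump_le1. Qed.

Lemma measurable_smooth_bump n (a b : R) : measurable_fun setT (smooth_bump n a b).
Proof. exact: continuous_measurable_fun (@continuous_smooth_bump n a b). Qed.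

Lemma integrable_smooth_bump n (a b : R) : lam.-integrable setT (EFin \o smooth_bump n a b).
Proof.
apply: (@integrable_compact_support _ _ a b 1).
- exact: continuous_smooth_bump.
- exact: norm_smooth_bump_le1.
- by move=> t; exact: smooth_bump_eq0.
Qed.

(** Otherwise [rhoJ] would vanish almost everywhere, yet it is positive on an interval of positive
    length. *)
Lemma cJ_gt0 : 0 < cJ.
Proof.
rewrite lt_neqAle Rintegral_ge0 ?andbT; last by move=> t _; exact: smooth_bump_ge0.
apply/eqP => c0.
have I0 : (\int[lam]_t `|(rhoJ t)%:E| = 0)%E.
  under eq_integral do rewrite gee0_abs ?lee_fin ?smooth_bump_ge0//.
  rewrite -[LHS]fineK; last by apply: integrable_fin_num => //; exact: integrable_smooth_bump.
  by rewrite -[fine _]/cJ -c0.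
have mrho : measurable_fun setT (EFin \o rhoJ).
  by apply/measurable_EFinP; exact: measurable_smooth_bump.
have [/(_ I0)[A [mA A0 sub]] _] := ae_eq_integral_abs lam measurableT mrho.
have /(le_measure lam) : (`]kap / 3, 2 * kap / 3[%classic `<=` A)%classic.
  move=> t; rewrite /= in_itv/= => tk; apply: sub => /= /(_ I) [rt].
  by have := smooth_bump_gt0 (n:=1) isT tk; rewrite -/rhoJ -/(rhoJ t) rt ltxx.
rewrite !inE => /(_ (measurable_itv _) mA) H.
have : (@lebesgue_measure R `](kap / 3)%R, (2 * kap / 3)%R[%classic <= 0)%E.
  by rewrite -A0; exact: H.
have [_ k3 _ _] := thirds kap0.
by rewrite lebesgue_measure_itv/= lte_fin k3 -EFinB lee_fin subr_le0 leNgt k3.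
Qed.

Let mcoordz : measurable_fun setT (fun z : Z => z.2 ord0 i).
Proof. by apply: measurable_coord; exact: measurable_snd. Qed.

Lemma measurable_kG : measurable_fun setT (fun z : Z => kG z.1 (z.2 ord0 i)).
Proof.
apply: measurable_natr_bool; apply: measurable_and; first apply: measurable_and.
- by apply: measurable_fun_ltr => //; exact: measurable_fst.
- by apply: measurable_fun_ltr => //; exact: measurable_fst.
- exact: measurable_fun_ltr.
Qed.

Let mkw : measurable_fun setT (fun z : Z => kw z.1 (z.2 ord0 i)).
Proof.
apply: measurable_funM.
  by apply: measurable_natr_bool; apply: measurable_and; exact: measurable_fun_ltr.
apply: measurable_funM => //.
by apply: measurableT_comp; [exact: measurable_smooth_bump|exact: measurable_fst].
Qed.

Lemma kG_le1 r s : `|kG r s| <= 1.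
Proof. by rewrite /kG; case: (_ && _); rewrite ?normr1 ?normr0. Qed.

Let kw_le r s : `|kw r s| <= cJ^-1.
Proof.
have c0 : 0 <= cJ^-1 by rewrite invr_ge0 ltW// cJ_gt0.
rewrite /kw normrM [`|rhoJ r / cJ|]normrM [`|cJ^-1|]ger0_norm//.
case: (_ && _); last by rewrite normr0 mul0r.
by rewrite normr1 mul1r ler_piMl//; exact: norm_smooth_bump_le1.
Qed.

Lemma kG_eq0 r s : ~ (0 < s < M) -> kG r s = 0.
Proof.
move=> H; rewrite /kG; case E: (_ && _) => //; case: H.
move: E => /andP[/andP[r0 rs] sM].
by rewrite sM (lt_trans r0 rs).
Qed.

Let kw_eq0 r s : ~ (0 < s < M) -> kw r s = 0.
Proof. by move=> /negP/negbTE H; rewrite /kw H mul0r. Qed.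

Let mkG1 r : measurable_fun setT (kG r).
Proof.
apply: measurable_natr_bool; apply: measurable_and; last exact: measurable_fun_ltr.
by apply: measurable_and; exact: measurable_fun_ltr.
Qed.

Let mkw1 r : measurable_fun setT (kw r).
Proof.
apply: measurable_funM => //.
by apply: measurable_natr_bool; apply: measurable_and; exact: measurable_fun_ltr.
Qed.

Lemma integrable_fibreG : leb.-integrable setT (EFin \o fibreG).
Proof. exact: (integrable_fibre_op M0 measurable_kG kG_le1 kG_eq0 ig). Qed.

Lemma integrable_W : leb.-integrable setT (EFin \o W).
Proof.
rewrite (_ : EFin \o W = (EFin \o u) \- (EFin \o fibreG))%E//.
by apply: integrableB => //; exact: integrable_fibreG.
Qed.

Lemma integrable_w : leb.-integrable setT (EFin \o w).
Proof. exact: (integrable_fibre_op M0 mkw kw_le kw_eq0 integrable_W). Qed.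

Lemma integrable_mul_bounded (f h : 'rV[R]_d -> R) D :
  leb.-integrable setT (EFin \o f) -> measurable_fun setT h ->
  (forall x, `|h x| <= D) -> leb.-integrable setT (EFin \o (fun x => f x * h x)).
Proof.
move=> fi mh hD; apply: (@le_integrable _ _ _ _ _ _ _ (fun x => D%:E * (f x)%:E)%E) => //.
- apply/measurable_EFinP; apply: measurable_funM => //.
  by apply/measurable_EFinP; exact: measurable_int fi.
- move=> x _; rewrite -EFinM !abse_EFin lee_fin !normrM mulrC ler_wpM2r//.
  exact: (le_trans (hD x) (ler_norm _)).
- exact: integrableZl.
Qed.

Section test_box.
Variables (a b : 'I_d -> R).
Hypothesis a0 : forall j, 0 < a j < b j.
Hypothesis Ob : Omega (\row_j b j).
Variable n : nat.

(* Subtracting a multiple of rhoJ gives q integral 0, so that its primitive has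
   compact support and yields a test function. *)
Let f := smooth_bump n (a i) (b i).
Let cn := \int[lam]_t f t.
Let q t := f t - cn / cJ * rhoJ t.
Let eta (x : 'rV[R]_d) := \prod_(j | j != i) smooth_bump n (a j) (b j) (x ord0 j).
Let lo := Num.min (a i) (kap / 3).
Let hi := Num.max (b i) (2 * kap / 3).

Let q_eq0 t : ~ (lo < t < hi) -> q t = 0.
Proof.
move=> H; rewrite /q /f /rhoJ !smooth_bump_eq0 ?mulr0 ?subr0//.
  move=> /andP[t1 t2]; apply: H.
  by rewrite gt_min t1 orbT lt_max t2 orbT.
move=> /andP[t1 t2]; apply: H.
by rewrite gt_min t1 lt_max t2.
Qed.

Let cq : continuous q.
Proof.
move=> t; apply: cvgB; first exact: continuous_smooth_bump.
by apply: cvgM; [exact: cvg_cst|exact: continuous_smooth_bump].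
Qed.

Let qD t : `|q t| <= 1 + `|cn / cJ|.
Proof.
apply: (le_trans (ler_normB _ _)); apply: lerD; first exact: norm_smooth_bump_le1.
by rewrite normrM ler_piMr//; exact: norm_smooth_bump_le1.
Qed.

Let Iq : \int[lam]_t q t = 0.
Proof.
have i1 := integrable_smooth_bump n (a i) (b i).
have i2 := integrable_smooth_bump 1%N (kap / 3) (2 * kap / 3).
have i3 : lam.-integrable setT (EFin \o (fun t => cn / cJ * rhoJ t)).
  rewrite (_ : _ \o _ = fun t => (cn / cJ)%:E * (rhoJ t)%:E)%E; last first.
    by apply/funext => t /=; rewrite EFinM.
  exact: integrableZl.
rewrite RintegralB// RintegralZl// -/cn -/cJ -mulrA mulVf ?mulr1 ?subrr//.
by rewrite gt_eqF// cJ_gt0.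
Qed.

Let psi := primitive q.

Let meta : measurable_fun setT eta.
Proof.
apply: (@measurable_prod_coord _ _ (fun j => smooth_bump n (a j) (b j))) => j.
exact: measurable_smooth_bump.
Qed.

Let eta_ge0 x : 0 <= eta x.
Proof. by apply: prodr_ge0 => j _; exact: smooth_bump_ge0. Qed.

Let eta_le1 x : `|eta x| <= 1.
Proof.
rewrite ger0_norm//; apply: prodr_ile1 => j _.
by rewrite smooth_bump_ge0 smooth_bump_le1.
Qed.

Let etaE s x : eta (upd i s x) = eta x.
Proof. by apply: eq_bigr => j ji; rewrite upd_neq. Qed.

(** The support of [psi] may extend past [b i], up to 2 kap / 3. By [Olow] the enlarged upper corner
    stays in the domain, and by [Odown] so does the whole support of the test function. *)
Let Ohi : Omega (upd i hi (\row_j b j)).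
Proof.
have [k1 _ k2 k3] := thirds kap0.
rewrite /hi; case: leP => _; first by apply: Olow => //; rewrite k2.
have -> : upd i (b i) (\row_j b j) = \row_j b j; last by [].
by apply/rowP => j; rewrite updE !mxE; case: eqP => // ->.
Qed.

(** The test function is the tensor product of [psi] along axis [i] with the bumps along the others;
    its [i]-th derivative is q eta. *)
Let weak_psi :
  \int[leb]_x (u x * (q (x ord0 i) * eta x)) = - \int[leb]_x (g x * (psi (x ord0 i) * eta x)).
Proof.
pose F j := if j == i then psi else smooth_bump n (a j) (b j).
pose F' j := if j == i then q else dbump n (a j) (b j).
have dF j (t : R) : is_derive t (1 : R) (F j) (F' j t).
  rewrite /F /F'; case: eqP => _; last exact: is_derive_smooth_bump.
  exact: (is_derive_primitive cq qD q_eq0).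
have cF' j : continuous (F' j).
  by rewrite /F'; case: eqP => _ //; exact: continuous_dbump.
have etaF (x : 'rV[R]_d) : \prod_(j | j != i) F j (x ord0 j) = eta x.
  by apply: eq_bigr => j /negbTE ji; rewrite /F ji.
have tF x : tensor F x = psi (x ord0 i) * eta x.
  by rewrite (tensorE F i) etaF /F eqxx.
have dtF x : 'D_(e_ i) (tensor F) x = q (x ord0 i) * eta x.
  by have [_ ->] := is_derive_tensor dF i x; rewrite /dtensor etaF /F' eqxx.
under eq_Rintegral do rewrite -dtF.
under [in RHS]eq_Rintegral do rewrite -tF.
apply: weak; apply: (tensor_C1c dF cF' (a := fun j => if j == i then lo else a j)
   (b := fun j => if j == i then hi else b j)).
- have [k1 _ k2 k3] := thirds kap0.
  move=> x xab; have xi : lo <= x ord0 i <= hi by have := xab i; rewrite eqxx.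
  have lo0 : 0 < lo by rewrite lt_min; case/andP: (a0 i) => -> _.
  apply: Odown Ohi _ => j; rewrite updE mxE.
  have := xab j; case: eqP => [->|_] /andP[x1 x2].
    by rewrite x2 (lt_le_trans lo0).
  by rewrite x2 andbT; case/andP: (a0 j) => /lt_le_trans ->.
- move=> j t; rewrite /F; case: eqP => _ H.
    exact: (primitive_eq0 cq qD q_eq0 Iq).
  apply: smooth_bump_eq0 => /andP[t1 t2]; apply: H.
  by rewrite !ltW.
Qed.

(** Integration by parts for the explicit primitive [fibreG], by duality: it satisfies against q eta
    the same identity as [u]. *)
Let dual_psi : \int[leb]_x (fibreG x * (q (x ord0 i) * eta x)) =
  - \int[leb]_x (g x * (psi (x ord0 i) * eta x)).
Proof.
have mq : measurable_fun setT q := measurable_continuous cq.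
rewrite (fibre_op_dual M0 measurable_kG kG_le1 kG_eq0 ig mkG1 mq)//; last 2 first.
- by exists (1 + `|cn / cJ|).
- by exists 1.
have mpsi : measurable_fun setT psi := measurable_primitive cq qD q_eq0.
have [D psiD] := primitive_bounded cq qD q_eq0.
rewrite -[RHS]mulN1r -RintegralZl//; last first.
  apply: (integrable_mul_bounded (D := D) ig).
    apply: measurable_funM => //.
    by apply: (measurableT_comp mpsi); exact: measurable_coord.
  by move=> x; rewrite normrM; apply: le_trans (psiD (x ord0 i)); rewrite ler_piMr.
apply: eq_Rintegral => x _; have [Ox|Ox] := pselect (Omega x); last first.
  by rewrite g0// !mul0r mulr0.
rewrite mulN1r -mulrN [_ * eta x]mulrC -mulrN; congr (_ * (_ * _)).
rewrite -(primitive_tail cq qD q_eq0 Iq) [RHS]Rintegral_mkcond.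
apply: eq_Rintegral => s _; rewrite patchE.
have /andP[x0 xM] := OM Ox i; rewrite /kG x0/=.
case: ifPn => [|]; rewrite ?inE ?notin_setE /= in_itv/= andbT.
  move=> xs; rewrite xs/=; case: ltP => [_|Ms]; first by rewrite mul1r.
  (* The kernel is cut off at [M], but [q] already vanishes there because [hi] is below [M]. *)
  rewrite q_eq0 ?mulr0// => /andP[_ sh].
  have := OM Ohi i; rewrite upd_eq => /andP[_ hM].
  by have := lt_trans (lt_le_trans hM Ms) sh; rewrite ltxx.
by move=> /negP/negbTE ->; rewrite mul0r.
Qed.

(** Subtracting [dual_psi] from [weak_psi], W integrates to 0 against q eta; hence its integral
    against f eta is cn / cJ times the one against rhoJ eta. By duality, the integral of w against f
    eta has this same value. *)
Lemma integral_W_w : \int[leb]_x ((W x - w x) *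
  \prod_j smooth_bump n (a j) (b j) (x ord0 j)) = 0.
Proof.
have mf : measurable_fun setT f by exact: measurable_smooth_bump.
have mq : measurable_fun setT q := measurable_continuous cq.
have mrho : measurable_fun setT rhoJ by exact: measurable_smooth_bump.
have mc (c : R -> R) : measurable_fun setT c ->
  measurable_fun setT (fun x : 'rV[R]_d => c (x ord0 i) * eta x).
  move=> mc; apply: measurable_funM => //.
  by apply: (measurableT_comp mc); exact: measurable_coord.
have bc (c : R -> R) D : (forall t, `|c t| <= D) ->
  forall x : 'rV[R]_d, `|c (x ord0 i) * eta x| <= D.
  move=> cD x; rewrite normrM; apply: le_trans (cD (x ord0 i)).
  by rewrite ler_piMr.
have iWc (c : R -> R) D (v : 'rV[R]_d -> R) : measurable_fun setT c ->
    (forall t, `|c t| <= D) -> leb.-integrable setT (EFin \o v) ->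
    leb.-integrable setT (EFin \o (fun x => v x * (c (x ord0 i) * eta x))).
  move=> m1 cD iv; apply: integrable_mul_bounded iv _ _; [exact: mc|exact: bc cD].
have b1 t : `|f t| <= 1 by exact: norm_smooth_bump_le1.
have b2 t : `|rhoJ t| <= 1 by exact: norm_smooth_bump_le1.
have E2 : \int[leb]_x (W x * (q (x ord0 i) * eta x)) = 0.
  rewrite /W; under eq_Rintegral do rewrite mulrBl.
  rewrite RintegralB//; last 2 first.
  - exact: iWc qD iu.
  - exact: iWc qD integrable_fibreG.
  by rewrite dual_psi weak_psi subrr.
have E3 : \int[leb]_x (W x * (f (x ord0 i) * eta x)) =
    cn / cJ * \int[leb]_x (W x * (rhoJ (x ord0 i) * eta x)).
  rewrite -RintegralZl//; last exact: iWc b2 integrable_W.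
  apply/eqP; rewrite -subr_eq0; apply/eqP; rewrite -RintegralB//; last 2 first.
  - exact: iWc b1 integrable_W.
  - rewrite (_ : _ \o _ = fun x => (cn / cJ)%:E *
        (W x * (rhoJ (x ord0 i) * eta x))%:E)%E; last first.
      by apply/funext => x /=; rewrite EFinM.
    by apply: integrableZl => //; exact: iWc b2 integrable_W.
  by rewrite -[RHS]E2; apply: eq_Rintegral => x _; rewrite /q; ring.
have E4 : \int[leb]_x (w x * (f (x ord0 i) * eta x)) =
    cn / cJ * \int[leb]_x (W x * (rhoJ (x ord0 i) * eta x)).
  rewrite (fibre_op_dual M0 mkw kw_le kw_eq0 integrable_W mkw1 mf)//; last 2 first.
  - by exists 1.
  - by exists 1.
  rewrite -RintegralZl//; last exact: iWc b2 integrable_W.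
  apply: eq_Rintegral => x _.
  suff -> : \int[lam]_s (kw (x ord0 i) s * f s) = rhoJ (x ord0 i) / cJ * cn by ring.
  rewrite -RintegralZl//; last exact: integrable_smooth_bump.
  apply: eq_Rintegral => s _; rewrite /kw; case: (boolP (0 < s < M)) => [_|sM].
    by rewrite mul1r.
  rewrite /f smooth_bump_eq0 ?mulr0// => /andP[as_ sb]; case/negP: sM.
  have := OM Ob i; rewrite mxE => /andP[_ bM].
  by case/andP: (a0 i) => ai _; rewrite (lt_trans ai as_) (lt_trans sb bM).
have bigE (x : 'rV[R]_d) : \prod_j smooth_bump n (a j) (b j) (x ord0 j) = f (x ord0 i) * eta x.
  by rewrite (bigD1 i).
under eq_Rintegral do rewrite bigE mulrBl.
rewrite RintegralB//; last 2 first.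
- exact: iWc b1 integrable_W.
- exact: iWc b1 integrable_w.
by rewrite E3 E4 subrr.
Qed.

End test_box.

Lemma cvg_prod_smooth_bump (a b : 'I_d -> R) (x : 'rV[R]_d) :
  (fun n => \prod_j smooth_bump n (a j) (b j) (x ord0 j)) @ \oo -->
  (\1_(rbox (fun j => `]a j, b j[%classic)) x : R).
Proof.
have -> : (\1_(rbox (fun j => `]a j, b j[%classic)) x : R) =
    \prod_j (\1_(`]a j, b j[%classic) (x ord0 j) : R).
  rewrite indicE; case: (boolP (x \in _)) => [|xab].
    rewrite inE => xab; rewrite big1// => j _.
    by rewrite indicE mem_set//; exact: xab.
  have [j xj] : exists j, ~ `]a j, b j[%classic (x ord0 j).
    by apply/existsNP => H; move/negP: xab; apply; rewrite inE.
  by rewrite (bigD1 j)//= indicE memNset// mul0r.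
elim: (index_enum _) => [|j s IH].
  rewrite big_nil (_ : (fun n => _) = fun=> 1); first exact: cvg_cst.
  by apply/funext => n; rewrite big_nil.
rewrite big_cons (_ : (fun n => _) = fun n => smooth_bump n (a j) (b j) (x ord0 j) *
    \prod_(j <- s) smooth_bump n (a j) (b j) (x ord0 j)).
  by apply: cvgM => //; exact: cvg_smooth_bump.
by apply/funext => n; rewrite big_cons.
Qed.

Let iWw : leb.-integrable setT (EFin \o (fun x => W x - w x)).
Proof.
rewrite (_ : _ \o _ = (EFin \o W) \- (EFin \o w))%E//.
by apply: integrableB => //; [exact: integrable_W|exact: integrable_w].
Qed.

(** The limit of [integral_W_w] as the bumps tend to the indicator of the box; |W - w| dominates
    since the bumps are at most 1. *)
Lemma integral_box_W_w (a b : 'I_d -> R) : (forall j, 0 < a j < b j) ->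
  Omega (\row_j b j) ->
  (\int[leb]_x ((W x - w x) * \1_(rbox (fun j => `]a j, b j[%classic)) x)%:E = 0)%E.
Proof.
move=> a0 Ob; have mb := @measurable_rbox R d (fun j => `]a j, b j[%classic) _.
pose f_ n (x : 'rV[R]_d) :=
  ((W x - w x) * \prod_j smooth_bump n (a j) (b j) (x ord0 j))%:E.
have mWw : measurable_fun setT (fun x => W x - w x).
  by apply/measurable_EFinP; exact: measurable_int iWw.
have mp n : measurable_fun setT (fun x : 'rV[R]_d =>
    \prod_j smooth_bump n (a j) (b j) (x ord0 j)).
  apply: (@measurable_prod_coord _ _ (fun j => smooth_bump n (a j) (b j))) => j.
  exact: measurable_smooth_bump.
have p1 n (x : 'rV[R]_d) :  `|\prod_j smooth_bump n (a j) (b j) (x ord0 j)| <= 1.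
  rewrite ger0_norm; last by apply: prodr_ge0 => j _; exact: smooth_bump_ge0.
  by apply: prodr_ile1 => j _; rewrite smooth_bump_ge0 smooth_bump_le1.
have ip n : leb.-integrable setT (f_ n) by exact: (integrable_mul_bounded (D := 1) iWw).
have I0 n : (\int[leb]_x f_ n x = 0)%E.
  have H := integral_W_w a0 Ob n.
  rewrite -[LHS]fineK; last by apply: integrable_fin_num => //; exact: ip.
  by rewrite -[fine _]/(\int[leb]_x _) H.
have [] := @dominated_convergence _ _ _ leb setT measurableT f_
  (fun x => ((W x - w x) * \1_(rbox (fun j => `]a j, b j[%classic)) x)%:E)
  (fun x => `|(W x - w x)%:E|%E).
- by move=> n; exact: measurable_int (ip n).
- apply/measurable_EFinP; apply: measurable_funM => //.
  by apply: measurable_indic; apply: measurable_rbox => j; exact: measurable_itv.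
- apply: aeW => x _; apply: cvg_EFin; first exact: nearW.
  by apply: cvgM; [exact: cvg_cst|exact: cvg_prod_smooth_bump].
- exact: integrable_abse iWw.
- apply: aeW => x n _; rewrite /f_ !abse_EFin lee_fin normrM ler_piMr//.
move=> _ _; rewrite (_ : (fun n => _) = fun=> 0%E); last by apply/funext => n; exact: I0.
by move=> /cvg_lim <- //; rewrite lim_cst.
Qed.

(** A box cut by a ray is empty or a box with a smaller upper corner, which is still in the domain
    by [Odown]; so all integrals over rays vanish. *)
Lemma ae_box_W_w (a b : 'I_d -> R) : (forall j, 0 < a j < b j) ->
  Omega (\row_j b j) ->
  {ae leb, forall x, rbox (fun j => `]a j, b j[%classic) x -> W x = w x}.
Proof.
move=> a0 Ob; pose box b := rbox (fun j => `]a j, b j[%classic).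
have mbox b' : measurable (box b') by apply: measurable_rbox => j; exact: measurable_itv.
have : {ae leb, forall x, (W x - w x) * \1_(box b) x = 0}.
  apply: integral_rays_eq0.
  - apply: (integrable_mul_bounded (D := 1) iWw); first exact: measurable_indic.
    by move=> x; rewrite indicE; case: (_ \in _); rewrite ?normr1 ?normr0.
  - exists b => x xb; rewrite indicE memNset ?mulr0// => xab; apply: xb.
    by apply/rayE => j; have := xab j; rewrite /= in_itv/= => /andP[].
  - move=> c; pose b' j := Num.min (b j) (c j).
    transitivity (\int[leb]_x ((W x - w x) * \1_(box b') x)%:E)%E.
      rewrite integral_mkcond; apply: eq_integral => x _.
      have bb : (box b `&` ray c = box b')%classic.
        apply/seteqP; split => [y [yb /rayE yc] j|y yb'].
          rewrite /= in_itv/= lt_min yc andbT.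
          by have := yb j; rewrite /= in_itv.
        split; first by move=> j; have := yb' j; rewrite /= !in_itv/= lt_min => /andP[-> /andP[-> _]].
        by apply/rayE => j; have := yb' j; rewrite /= !in_itv/= lt_min => /andP[_ /andP[_ ->]].
      rewrite -bb patchE !indicE in_setI; case: (x \in ray c); first by rewrite andbT.
      by rewrite andbF mulr0.
    have [ab'|/existsNP[j /negP]] := pselect (forall j, a j < b' j).
      apply: integral_box_W_w; first by move=> j; rewrite ab' andbT; case/andP: (a0 j).
      apply: Odown Ob _ => j; rewrite !mxE ge_min lexx/= andbT.
      by apply: lt_trans (ab' j); case/andP: (a0 j).
    rewrite -leNgt => ba; apply: integral0_eq => x _; rewrite indicE memNset ?mulr0//.
    move=> /(_ j); rewrite /= in_itv/= => /andP[xa xb].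
    by have := lt_le_trans (lt_trans xa xb) ba; rewrite ltxx.
apply: filterS => x + xab; rewrite indicE mem_set// mulr1 => /eqP.
by rewrite subr_eq0 => /eqP.
Qed.

(** The domain is covered by countably many boxes with rational corners: openness leaves room for an
    upper corner inside the domain, positivity of the coordinates for a positive lower corner. *)
Lemma ae_W_w : {ae leb, forall x, Omega x -> W x = w x}.
Proof.
pose P (p : {ffun 'I_d -> rat * rat}) := (forall j, 0 < (ratr (p j).1 : R) < ratr (p j).2) /\
  Omega (\row_j ratr (p j).2).
pose B (p : {ffun 'I_d -> rat * rat}) :=
  rbox (fun j => `](ratr (p j).1 : R), ratr (p j).2[%classic).
have H n : {ae leb, forall x, forall p, unpickle n = Some p -> P p -> B p x -> W x = w x}.
  case E : (unpickle n) => [p|]; last exact: aeW.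
  have [Pp|Pp] := pselect (P p); last by apply: aeW => x p' [<-].
  by have := ae_box_W_w Pp.1 Pp.2; apply: filterS => x xB p' [<-] _.
have := ae_foralln H; apply: filterS => x Hx Ox.
have /nbhs_ballP[e /= e0 be] : nbhs x Omega by exact: Oopen.
have /choice[p2 p2P] j : exists q : rat, x ord0 j < ratr q < x ord0 j + e.
  have /rat_in_itvoo[q] : x ord0 j < x ord0 j + e by rewrite ltrDl.
  by rewrite in_itv; exists q.
have /choice[p1 p1P] j : exists q : rat, 0 < (ratr q : R) < x ord0 j.
  have /rat_in_itvoo[q] : 0 < x ord0 j by case/andP: (OM Ox j).
  by rewrite in_itv; exists q.
apply: (Hx (pickle [ffun j => (p1 j, p2 j)]) [ffun j => (p1 j, p2 j)]).
- exact: pickleK.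
- split => [j|].
    rewrite ffunE/=; case/andP: (p1P j) => -> /lt_trans; apply.
    by case/andP: (p2P j).
  apply: be; split => // i' j; rewrite mxE ffunE/= ord1 /ball/=.
  by case/andP: (p2P j) => h1 h2; rewrite distrC gtr0_norm ?subr_gt0// ltrBlDl.
- move=> j; rewrite /= ffunE/= in_itv/=.
  by case/andP: (p1P j) => _ ->; case/andP: (p2P j) => ->.
Qed.

End absolutely_continuous_on_lines.

(** * Differences along a line controlled by the derivative *)

Section one_dimensional_estimate.
Context {R : realType}.
Local Notation lam := (@lebesgue_measure R).

Lemma measurable_near_bool (c l : R) : measurable_fun setT (fun r : R => `|r - c| <= l).
Proof.
apply: measurable_fun_ler => //; apply: measurableT_comp => //.
exact: measurable_funB.
Qed.

Lemma integral_near_bool (c l : R) : 0 <= l ->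
  (\int[lam]_r ((`|r - c| <= l)%R%:R : R)%:E = (2 * l)%:E)%E.
Proof.
move=> l0; transitivity (\int[lam]_r (\1_(`[c - l, c + l]%classic) r : R)%:E)%E.
  apply: eq_integral => r _; rewrite indicE; congr ((_ : bool)%:R%:E).
  by rewrite ler_distl; apply/idP/idP; rewrite inE/= in_itv.
rewrite integral_indic// setIT.
transitivity (@lebesgue_measure R `[c - l, c + l]%classic); first by [].
rewrite lebesgue_measure_itv/= lte_fin; case: ltP => h.
  by rewrite -EFinB; congr EFin; ring.
have -> : l = 0 by apply/eqP; rewrite eq_le l0 andbT; move: h; lra.
by rewrite mulr0.
Qed.

(** Cauchy-Schwarz on a window of length 2 l. With D the integral on the left, 2 D y <= D^2 / (2 l)
    + 2 l y^2 is integrated over the window; the first term contributes D^2, half of the left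
    side. *)
Lemma sqr_integral_near (delta gam : R -> R) (c l : R) : 0 < l ->
  measurable_fun setT gam ->
  lam.-integrable setT (EFin \o (fun r => delta r * gam r)) ->
  (forall r, `|delta r| <= (`|r - c| <= l)%R%:R) ->
  (((\int[lam]_r (delta r * gam r)) ^+ 2)%:E <=
    (2 * l)%:E * \int[lam]_r ((`|r - c| <= l)%R%:R * gam r ^+ 2)%:E)%E.
Proof.
move=> l0 mg idg dl; set D := \int[lam]_r _; set J := (\int[lam]_r _)%E.
have mb := measurable_natr_bool (R := R) (measurable_near_bool c l).
have mJ : measurable_fun setT (fun r : R => (`|r - c| <= l)%R%:R * gam r ^+ 2).
  by apply: measurable_funM => //; exact: measurable_funX.
have J0 : (0 <= J)%E by apply: integral_ge0 => r _; rewrite lee_fin mulr_ge0// sqr_ge0.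
have [->|Jfin] := eqVneq J +oo%E; first by rewrite mulry gtr0_sg ?mul1e ?leey// mulr_gt0.
have iJ : lam.-integrable setT (EFin \o (fun r => (`|r - c| <= l)%R%:R * gam r ^+ 2)).
  apply/integrableP; split; first exact/measurable_EFinP.
  rewrite (_ : integral _ _ _ = J) ?ltey//; apply: eq_integral => r _.
  by rewrite /= ger0_norm// mulr_ge0// sqr_ge0.
have ib : lam.-integrable setT (EFin \o (fun r => (`|r - c| <= l)%R%:R : R)).
  apply/integrableP; split; first exact/measurable_EFinP.
  rewrite (_ : integral _ _ _ = (2 * l)%:E) ?ltry//.
  rewrite -(integral_near_bool c (ltW l0)); apply: eq_integral => r _.
  by rewrite /= ger0_norm.
have l2 : 0 < 2 * l by rewrite mulr_gt0.
have le r : 2 * D * (delta r * gam r) <= D ^+ 2 / (2 * l) * (`|r - c| <= l)%R%:R +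
    2 * l * ((`|r - c| <= l)%R%:R * gam r ^+ 2).
  have := dl r; case: (_ <= l); last first.
    rewrite normr_le0 => /eqP ->; rewrite mul0r !mulr0 mul0r mulr0 addr0; lra.
  move=> d1; rewrite mulr1 mul1r.
  have h1 : 2 * D * (delta r * gam r) <= 2 * `|D| * `|gam r|.
    rewrite -!mulrA ler_pM2l// (le_trans (ler_norm _))// normrM ler_wpM2l// normrM.
    by rewrite ler_piMl.
  apply: le_trans h1 _.
  have : 0 <= (`|D| / (2 * l) - `|gam r|) ^+ 2 * (2 * l) by rewrite mulr_ge0 ?sqr_ge0 ?ltW.
  rewrite -[D ^+ 2]real_normK ?num_real// -[gam r ^+ 2]real_normK ?num_real//.
  have -> : (`|D| / (2 * l) - `|gam r|) ^+ 2 * (2 * l) = `|D| ^+ 2 / (2 * l) +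
    2 * l * `|gam r| ^+ 2 - 2 * `|D| * `|gam r| by field; lra.
  by rewrite subr_ge0.
have i1 : lam.-integrable setT (EFin \o (fun r => 2 * D * (delta r * gam r))).
  rewrite (_ : _ \o _ = fun r => (2 * D)%:E * (delta r * gam r)%:E)%E; first exact: integrableZl.
  by apply/funext => r /=; rewrite EFinM.
have i2 : lam.-integrable setT (EFin \o (fun r => D ^+ 2 / (2 * l) * (`|r - c| <= l)%R%:R)).
  rewrite (_ : _ \o _ = fun r => (D ^+ 2 / (2 * l))%:E * ((`|r - c| <= l)%R%:R)%:E)%E.
    exact: integrableZl.
  by apply/funext => r /=; rewrite EFinM.
have i3 : lam.-integrable setT (EFin \o (fun r => 2 * l * ((`|r - c| <= l)%R%:R * gam r ^+ 2))).
  rewrite (_ : _ \o _ = fun r => (2 * l)%:E * ((`|r - c| <= l)%R%:R * gam r ^+ 2)%:E)%E.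
    exact: integrableZl.
  by apply/funext => r /=; rewrite EFinM.
have : (2 * D) * D <= D ^+ 2 + (2 * l) * fine J.
  rewrite {2}/D -RintegralZl//; apply: le_trans.
    apply: (@le_Rintegral _ _ _ lam setT _ (fun r => D ^+ 2 / (2 * l) * (`|r - c| <= l)%R%:R +
    2 * l * ((`|r - c| <= l)%R%:R * gam r ^+ 2))) => //.
    exact: integrableD i2 i3.
  rewrite RintegralD// !RintegralZl// lerD//.
  rewrite /Rintegral (integral_near_bool _ (ltW l0))/=.
  by rewrite divfK// gt_eqF.
rewrite -[J]fineK ?ge0_fin_numE ?ltey// -EFinM lee_fin.
by rewrite mulrAC -mulrA -expr2 mulr2n mulrDl mul1r lerD2l.
Qed.

End one_dimensional_estimate.

(** The difference of the two kernels is nonzero only for r between a and s, hence within l of a. *)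
Lemma norm_kG_sub {R : realType} (M r a s l : R) : 0 < a < M -> 0 < s < M ->
  `|s - a| <= l -> `|kG M r a - kG M r s| <= (`|r - a| <= l)%R%:R.
Proof.
move=> /andP[a0 aM] /andP[s0 sM] sal.
have l0 : 0 <= l by exact: le_trans sal.
have /andP[sx1 sx2] : a - l <= s <= a + l by rewrite -ler_distl.
rewrite /kG aM sM !andbT; case: (ltP 0 r) => r0; last by rewrite subrr normr0.
case: (ltP r a) => ra; case: (ltP r s) => rs; rewrite ?subrr ?normr0//.
- rewrite subr0 normr1 (_ : _ <= l)// ler_distl (le_trans sx1 rs)/=.
  by rewrite (le_trans (ltW ra))// lerDl.
- rewrite sub0r normrN normr1 (_ : _ <= l)// ler_distl (ltW (lt_le_trans rs sx2)) andbT.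
  by rewrite (le_trans _ ra)// gerBl.
Qed.

Section null_pairs.
Context {R : realType} {d : nat}.
Local Notation leb := (lebesgue_rV d : {sigma_finite_measure set 'rV[R]_d -> \bar R}).
Local Notation lam := (@lebesgue_measure R).
Local Notation Z := (measurableTypeR R * 'rV[R]_d)%type.

Lemma ae_snd (P : 'rV[R]_d -> Prop) : {ae leb, forall x, P x} ->
  {ae (lam \x leb)%E, forall z, P z.2}.
Proof.
move=> [A [mA A0 PA]]; exists (setT `*` A); split.
- exact: measurableX.
- transitivity (lam setT * leb A)%E; first exact: product_measure1E.
  by rewrite [leb A]A0 mule0.
- by move=> [s x] /= H; split => //; exact: PA.
Qed.

(** The null set of [ae_snd] pulled back by the swap, which preserves the measure. With [ae_snd] it
    makes both ends of almost every pair good points. *)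
Lemma ae_upd i (P : 'rV[R]_d -> Prop) : {ae leb, forall x, P x} ->
  {ae (lam \x leb)%E, forall z : Z, P (upd i z.1 z.2)}.
Proof.
move=> /ae_snd[A [mA A0 PA]]; exists (cswap i @^-1` A); split.
- by rewrite -[X in measurable X]setTI; exact: (@measurable_cswap R d i measurableT A mA).
- by rewrite -A0; apply/esym; exact: swap_invariant.
- by move=> [s x] /= H; exact: PA.
Qed.

End null_pairs.

Section pair_energy.
Context {R : realType} {d : nat}.
Local Notation leb := (lebesgue_rV d : {sigma_finite_measure set 'rV[R]_d -> \bar R}).
Local Notation lam := (@lebesgue_measure R).
Local Notation Z := (measurableTypeR R * 'rV[R]_d)%type.
Local Notation e_ i := (delta_mx ord0 i : 'rV[R]_d).
Variables (Omega : set 'rV[R]_d) (M kap : R) (i : 'I_d) (u g : 'rV[R]_d -> R).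
Hypothesis kap0 : 0 < kap.
Hypothesis M0 : 0 <= M.
Hypothesis OM : forall x, Omega x -> forall j, 0 < x ord0 j < M.
Hypothesis Odown : forall (b x : 'rV[R]_d), Omega b ->
  (forall j, 0 < x ord0 j <= b ord0 j) -> Omega x.
Hypothesis Olow : forall (x : 'rV[R]_d) j t, Omega x -> 0 < t < kap -> Omega (upd j t x).
Hypothesis Oopen : open Omega.
Hypothesis iu : leb.-integrable setT (EFin \o u).
Hypothesis ig : leb.-integrable setT (EFin \o g).
Hypothesis g0 : forall x, ~ Omega x -> g x = 0.
Hypothesis weak : forall phi, C1c Omega phi ->
  \int[leb]_x (u x * 'D_(e_ i) phi x) = - \int[leb]_x (g x * phi x).
Variables (l : 'rV[R]_d -> R) (p : Z -> R).
Hypothesis l01 : forall x, 0 < l x <= 1.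
Hypothesis ml : measurable_fun setT l.
Hypothesis l_upd : forall s x, l (upd i s x) = l x.
Hypothesis mp : measurable_fun setT p.
Hypothesis p0l : forall z, 0 <= p z <= (l z.2)^-1.
Hypothesis pS : forall s x, p (s, x) != 0 ->
  [/\ Omega x, Omega (upd i s x) & `|s - x ord0 i| <= l x].

Let mg : measurable_fun setT g.
Proof. by apply/measurable_EFinP; exact: measurable_int ig. Qed.

Let mu : measurable_fun setT u.
Proof. by apply/measurable_EFinP; exact: measurable_int iu. Qed.

Let near (z : Z) : R := (`|z.1 - z.2 ord0 i| <= l z.2)%R%:R.

Let mnear : measurable_fun setT near.
Proof.
apply: measurable_natr_bool; apply: measurable_fun_ler.
  apply: measurableT_comp => //; apply: measurable_funB; first exact: measurable_fst.
  by apply: measurable_coord; exact: measurable_snd.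
by apply: (measurableT_comp ml); exact: measurable_snd.
Qed.

Let mnear1 x : measurable_fun setT (fun s => near (s, x)).
Proof.
apply: (@measurable_natr_bool R _ _ (fun s : R => `|s - x ord0 i| <= l x)).
exact: measurable_near_bool.
Qed.

Let mupd : measurable_fun setT (fun z : Z => upd i z.1 z.2).
Proof. by apply: measurable_upd; [exact: measurable_fst|exact: measurable_snd]. Qed.

Let F (z : Z) : \bar R := (near z * g (upd i z.1 z.2) ^+ 2)%:E.

Let mF : measurable_fun setT F.
Proof.
apply/measurable_EFinP; apply: measurable_funM => //.
by apply: measurable_funX; exact: (measurableT_comp mg).
Qed.

Let F0 z : (0 <= F z)%E.
Proof. by rewrite lee_fin mulr_ge0// sqr_ge0. Qed.

Let J := fubini_G lam F.

Let mJ : measurable_fun setT J.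
Proof. exact: measurable_fun_fubini_tonelli_G. Qed.

Let J0 x : (0 <= J x)%E.
Proof. by apply: integral_ge0 => r _; exact: F0. Qed.

(** For almost every pair both ends satisfy W = w. As w takes the same value at both, u differs by
    the difference of the primitives, an integral of g over the segment between the two points. *)
Lemma ae_pair_bound : {ae (lam \x leb)%E, forall z : Z,
  ((p z * (u z.2 - u (upd i z.1 z.2)) ^+ 2)%:E <= (p z * (2 * l z.2))%:E * J z.2)%E}.
Proof.
have A1 := ae_W_w kap0 M0 OM Odown Olow Oopen iu ig g0 weak.
have A2 := fibre_op_ae M0 (measurable_kG M i) (kG_le1 M) (@kG_eq0 R M) ig.
have C1 := ae_snd A1; have C2 := ae_upd i A1; have C3 := ae_snd A2; have C4 := ae_upd i A2.
refine (filterS2 _ _ (filterI C1 C2) (filterI C3 C4)).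
move=> [s x] /= [B1 B2] [B3 B4].
have [->|/pS[Ox Oy sx]] := eqVneq (p (s, x)) 0; first by rewrite !mul0r mul0e.
move: B1 B2 => /(_ Ox) B1 /(_ Oy) B2.
have /andP[x0 xM] := OM Ox i.
have := OM Oy i; rewrite upd_eq => /andP[s0 sM].
pose gam r := g (upd i r x); pose delta r := kG M r (x ord0 i) - kG M r s.
(* The kernel [kw] sees the [i]-th coordinate only through the condition of lying in ]0, M[. *)
have wE : w M kap i u g x = w M kap i u g (upd i s x).
  apply: eq_Rintegral => r _; rewrite upd_upd upd_eq; congr (_ * _).
  by rewrite /kw x0 xM s0 sM.
have E3 : (fun r => (kG M r (upd i s x ord0 i) * g (upd i r (upd i s x)))%:E) =
    EFin \o (fun r => kG M r s * gam r).
  by apply/funext => r; rewrite upd_upd upd_eq.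
have B4' : lam.-integrable setT (EFin \o (fun r => kG M r s * gam r)) by rewrite -E3.
have B3' : lam.-integrable setT (EFin \o (fun r => kG M r (x ord0 i) * gam r)) := B3.
have GE : fibreG M i g x - fibreG M i g (upd i s x) = \int[lam]_r (delta r * gam r).
  have -> : fibreG M i g (upd i s x) = \int[lam]_r (kG M r s * gam r).
    by apply: eq_Rintegral => r _; rewrite upd_upd upd_eq.
  have -> : fibreG M i g x = \int[lam]_r (kG M r (x ord0 i) * gam r) by [].
  rewrite -(RintegralB measurableT B3' B4').
  by apply: eq_Rintegral => r _; rewrite /delta mulrBl.
have idg : lam.-integrable setT (EFin \o (fun r => delta r * gam r)).
  rewrite (_ : _ \o _ = fun r => (kG M r (x ord0 i) * gam r)%:E - (kG M r s * gam r)%:E)%E.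
    exact: integrableB.
  by apply/funext => r; rewrite /= /delta mulrBl EFinB.
have -> : u x - u (upd i s x) = \int[lam]_r (delta r * gam r).
  rewrite -GE -(subrK (fibreG M i g x) (u x)) -[X in _ - X](subrK (fibreG M i g (upd i s x))).
  by rewrite -/(W M i u g x) -/(W M i u g (upd i s x)) B1 B2 wE; ring.
have mgam : measurable_fun setT gam.
  by apply: (measurableT_comp mg); apply: measurable_upd => //; exact: measurable_cst.
have dl r : `|delta r| <= (`|r - x ord0 i| <= l x)%R%:R.
  by apply: norm_kG_sub; [rewrite x0 xM|rewrite s0 sM|exact: sx].
have lx : 0 < l x by case/andP: (l01 x).
have H := sqr_integral_near lx mgam idg dl.
rewrite (EFinM (p (s, x)) (_ ^+ 2)) (EFinM (p (s, x)) (2 * _)) -muleA.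
apply: lee_wpmul2l; first by rewrite lee_fin; case/andP: (p0l (s, x)).
exact: H.
Qed.

(** Since p <= 1 / l, the bound p * 2 l * J of [ae_pair_bound] is at most 2 J on pairs within l.
    Integrating over the partner gives 4 l J, and the swap turns J into 2 l g^2. The result 8 l^2
    g^2 is at most 8 g^2 because l <= 1. *)
Lemma pair_energy : (\int[leb]_x \int[lam]_s
  (p (s, x) * (u x - u (upd i s x)) ^+ 2)%:E <= 8%:E * \int[leb]_x (g x ^+ 2)%:E)%E.
Proof.
pose D (z : Z) := (p z * (u z.2 - u (upd i z.1 z.2)) ^+ 2)%:E.
have mD : measurable_fun setT D.
  apply/measurable_EFinP; apply: measurable_funM => //; apply: measurable_funX.
  apply: measurable_funB; first by apply: (measurableT_comp mu); exact: measurable_snd.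
  exact: (measurableT_comp mu).
have D0 z : (0 <= D z)%E.
  by rewrite lee_fin mulr_ge0 ?sqr_ge0//; case/andP: (p0l z).
rewrite -[leLHS]/(\int[leb]_x fubini_G lam D x)%E -(fubini_tonelli2 D)//.
pose D2 (z : Z) := ((2 * near z)%:E * J z.2)%E.
have mJ2 : measurable_fun setT (fun z : Z => J z.2).
  by apply: (measurableT_comp mJ); exact: measurable_snd.
have mD2 : measurable_fun setT D2.
  by apply: emeasurable_funM => //; apply/measurable_EFinP; exact: measurable_funM.
have D20 z : (0 <= D2 z)%E by rewrite mule_ge0// lee_fin mulr_ge0.
apply: (@le_trans _ _ (\int[lam \x leb]_z D2 z)%E).
  apply: ae_ge0_le_integral => //.
  apply: filterS ae_pair_bound => z H _; apply: (le_trans H).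
  have [->|pz] := eqVneq (p z) 0; first by rewrite mul0r mul0e D20.
  have [_ _ near1] : [/\ Omega z.2, Omega (upd i z.1 z.2) & `|z.1 - z.2 ord0 i| <= l z.2].
    by apply: pS; case: z pz {H}.
  rewrite /D2 lee_wpmul2r// lee_fin /near near1 mulr1 mulrCA ger_pMr//.
  have /andP[lz _] := l01 z.2.
  by rewrite -ler_pdivlMr// mul1r; case/andP: (p0l z).
rewrite (fubini_tonelli2 D2)//.
have -> : fubini_G lam D2 = (fun x => (4 * l x)%:E * J x)%E.
  apply/funext => x; rewrite /fubini_G /D2 /=.
  rewrite ge0_integralZr//; last 2 first.
  - by apply/measurable_EFinP; exact: measurable_funM.
  - by move=> s _; rewrite lee_fin mulr_ge0.
  congr (_ * _)%E; transitivity (2%:E * \int[lam]_s (near (s, x))%:E)%E.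
    under eq_integral do rewrite EFinM; rewrite ge0_integralZl//.
      by apply/measurable_EFinP; exact: mnear1.
    by move=> s _; rewrite lee_fin.
  transitivity (2%:E * (2 * l x)%:E)%E; last by rewrite -EFinM; congr EFin; ring.
  have lx0 : 0 <= l x by case/andP: (l01 x) => /ltW.
  by congr (_ * _)%E; exact (integral_near_bool (x ord0 i) lx0).
pose F2 (z : Z) := ((4 * l z.2)%:E * F z)%E.
have mF2 : measurable_fun setT F2.
  apply: emeasurable_funM => //; apply/measurable_EFinP; apply: measurable_funM => //.
  by apply: (measurableT_comp ml); exact: measurable_snd.
have l0 x : 0 <= l x by case/andP: (l01 x) => /ltW.
have F20 z : (0 <= F2 z)%E by rewrite mule_ge0// lee_fin mulr_ge0.
rewrite [leLHS](_ : _ = \int[leb]_x \int[lam]_s F2 (s, x))%E; last first.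
  apply: eq_integral => x _; rewrite /F2 /=.
  rewrite ge0_integralZl ?lee_fin ?mulr_ge0//.
  exact: measurable_fun_pair1 mF.
rewrite (tonelli_swap i)//.
rewrite -ge0_integralZl//; last 2 first.
- by apply/measurable_EFinP; exact: measurable_funX.
- by move=> x _; rewrite lee_fin sqr_ge0.
apply: ge0_le_integral => //.
- by move=> x _; apply: integral_ge0 => s _; exact: F20.
- apply: (measurable_fun_fubini_tonelli_G (F2 \o cswap i)).
    by apply: (measurableT_comp mF2); exact: measurable_cswap.
  by move=> z; exact: F20.
- apply: emeasurable_funM; first exact: measurable_cst.
  by apply/measurable_EFinP; exact: measurable_funX.
move=> x _; rewrite /F2/F/near/=.
under eq_integral do rewrite upd_upd upd_id upd_eq l_upd distrC -EFinM mulrCA EFinM.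
rewrite ge0_integralZr//; last 2 first.
- by apply/measurable_EFinP; exact: mnear1.
- by rewrite lee_fin; apply: mulr_ge0; [apply: mulr_ge0|exact: sqr_ge0].
rewrite [X in (X * _)%E](integral_near_bool (x ord0 i) (l0 x)) -!EFinM lee_fin.
have -> : 2 * l x * (4 * l x * g x ^+ 2) = 8 * (l x * l x) * g x ^+ 2 by ring.
rewrite ler_wpM2r ?sqr_ge0// ger_pMr//.
by case/andP: (l01 x) => lx0 lx1; rewrite -[leRHS]mulr1 ler_pM.
Qed.

End pair_energy.

(** * The Poincare inequality on the unit cube *)

(** If [Phi] exceeded its mean on all of ]0, 1[, then Phi - K would be positive there and have
    integral 0. *)
Lemma exists_le_integral {R : realType} (Phi : R -> \bar R) :
  measurable_fun setT Phi -> (forall z, 0 <= Phi z)%E ->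
  exists2 z, 0 < z < 1 &
    (Phi z <= \int[@lebesgue_measure R]_z ((\1_(`]0%R, 1%R[%classic) z)%:E * Phi z))%E.
Proof.
move=> mP P0; set K := (\int[_]_z _)%E; apply: contrapT => H.
have lt z : 0 < z < 1 -> (K < Phi z)%E.
  by move=> z01; rewrite ltNge; apply/negP => zI; apply: H; exists z.
have m01 : measurable_fun setT (fun z : R => (\1_(`]0%R, 1%R[%classic) z : R)%:E).
  by apply/measurable_EFinP; exact: measurable_indic.
have K0 : (0 <= K)%E by apply: integral_ge0 => z _; rewrite mule_ge0.
have Kfin : K \is a fin_num.
  (* The mean is finite since it is strictly below the value at 1/2. *)
  rewrite ge0_fin_numE//; apply: lt_le_trans (leey (Phi 2^-1)); apply: lt; lra.
pose G (z : R) := ((\1_(`]0%R, 1%R[%classic) z)%:E * (Phi z - K))%E.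
have mG : measurable_fun setT G.
  by apply: emeasurable_funM => //; apply: emeasurable_funB => //; exact: measurable_cst.
have G0 z : (0 <= G z)%E.
  rewrite /G indicE; case: (boolP (z \in _)) => [|_]; last by rewrite mul0e.
  by rewrite inE/= in_itv/= => /lt/ltW; rewrite mul1e suber_ge0.
have IG : (\int[@lebesgue_measure R]_z `|G z| = 0)%E.
  under eq_integral do rewrite gee0_abs//.
  have E : (K = \int[@lebesgue_measure R]_z G z + K)%E.
    have {1}-> : (K = \int[@lebesgue_measure R]_z (G z + K * (\1_(`]0%R, 1%R[%classic) z)%:E))%E.
      apply: eq_integral => z _; rewrite /G (muleC K) -muleDr//; last first.
        by rewrite fin_num_adde_defl.
      by rewrite subeK.
    rewrite ge0_integralD//; last 2 first.
    - by move=> z _; rewrite mule_ge0.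
    - by apply: emeasurable_funM => //; exact: measurable_cst.
    rewrite ge0_integralZl// (integral_indic_itvoo 0 1) subr0 max_r ?mule1//.
  by rewrite -[LHS](addeK _ Kfin) -E subee.
have [/(_ IG)[A [mA A0 sub]] _] := ae_eq_integral_abs (@lebesgue_measure R) measurableT mG.
have /(le_measure (@lebesgue_measure R)) : (`]0, 1[%classic `<=` A)%classic.
  move=> t; rewrite /= in_itv/= => t01; apply: sub => /= /(_ I).
  have := lt _ t01; rewrite /G indicE mem_set/= ?in_itv// mul1e -(fineK Kfin).
  case: (Phi t) => [b| |] //; rewrite lte_fin => h [] /eqP.
  by rewrite subr_eq0 gt_eqF.
rewrite !inE => /(_ (measurable_itv _) mA) HA.
have : (@lebesgue_measure R `]0%R, 1%R[%classic <= 0)%E.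
  by rewrite -A0; exact: HA.
by rewrite lebesgue_measure_itv/= lte_fin ltr01 -EFinB lee_fin subr0 ler10.
Qed.

Lemma integral_sqr_triangle {R : realType} dT (T : measurableType dT)
    (mu : {measure set T -> \bar R}) (p a b c : T -> R) :
  measurable_fun setT p -> measurable_fun setT a -> measurable_fun setT b ->
  measurable_fun setT c -> (forall x, 0 <= p x) ->
  (\int[mu]_x (p x * (a x - c x) ^+ 2)%:E <=
   2%:E * \int[mu]_x (p x * (a x - b x) ^+ 2)%:E +
   2%:E * \int[mu]_x (p x * (b x - c x) ^+ 2)%:E)%E.
Proof.
move=> mp ma mb mc p0.
have m (f g : T -> R) : measurable_fun setT f -> measurable_fun setT g ->
    measurable_fun setT (fun x => (p x * (f x - g x) ^+ 2)%:E).
  move=> mf mg; apply/measurable_EFinP; apply: measurable_funM => //.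
  by apply: measurable_funX; exact: measurable_funB.
have p1 (f g : T -> R) x : (0 <= (p x * (f x - g x) ^+ 2)%:E)%E.
  by rewrite lee_fin mulr_ge0 ?sqr_ge0.
rewrite -!ge0_integralZl//; try exact: m.
rewrite -ge0_integralD//; last 4 first.
- by move=> x _; rewrite mule_ge0.
- by apply: emeasurable_funM; [exact: measurable_cst|exact: m].
- by move=> x _; rewrite mule_ge0.
- by apply: emeasurable_funM; [exact: measurable_cst|exact: m].
apply: ge0_le_integral => //.
- exact: m.
- by apply: emeasurable_funD; apply: emeasurable_funM; (exact: measurable_cst || exact: m).
move=> x _; rewrite -!EFinM -EFinD lee_fin.
rewrite -subr_ge0 (_ : _ - _ = p x * ((a x - b x) - (b x - c x)) ^+ 2); last by ring.
by rewrite mulr_ge0 ?sqr_ge0.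
Qed.

Section unit_cube.
Context {R : realType} {d : nat}.
Local Notation leb := (lebesgue_rV d : {sigma_finite_measure set 'rV[R]_d -> \bar R}).
Local Notation lam := (@lebesgue_measure R).
Local Notation Z := (measurableTypeR R * 'rV[R]_d)%type.

Definition in01 (s : R) : R := \1_(`]0, 1[%classic) s.

Definition in_cube (x : 'rV[R]_d) : R := \1_(rbox (fun=> `]0, 1[%classic)) x.

Definition line_energy (i : 'I_d) (v : 'rV[R]_d -> R) (x : 'rV[R]_d) : \bar R :=
  (\int[lam]_s (in01 s * (v x - v (upd i s x)) ^+ 2)%:E)%E.

Definition cube_energy (i : 'I_d) (v : 'rV[R]_d -> R) : \bar R :=
  (\int[leb]_x ((in_cube x)%:E * line_energy i v x))%E.

Lemma in01_ge0 s : 0 <= in01 s.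
Proof. by rewrite /in01 indicE. Qed.

Lemma in_cube_ge0 (x : 'rV[R]_d) : 0 <= in_cube x.
Proof. by rewrite /in_cube indicE. Qed.

Lemma measurable_in01 : measurable_fun setT in01.
Proof. exact: measurable_indic. Qed.

Lemma measurable_in_cube : measurable_fun setT in_cube.
Proof. by apply: measurable_indic; apply: measurable_rbox => _; exact: measurable_itv. Qed.

(** The weight of a pair of cube points on a common line is invariant under [cswap]. *)
Lemma in_cube_upd i s (x : 'rV[R]_d) : in01 (x ord0 i) * in_cube (upd i s x) = in_cube x * in01 s.
Proof.
rewrite /in01 /in_cube !indicE -!natrM !mulnb; congr (_ : bool)%:R.
apply/andP/andP; rewrite !inE => -[H1 H2]; split.
- move=> j; have [->//|ji] := eqVneq j i.
  by have := H2 j; rewrite upd_neq.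
- by have := H2 i; rewrite upd_eq.
- exact: H1.
- by move=> j; have [->|ji] := eqVneq j i; rewrite ?upd_eq// upd_neq//; exact: H1.
Qed.

Section line_energy.
Variables (i : 'I_d) (v : 'rV[R]_d -> R).
Hypothesis mv : measurable_fun setT v.

Lemma line_energy_ge0 x : (0 <= line_energy i v x)%E.
Proof.
by apply: integral_ge0 => s _; rewrite lee_fin mulr_ge0 ?sqr_ge0 ?in01_ge0.
Qed.

Let mF : measurable_fun setT
  (fun z : Z => (in01 z.1 * (v z.2 - v (upd i z.1 z.2)) ^+ 2)%:E).
Proof.
apply/measurable_EFinP; apply: measurable_funM.
  by apply: (measurableT_comp measurable_in01); exact: measurable_fst.
apply: measurable_funX; apply: measurable_funB; apply: (measurableT_comp mv).
  exact: measurable_snd.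
by apply: measurable_upd; [exact: measurable_fst|exact: measurable_snd].
Qed.

Lemma measurable_line_energy : measurable_fun setT (line_energy i v).
Proof.
apply: (measurable_fun_fubini_tonelli_G (fun z : Z =>
  (in01 z.1 * (v z.2 - v (upd i z.1 z.2)) ^+ 2)%:E)) => //.
by move=> z; rewrite lee_fin mulr_ge0 ?sqr_ge0 ?in01_ge0.
Qed.

End line_energy.

(** Freezing the [i]-th coordinate at z and then averaging over z restores the integral over the
    cube. *)
Lemma integral_cube_upd (i : 'I_d) (Psi : 'rV[R]_d -> \bar R) :
  measurable_fun setT Psi -> (forall x, 0 <= Psi x)%E ->
  (\int[lam]_z ((in01 z)%:E * \int[leb]_x ((in_cube x)%:E * Psi (upd i z x))) =
  \int[leb]_x ((in_cube x)%:E * Psi x))%E.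
Proof.
move=> mP P0; pose H (z : Z) := ((in01 z.1 * in_cube z.2)%:E * Psi (upd i z.1 z.2))%E.
have mH : measurable_fun setT H.
  apply: emeasurable_funM.
    apply/measurable_EFinP; apply: measurable_funM.
      by apply: (measurableT_comp measurable_in01); exact: measurable_fst.
    by apply: (measurableT_comp measurable_in_cube); exact: measurable_snd.
  apply: (measurableT_comp mP).
  by apply: measurable_upd; [exact: measurable_fst|exact: measurable_snd].
have H0 z : (0 <= H z)%E.
  by rewrite mule_ge0// lee_fin mulr_ge0 ?in01_ge0 ?in_cube_ge0.
transitivity (\int[lam]_z \int[leb]_x H (z, x))%E.
  apply: eq_integral => z _; rewrite -ge0_integralZl ?lee_fin ?in01_ge0//.
  - by apply: eq_integral => x _; rewrite /H/= EFinM muleA.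
  - apply: emeasurable_funM; first by apply/measurable_EFinP; exact: measurable_in_cube.
    by apply: (measurableT_comp mP); apply: measurable_upd => //; exact: measurable_cst.
  - by move=> x _; rewrite mule_ge0// lee_fin in_cube_ge0.
rewrite (fubini_tonelli H)// (tonelli_swap i)//.
apply: eq_integral => x _; rewrite /H/=.
under eq_integral do rewrite upd_upd upd_id in_cube_upd EFinM -muleA muleCA.
rewrite ge0_integralZr//; last 3 first.
- by apply/measurable_EFinP; exact: measurable_in01.
- by move=> s _; rewrite lee_fin in01_ge0.
- by rewrite mule_ge0// lee_fin in_cube_ge0.
by rewrite (integral_indic_itvoo 0 1) subr0 max_r// mul1e.
Qed.

Lemma const_of_upd_invariant (v : 'rV[R]_d -> R) :
  (forall j s x, v (upd j s x) = v x) -> forall x, v x = v 0.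
Proof.
move=> vu x; pose y := foldr (fun j => upd j 0) x (enum 'I_d).
have -> : v x = v y by rewrite /y; elim: (enum _) => //= j s ->; rewrite vu.
congr v; apply/rowP => j; rewrite mxE /y.
have : j \in enum 'I_d by rewrite mem_enum.
elim: (enum _) => // k s IH; rewrite inE /= updE.
by case: eqP => //= _ /IH.
Qed.

(** Induction on the coordinates on which v depends. The first one is frozen at a value z that is
    good on average, which leaves a function of the others, and the triangle inequality gives C' = 2
    + 2 C. *)
Lemma cube_poincare_seq (s : seq 'I_d) : uniq s -> exists2 C : R, 0 <= C &
  forall v : 'rV[R]_d -> R, measurable_fun setT v ->
  (forall j, j \notin s -> forall t x, v (upd j t x) = v x) ->
  exists c : R, (\int[leb]_x (in_cube x * (v x - c) ^+ 2)%:E <=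
    C%:E * \sum_(j <- s) cube_energy j v)%E.
Proof.
elim: s => [_|i s IH /andP[is_ us]].
  exists 0 => // v mv vu; exists (v 0).
  rewrite mul0e integral0_eq// => x _.
  by rewrite [v x](const_of_upd_invariant (v := v))// ?subrr ?expr0n ?mulr0// => j; exact: vu.
have [C C0 HC] := IH us.
have CC : 0 <= 2 + 2 * C by rewrite addr_ge0// mulr_ge0.
exists (2 + 2 * C); first exact: CC.
move=> v mv vu; set T := (\sum_(j <- _) _)%E.
pose A z : \bar R := (\int[leb]_x (in_cube x * (v x - v (upd i z x)) ^+ 2)%:E)%E.
pose B j z : \bar R := (\int[leb]_x ((in_cube x)%:E * line_energy j v (upd i z x)))%E.
have mupd : measurable_fun setT (fun z : Z => upd i z.1 z.2).
  by apply: measurable_upd; [exact: measurable_fst|exact: measurable_snd].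
have mcube2 : measurable_fun setT (fun z : Z => in_cube z.2).
  by apply: (measurableT_comp measurable_in_cube); exact: measurable_snd.
pose FA (z : Z) := (in_cube z.2 * (v z.2 - v (upd i z.1 z.2)) ^+ 2)%:E.
have mFA : measurable_fun setT FA.
  apply/measurable_EFinP; apply: measurable_funM => //; apply: measurable_funX.
  apply: measurable_funB; first by apply: (measurableT_comp mv); exact: measurable_snd.
  exact: (measurableT_comp mv).
have FA0 z : (0 <= FA z)%E by rewrite lee_fin mulr_ge0 ?sqr_ge0 ?in_cube_ge0.
have mA : measurable_fun setT A by exact: (measurable_fun_fubini_tonelli_F FA).
pose FB j (z : Z) := ((in_cube z.2)%:E * line_energy j v (upd i z.1 z.2))%E.
have mFB j : measurable_fun setT (FB j).
  apply: emeasurable_funM; first exact/measurable_EFinP.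
  by apply: (measurableT_comp _ mupd); exact: measurable_line_energy.
have FB0 j z : (0 <= FB j z)%E.
  by rewrite mule_ge0 ?line_energy_ge0// lee_fin in_cube_ge0.
have mB j : measurable_fun setT (B j) by exact: (measurable_fun_fubini_tonelli_F (FB j)).
have A0 z : (0 <= A z)%E by apply: integral_ge0 => x _; exact: (FA0 (z, x)).
have B0 j z : (0 <= B j z)%E by apply: integral_ge0 => x _; exact: (FB0 j (z, x)).
pose Phi z := (A z + \sum_(j <- s) B j z)%E.
have mS : measurable_fun setT (fun z => \sum_(j <- s) B j z)%E.
  by apply: emeasurable_sum => j; exact: mB.
have S0 z : (0 <= \sum_(j <- s) B j z)%E by apply: sume_ge0 => j _; exact: B0.
have mPhi : measurable_fun setT Phi by exact: emeasurable_funD.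
have Phi0 z : (0 <= Phi z)%E by exact: adde_ge0.
have IA : (\int[lam]_z ((in01 z)%:E * A z) = cube_energy i v)%E.
  pose FA1 (z : Z) := ((in01 z.1)%:E * FA z)%E.
  have mFA1 : measurable_fun setT FA1.
    apply: emeasurable_funM => //; apply/measurable_EFinP.
    by apply: (measurableT_comp measurable_in01); exact: measurable_fst.
  have FA10 z : (0 <= FA1 z)%E by rewrite mule_ge0 ?FA0// lee_fin in01_ge0.
  transitivity (\int[lam]_z \int[leb]_x FA1 (z, x))%E.
    apply: eq_integral => z _; rewrite /FA1/= ge0_integralZl ?lee_fin ?in01_ge0//.
    exact: measurable_fun_pair2 mFA.
  rewrite (fubini_tonelli FA1)//; apply: eq_integral => x _.
  rewrite /line_energy -ge0_integralZl ?lee_fin ?in_cube_ge0//; last 2 first.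
  - apply/measurable_EFinP; apply: measurable_funM; first exact: measurable_in01.
    apply: measurable_funX; apply: measurable_funB => //.
    by apply: (measurableT_comp mv); apply: measurable_upd => //; exact: measurable_cst.
  - by move=> z _; rewrite lee_fin mulr_ge0 ?sqr_ge0 ?in01_ge0.
  by apply: eq_integral => z _; rewrite /FA1 /FA/= -!EFinM; congr EFin; ring.
have IB j : (\int[lam]_z ((in01 z)%:E * B j z) = cube_energy j v)%E.
  by apply: integral_cube_upd; [exact: measurable_line_energy|exact: line_energy_ge0].
have m01 : measurable_fun setT (fun z => (in01 z)%:E).
  by apply/measurable_EFinP; exact: measurable_in01.
have IPhi : (\int[lam]_z ((in01 z)%:E * Phi z) = T)%E.
  rewrite /Phi; under eq_integral do rewrite ge0_muleDr// ge0_sume_distrr//.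
  rewrite ge0_integralD//; last 4 first.
  - by move=> z _; rewrite mule_ge0// lee_fin in01_ge0.
  - exact: (emeasurable_funM m01 mA).
  - by move=> z _; apply: sume_ge0 => j _; rewrite mule_ge0 ?B0// lee_fin in01_ge0.
  - by apply: emeasurable_sum => j; exact: (emeasurable_funM m01 (mB j)).
  rewrite ge0_integral_sum//; last 2 first.
  - by move=> j; exact: (emeasurable_funM m01 (mB j)).
  - by move=> j z _; rewrite mule_ge0 ?B0// lee_fin in01_ge0.
  by rewrite IA /T big_cons; congr (_ + _)%E; apply: eq_bigr => j _; exact: IB.
have [z z01 zT] := exists_le_integral mPhi Phi0.
rewrite IPhi in zT.
pose v1 x := v (upd i z x).
have mv1 : measurable_fun setT v1.
  by apply: (measurableT_comp mv); apply: measurable_upd => //; exact: measurable_cst.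
have v1u j : j \notin s -> forall t x, v1 (upd j t x) = v1 x.
  move=> js t x; rewrite /v1; have [->|ji] := eqVneq j i; first by rewrite upd_upd.
  by rewrite updC 1?eq_sym// vu// inE negb_or ji.
have [c Hc] := HC v1 mv1 v1u; exists c.
have E1 : (\sum_(j <- s) cube_energy j v1 = \sum_(j <- s) B j z)%E.
  apply: eq_big_seq => j js; apply: eq_integral => x _; congr (_ * _)%E.
  have ji : i != j by apply: contraNneq is_ => ->.
  by apply: eq_integral => r _; rewrite /v1 (updC _ _ _ ji).
rewrite E1 in Hc.
apply: (@le_trans _ _ (2%:E * A z + 2%:E * (C%:E * \sum_(j <- s) B j z))%E).
  apply: (@le_trans _ _ (2%:E * A z + 2%:E *
      \int[leb]_x (in_cube x * (v1 x - c) ^+ 2)%:E)%E); last first.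
    by apply: leeD2l; apply: lee_wpmul2l; [rewrite lee_fin|exact: Hc].
  exact (integral_sqr_triangle leb measurable_in_cube mv mv1 (measurable_cst c) in_cube_ge0).
apply: (@le_trans _ _ ((2 + 2 * C)%:E * Phi z)%E); last first.
  by apply: lee_wpmul2l; [rewrite lee_fin; exact: CC|exact: zT].
move: (A0 z) (S0 z) C0; rewrite /Phi.
move: (A z) (\sum_(j <- s) B j z)%E; clear => a b a0 b0 C0.
rewrite (EFinD 2 (2 * C)) ge0_muleDl ?lee_fin ?mulr_ge0//; apply: leeD.
  by apply: lee_wpmul2l; [rewrite lee_fin|rewrite leeDl].
rewrite (EFinM 2 C) -!muleA; apply: lee_wpmul2l; first by rewrite lee_fin.
by apply: lee_wpmul2l; [rewrite lee_fin|rewrite leeDr].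
Qed.

End unit_cube.

(** * The horn *)

Section euclidean_norm.
Context {R : realType} {d : nat}.
Implicit Types x y : 'rV[R]_d.

Lemma enorm_ge0 x : 0 <= enorm x.
Proof. exact: sqrtr_ge0. Qed.

Lemma enormZ (a : R) x : enorm (a *: x) = `|a| * enorm x.
Proof.
rewrite /enorm (_ : dotp (a *: x) (a *: x) = a ^+ 2 * dotp x x); last first.
  by rewrite /dotp big_distrr/=; apply: eq_bigr => i _; rewrite !mxE; ring.
by rewrite sqrtrM ?sqr_ge0// sqrtr_sqr.
Qed.

Lemma enormBC x y : enorm (x - y) = enorm (y - x).
Proof. by rewrite -opprB -scaleN1r enormZ normrN normr1 mul1r. Qed.

Lemma coord_le_enorm x i : `|x ord0 i| <= enorm x.
Proof.
rewrite -sqrtr_sqr; apply: ler_wsqrtr.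
by rewrite /dotp (bigD1 i)//= -expr2 lerDl sumr_ge0// => j _; rewrite -expr2 sqr_ge0.
Qed.

Lemma enorm_gt0 x i : x ord0 i != 0 -> 0 < enorm x.
Proof. by rewrite -normr_gt0 => /lt_le_trans; apply; exact: coord_le_enorm. Qed.

End euclidean_norm.

(** * Positivity sets of Lipschitz functions as regions above a graph *)

Section lipschitz_graph.
Context {R : realType} {d : nat}.
Variables (F : 'rV[R]_d -> R) (nu : 'rV[R]_d) (L c : R).
Hypothesis nu1 : enorm nu = 1.
Hypothesis L0 : 0 <= L.
Hypothesis c0 : 0 < c.
Hypothesis FL : forall x y, F x <= F y + L * enorm (x - y).
Hypothesis Fnu : forall x s, 0 <= s -> F x + c * s <= F (x + s *: nu).

Let A y := [set s | F (y + s *: nu) <= 0].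

(** The height at which F changes sign on the line y + s nu. Linear growth along [nu] makes the set
    of nonpositive heights nonempty and bounded. *)
Definition graph_function y : R := sup (A y).

Let F_mono y s t : s <= t -> F (y + s *: nu) + c * (t - s) <= F (y + t *: nu).
Proof.
move=> st; have := Fnu (y + s *: nu) (_ : 0 <= t - s); rewrite subr_ge0 => /(_ st).
by rewrite -addrA -scalerDl subrKC.
Qed.

Let A0 y : A y !=set0.
Proof.
exists (- (`|F y| / c)); rewrite /A/=.
have h : - (`|F y| / c) <= 0 by rewrite oppr_le0 divr_ge0// ltW.
have := F_mono y h; rewrite scale0r addr0 sub0r opprK mulrCA divff ?gt_eqF// mulr1.
by rewrite -lerBrDr => /le_trans; apply; rewrite subr_le0 ler_norm.
Qed.

Let ubA y : has_ubound (A y).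
Proof.
exists (`|F y| / c) => s; rewrite /A/= => Fs; rewrite leNgt; apply/negP => hs.
have s0 : 0 <= s by apply: le_trans (ltW hs); rewrite divr_ge0// ltW.
have := F_mono y s0; rewrite scale0r addr0 subr0 => /le_trans/(_ Fs).
apply/negP; rewrite -ltNge.
have : `|F y| < c * s by rewrite mulrC -ltr_pdivrMr.
have := ler_norm (- F y); rewrite normrN; lra.
Qed.

Lemma graph_functionP y s : (graph_function y < s) <-> 0 < F (y + s *: nu).
Proof.
split=> [gs|Fs].
  rewrite ltNge; apply/negP => Fs; move: gs; rewrite ltNge; apply/negP; rewrite negbK.
  exact: ub_le_sup.
(* Going down by e costs at most L e, less than the value of F, so F is still positive at s - e.
   This margin makes the inequality strict. *)
pose e := F (y + s *: nu) / (L + 1).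
have L1 : 0 < L + 1 by rewrite ltr_wpDl.
have e0 : 0 < e by rewrite divr_gt0.
apply: (@le_lt_trans _ _ (s - e)); last by rewrite gtrBl.
apply: ge_sup; first exact: A0.
move=> t; rewrite /A/= => Ft; rewrite leNgt; apply/negP => te.
have := F_mono y (ltW te); rewrite leNgt => /negP; apply.
apply: (le_lt_trans Ft); apply: ltr_pwDr; first by rewrite mulr_gt0// subr_gt0.
have := FL (y + s *: nu) (y + (s - e) *: nu).
have -> : y + s *: nu - (y + (s - e) *: nu) = e *: nu.
  by apply/rowP => j; rewrite !mxE; ring.
rewrite enormZ nu1 mulr1 gtr0_norm// => h.
have : L * e < F (y + s *: nu).
  by rewrite /e mulrCA gtr_pMr// ltr_pdivrMr// mul1r ltrDl.
by move: h; lra.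
Qed.

(** Moving the base point by e raises F by at most L e, and going down by L e / c along [nu]
    compensates for it. *)
Lemma graph_function_lipschitz y z :
  `|graph_function y - graph_function z| <= L / c * enorm (y - z).
Proof.
suff H y' z' : graph_function y' <= graph_function z' + L / c * enorm (y' - z').
  have h1 := H y z; have h2 := H z y; rewrite enormBC in h2.
  by rewrite ler_norml; apply/andP; split; lra.
apply: ge_sup; first exact: A0.
move=> s; rewrite /A/= => Fs; rewrite -lerBlDr; apply: ub_le_sup; first exact: ubA.
rewrite /A/=; set e := enorm _.
have e0 : 0 <= L / c * e by rewrite mulr_ge0 ?divr_ge0 ?enorm_ge0// ltW.
have := F_mono z' (_ : s - L / c * e <= s); rewrite gerBl => /(_ e0).
have -> : c * (s - (s - L / c * e)) = L * e by field; rewrite gt_eqF.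
move=> h.
have := FL (z' + s *: nu) (y' + s *: nu).
have -> : z' + s *: nu - (y' + s *: nu) = z' - y' by apply/rowP => j; rewrite !mxE; ring.
by rewrite enormBC -/e; lra.
Qed.

End lipschitz_graph.

Section horn_profile.
Context {R : realType}.
Variable N : R.
Hypothesis N0 : 0 <= N.

(** The upper clamp gives the horn a least width exp(-2 N), the [kap] required of the domain by the
    analysis on lines. *)
Definition profile_depth (r : R) : R := Num.max 0 (Num.min (r - 1) N).

(** At rate 2 the width is divided by e, hence at least by 2, on a step of length 1/2, and the slope
    never exceeds 2. *)
Definition profile (r : R) : R := expR (- (2 * profile_depth r)).

Lemma profile_depth_ge0 r : 0 <= profile_depth r.
Proof. by rewrite /profile_depth le_max lexx. Qed.

Lemma profile_depth_le r : profile_depth r <= N.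
Proof. by rewrite /profile_depth ge_max N0 ge_min lexx orbT. Qed.

Lemma profile_depth_lipschitz r s : r <= s ->
  profile_depth r <= profile_depth s <= profile_depth r + (s - r).
Proof.
move=> rs; have rs1 : r - 1 <= s - 1 by rewrite lerD2r.
have d0 : 0 <= s - r by rewrite subr_ge0.
rewrite /profile_depth; apply/andP; split.
  by rewrite ge_max le_max lexx/= le_max le_min !ge_min rs1 lexx !orbT.
rewrite ge_max addr_ge0//=; last by rewrite le_max lexx.
have [h1|h1] := leP (r - 1) N; last first.
  by rewrite ge_min (max_r N0) lerDl d0 orbT.
rewrite ge_min (_ : s - 1 <= _)//; have -> : s - 1 = r - 1 + (s - r) by ring.
by rewrite lerD2r le_max lexx orbT.
Qed.

Lemma profile_gt0 r : 0 < profile r.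
Proof. exact: expR_gt0. Qed.

Lemma profile_le1 r : profile r <= 1.
Proof.
by rewrite /profile -expR0 ler_expR oppr_le0 mulr_ge0// profile_depth_ge0.
Qed.

Lemma profile_ge r : expR (- (2 * N)) <= profile r.
Proof. by rewrite /profile ler_expR lerN2 ler_pM2l// profile_depth_le. Qed.

Lemma profile_nonincr r s : r <= s -> profile s <= profile r.
Proof.
by move=> /profile_depth_lipschitz/andP[h _]; rewrite ler_expR lerN2 ler_pM2l.
Qed.

Lemma profile_eq1 r : r <= 1 -> profile r = 1.
Proof.
move=> r1; rewrite /profile (_ : profile_depth r = 0) ?mulr0 ?oppr0 ?expR0//.
by rewrite /profile_depth max_l// ge_min subr_le0 r1.
Qed.

Lemma profile_half r : 1 <= r -> r + 2^-1 <= N + 1 -> profile (r + 2^-1) <= profile r / 2.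
Proof.
move=> r1 rN; have -> : profile r = profile (r + 2^-1) * expR 1.
  rewrite -expRD; congr expR; rewrite /profile_depth.
  rewrite (min_l (_ : r - 1 <= N)); last by lra.
  rewrite (min_l (_ : r + 2^-1 - 1 <= N)); last by lra.
  rewrite !max_r; lra.
rewrite -mulrA ler_peMr ?(ltW (profile_gt0 _))// ler_pdivlMr// mul1r.
exact: le_trans (expR_ge1Dx 1).
Qed.

Lemma profile_lipschitz r s : `|profile r - profile s| <= 2 * `|r - s|.
Proof.
wlog rs : r s / r <= s.
  move=> H; have [/H//|/ltW/H] := leP r s.
  by rewrite distrC [`|s - r|]distrC.
rewrite ger0_norm ?subr_ge0 ?profile_nonincr// distrC ger0_norm ?subr_ge0//.
have /andP[h1 h2] := profile_depth_lipschitz rs.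
have -> : profile s = profile r * expR (- (2 * (profile_depth s - profile_depth r))).
  by rewrite -expRD; congr expR; ring.
have := expR_ge1Dx (- (2 * (profile_depth s - profile_depth r))).
set E := expR _ => hE; have := profile_le1 r; have := profile_gt0 r.
set p := profile r => p0 p1.
have : p * (1 - E) <= 1 * (2 * (s - r)).
  have [E1|E1] := leP 0 (1 - E); last first.
    apply: (@le_trans _ _ 0); last by rewrite mul1r mulr_ge0// subr_ge0.
    by rewrite pmulr_rle0// ltW.
  by rewrite ler_pM// ?(ltW p0)//; lra.
by rewrite mulrBr mulr1 mul1r.
Qed.

End horn_profile.

Lemma convex_lt {R : realFieldType} (t a b c : R) : 0 <= t <= 1 -> a < c -> b < c ->
  (1 - t) * a + t * b < c.
Proof.
move=> /andP[t0 t1] ac bc; rewrite -subr_gt0.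
have -> : c - ((1 - t) * a + t * b) = (1 - t) * (c - a) + t * (c - b) by ring.
have [->|tn] := eqVneq t 1; first by rewrite subrr mul0r add0r mul1r subr_gt0.
apply: ltr_pwDl; last by rewrite mulr_ge0// subr_ge0 ltW.
by rewrite mulr_gt0// subr_gt0// lt_neqAle tn.
Qed.

Section horn.
Context {R : realType} {d : nat}.
Variables (N : R) (i0 i1 : 'I_d).
Hypothesis N0 : 0 <= N.
Hypothesis i01 : i1 != i0.

Definition horn : set 'rV[R]_d := [set x | [/\ forall j, 0 < x ord0 j,
  x ord0 i0 < N + 1, x ord0 i1 < profile N (x ord0 i0) &
  forall j, j != i0 -> x ord0 j < 1]].

Local Notation kap := (expR (- (2 * N))).

Lemma kap_le1 : kap <= 1.
Proof. exact: le_trans (profile_ge N0 0) (profile_le1 _ _). Qed.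

Lemma horn_bounds x : horn x -> forall j, 0 < x ord0 j < N + 1.
Proof.
move=> [x0 xN _ x1] j; rewrite x0/=; have [->//|/x1 xj] := eqVneq j i0.
by apply: (lt_le_trans xj); rewrite lerDr.
Qed.

Lemma horn_down (b x : 'rV[R]_d) : horn b ->
  (forall j, 0 < x ord0 j <= b ord0 j) -> horn x.
Proof.
move=> [b0 bN bh b1] xb; have xle j : x ord0 j <= b ord0 j by case/andP: (xb j).
split.
- by move=> j; case/andP: (xb j).
- exact: le_lt_trans bN.
- by apply: (le_lt_trans (xle _)); apply: (lt_le_trans bh); exact: profile_nonincr.
- by move=> j ji; apply: (le_lt_trans (xle _)); exact: b1.
Qed.

(** A coordinate [i1] below the least width fits at every depth, and lowering the coordinate [i0]
    below kap <= 1 lands where the width is 1. *)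
Lemma horn_low (x : 'rV[R]_d) j t : horn x -> 0 < t < kap -> horn (upd j t x).
Proof.
move=> [x0 xN xh x1] /andP[t0 tk]; have t1 : t < 1 := lt_le_trans tk kap_le1.
split.
- by move=> k; rewrite updE; case: eqP.
- by rewrite updE; case: eqP => // _; apply: (lt_le_trans t1); rewrite lerDr.
- have [ji|ji1] := eqVneq j i1.
    rewrite ji upd_eq upd_neq; first exact: (lt_le_trans tk (profile_ge N0 _)).
    by rewrite eq_sym.
  rewrite (upd_neq _ _ (_ : i1 != j)); last by rewrite eq_sym.
  have [ji0|ji0] := eqVneq j i0; last by rewrite upd_neq// eq_sym.
  by rewrite ji0 upd_eq (profile_eq1 N (ltW t1)) x1.
- by move=> k ki; rewrite updE; case: eqP => // _; exact: x1.
Qed.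

Lemma horn_cube x : horn x -> x ord0 i0 < 1 -> rbox (fun=> `]0, 1[%classic) x.
Proof.
move=> [x0 _ _ x1] xi0 j; rewrite /= in_itv/= x0/=.
by have [->//|/x1] := eqVneq j i0.
Qed.

Lemma cube_horn x : rbox (fun=> `]0, 1[%classic) x -> horn x.
Proof.
move=> xc; have x01 j : 0 < x ord0 j < 1 by have := xc j; rewrite /= in_itv.
have x1 j : x ord0 j < 1 by case/andP: (x01 j).
split => //.
- by move=> j; case/andP: (x01 j).
- by apply: lt_le_trans (x1 _) _; rewrite lerDr.
- by rewrite (profile_eq1 N (ltW (x1 _))).
Qed.

Lemma profile_continuous : continuous (profile N).
Proof.
move=> r; apply/cvgrPdist_le => e e0; near=> s.
apply: (le_trans (profile_lipschitz N0 r s)).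
have : `|r - s| <= e / 2 by near: s; apply: cvgr_dist_le => //; rewrite divr_gt0.
by rewrite ler_pdivlMr// mulrC.
Unshelve. all: end_near. Qed.

Lemma horn_open : open horn.
Proof.
rewrite openE => x [x0 xN xh x1]; rewrite /interior.
have cc j : (y ord0 j : R) @[y --> x] --> x ord0 j by exact: coord_continuous.
have H1 : \forall y \near x, forall j, 0 < (y : 'rV[R]_d) ord0 j.
  refine (@filter_forall _ _ (fun j => [set y : 'rV[R]_d | 0 < y ord0 j]) (nbhs x) _ _) => j.
  exact: (cvgr_gt _ (cc j)).
have H2 : \forall y \near x, (y : 'rV[R]_d) ord0 i0 < N + 1.
  exact: (cvgr_lt _ (cc i0)).
have H3 : \forall y \near x, 0 < profile N ((y : 'rV[R]_d) ord0 i0) - y ord0 i1.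
  have cp : continuous (profile N \o (fun y : 'rV[R]_d => y ord0 i0)).
    by move=> y; apply: continuous_comp; [exact: coord_continuous|exact: profile_continuous].
  have c1 : continuous (fun y : 'rV[R]_d => y ord0 i1) by exact: coord_continuous.
  have c3 := continuousB (cp x) (c1 x).
  by apply: (cvgr_gt _ c3); rewrite /= subr_gt0.
have H4 : \forall y \near x, forall j, j != i0 -> (y : 'rV[R]_d) ord0 j < 1.
  refine (@filter_forall _ _ (fun j => [set y : 'rV[R]_d | j != i0 -> y ord0 j < 1]) (nbhs x) _ _) => j.
  have [->|ji] := eqVneq j i0; first by apply: nearW => y /=.
  rewrite (_ : [set y | _] = [set y : 'rV[R]_d | y ord0 j < 1]).
    exact: (cvgr_lt _ (cc j) _ (x1 j ji)).
  by apply/seteqP; split => y /= h; [exact: h|move=> _].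
near=> y; split; first by near: y.
- by near: y.
- by rewrite -subr_gt0; near: y.
- by near: y.
Unshelve. all: end_near. Qed.

Lemma measurable_profile : measurable_fun setT (profile N).
Proof. exact: continuous_measurable_fun profile_continuous. Qed.

Lemma measurable_horn : measurable horn.
Proof.
have -> : horn = (rbox (fun=> `]0, +oo[%classic) `&`
   rbox (fun j => if j == i0 then `]-oo, N + 1[%classic else `]-oo, 1[%classic)) `&`
   [set x | x ord0 i1 < profile N (x ord0 i0)].
  apply/seteqP; split => x.
    move=> [x0 xN xh x1]; split => //; split => j; rewrite /= ?in_itv/= ?x0//.
    by case: eqP => [->|/eqP ji]; rewrite /= in_itv//=; exact: x1.
  move=> [[x0 x1] xh]; split => //.
  - by move=> j; have := x0 j; rewrite /= in_itv/= andbT.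
  - by have := x1 i0; rewrite eqxx /= in_itv.
  - by move=> j ji; have := x1 j; rewrite (negbTE ji) /= in_itv.
apply: measurableI.
  by apply: measurableI; apply: measurable_rbox => j; try case: ifP => _; exact: measurable_itv.
rewrite -[X in measurable X]setTI.
have mlt : measurable_fun setT (fun x : 'rV[R]_d => x ord0 i1 < profile N (x ord0 i0)).
  apply: measurable_fun_ltr; first exact: measurable_coord.
  by apply: (measurableT_comp measurable_profile); exact: measurable_coord.
exact: (mlt measurableT [set true]).
Qed.

Section horn_lipschitz.
Variable x0 : 'rV[R]_d.

(* At x0 only one of the constraints 0 < x_j and x_j < up j x can be active for each
   j, so near x0 the horn is the set where the minimum F of these d Lipschitz
   functions is positive; F grows linearly in the direction nut. *)
Let low j : bool :=
  if j == i0 then x0 ord0 i0 < (N + 1) / 2 else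
  if j == i1 then x0 ord0 i1 < kap / 2 else x0 ord0 j < 1 / 2.

Let up j (x : 'rV[R]_d) : R :=
  if j == i0 then N + 1 else if j == i1 then profile N (x ord0 i0) else 1.

Let f j (x : 'rV[R]_d) : R := if low j then x ord0 j else up j x - x ord0 j.

Let F x := \big[Order.min/f i0 x]_j f j x.

Let nut : 'rV[R]_d := \row_j ((if low j then 1 else -1) * (if j == i0 then 1 else 3)).

Let f_lip j x y : f j x <= f j y + 3 * enorm (x - y).
Proof.
have c k : `|x ord0 k - y ord0 k| <= enorm (x - y).
  by have := coord_le_enorm (x - y) k; rewrite !mxE.
have e0 := enorm_ge0 (x - y).
have /ler_normlP[a1 a2] := c j; have c0 := c i0.
have /ler_normlP[b1 b2] := profile_lipschitz N0 (x ord0 i0) (y ord0 i0).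
rewrite /f /up; case: (low j); first by move: a1 a2 e0; lra.
case: eqP => _; first by move: a1 a2 e0; lra.
by case: eqP => _; [move: a1 a2 e0 b1 b2 c0|move: a1 a2 e0]; lra.
Qed.

(** The weight 3 on the transverse coordinates beats the profile: its slope is at most 2 and the
    coordinate [i0] moves at speed 1, which leaves 3 - 2 = 1. *)
Let f_incr j x s : 0 <= s -> f j x + s <= f j (x + s *: nut).
Proof.
move=> s0; rewrite /f /up !mxE eqxx mulr1.
have [lj|lj] := boolP (low j).
  by rewrite mul1r; case: eqP => _; lra.
have [_|ji0] := eqVneq j i0; first by lra.
have [_|ji1] := eqVneq j i1; last by lra.
set t := if _ then _ else _; have t1 : `|s * t| <= s.
  by rewrite normrM (ger0_norm s0) ler_piMr// /t; case: ifP; rewrite ?normrN normr1.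
have := profile_lipschitz N0 (x ord0 i0) (x ord0 i0 + s * t).
rewrite (_ : x ord0 i0 - (x ord0 i0 + s * t) = - (s * t)); last by ring.
by rewrite normrN => /ler_normlP[_ h]; move: h t1 s0; lra.
Qed.

Let nut0 : 0 < enorm nut.
Proof.
by apply: (@enorm_gt0 _ _ _ i0); rewrite mxE eqxx mulr1; case: ifP; rewrite ?oppr_eq0 oner_neq0.
Qed.

Let F_lip x y : F x <= F y + 3 * enorm (x - y).
Proof.
rewrite -lerBlDr; apply: le_bigmin => [|j _]; rewrite lerBlDr.
  exact: le_trans (bigmin_le_id _ _ _ _) (f_lip _ _ _).
exact: le_trans (bigmin_le _ _ _) (f_lip _ _ _).
Qed.

Let F_incr x s : 0 <= s ->
  F x + (enorm nut)^-1 * s <= F (x + s *: ((enorm nut)^-1 *: nut)).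
Proof.
move=> s0; rewrite scalerA mulrC; set t := s / _.
have t0 : 0 <= t by rewrite divr_ge0// ltW.
apply: le_bigmin => [|j _]; apply: le_trans (f_incr _ x t0); rewrite lerD2r.
  exact: bigmin_le_id.
exact: bigmin_le.
Qed.

(** The thresholds of [low] are such that, within kap / 2 of [x0], the constraint discarded for j
    holds automatically; for [i1] this uses that the width is at least kap everywhere. *)
Let F_horn x : enorm (x - x0) < kap / 2 -> (horn x <-> 0 < F x).
Proof.
have kl1 := kap_le1; have k0 : 0 < kap := expR_gt0 _.
move=> xr; have xj j : x0 ord0 j - kap / 2 < x ord0 j < x0 ord0 j + kap / 2.
  have := le_lt_trans (coord_le_enorm (x - x0) j) xr; rewrite !mxE ltr_norml.
  by move=> /andP[h1 h2]; apply/andP; split; lra.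
split=> [[y0 yN yh y1]|/bigmin_gtP[_ fx]].
  have H j : 0 < f j x.
    rewrite /f /up; case: ifP => _ //; rewrite subr_gt0.
    by case: eqP => [->//|/eqP ji0]; case: eqP => [->//|_]; exact: y1.
  by apply/bigmin_gtP; split => [|j _]; exact: H.
have fj j : 0 < f j x by exact: fx.
have y0 j : 0 < x ord0 j.
  have := fj j; rewrite /f; case: (boolP (low j)) => //; rewrite /low.
  have /andP[h1 h2] := xj j; move: h1 h2 kl1 k0 N0.
  case: eqP => [->|_]; first by rewrite -leNgt; lra.
  by case: eqP => [->|_]; rewrite -leNgt; lra.
have yh : x ord0 i1 < profile N (x ord0 i0).
  have := fj i1; rewrite /f; case: (boolP (low i1)); last first.
    by rewrite /up (negbTE i01) eqxx subr_gt0.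
  rewrite /low (negbTE i01) eqxx => l1 _; apply: lt_le_trans (profile_ge N0 _).
  have /andP[_ h2] := xj i1; move: h2 l1; lra.
split => //.
  have := fj i0; rewrite /f; case: (boolP (low i0)); last first.
    by rewrite /up eqxx subr_gt0.
  rewrite /low eqxx => l1 _; have /andP[_ h2] := xj i0.
  by move: h2 l1 kl1 N0; lra.
move=> j ji0; have [->|ji1] := eqVneq j i1.
  by apply: (lt_le_trans yh); exact: profile_le1.
have := fj j; rewrite /f; case: (boolP (low j)); last first.
  by rewrite /up (negbTE ji0) (negbTE ji1) subr_gt0.
rewrite /low (negbTE ji0) (negbTE ji1) => l1 _; have /andP[_ h2] := xj j.
by move: h2 l1 kl1; lra.
Qed.

Lemma horn_graph : exists (r L : R) (nu : 'rV[R]_d) (gamma : 'rV[R]_d -> R),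
    [/\ 0 < r, enorm nu = 1,
        forall y z, `|gamma y - gamma z| <= L * enorm (y - z)
      & forall x, enorm (x - x0) < r ->
          (horn x <-> gamma (x - dotp x nu *: nu) < dotp x nu)].
Proof.
pose nu := (enorm nut)^-1 *: nut.
have nu1 : enorm nu = 1.
  by rewrite /nu enormZ ger0_norm ?invr_ge0 ?enorm_ge0// mulVf// gt_eqF.
have c0 : 0 < (enorm nut)^-1 by rewrite invr_gt0.
have L0 : (0 : R) <= 3 by [].
exists (kap / 2), (3 / (enorm nut)^-1), nu, (graph_function F nu); split => //.
- by rewrite divr_gt0// expR_gt0.
- exact: (graph_function_lipschitz L0 c0 F_lip F_incr).
- move=> x xr; rewrite F_horn//.
  have := graph_functionP nu1 L0 c0 F_lip F_incr (x - dotp x nu *: nu) (dotp x nu).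
  by rewrite subrK => H; split => /H.
Qed.

End horn_lipschitz.

Let half := kap / 2.

Let half_horn : horn (\row_j half).
Proof.
have k0 : 0 < kap := expR_gt0 _; have k1 := kap_le1.
have h1 : half < 1 by rewrite /half; move: k1; lra.
have h0 : 0 < half by rewrite divr_gt0.
split; rewrite ?mxE.
- by move=> j; rewrite mxE.
- by apply: (lt_le_trans h1); rewrite lerDr.
- by rewrite (profile_eq1 N (ltW h1)).
- by move=> j _; rewrite mxE.
Qed.

(** The horn is star-shaped about the point whose coordinates all equal kap / 2, and a union of
    segments through a common point is connected. *)
Lemma horn_connected : connected horn.
Proof.
have k0 : 0 < kap := expR_gt0 _; have k1 := kap_le1.
have h1 : half < 1 by rewrite /half; move: k1; lra.
have h0 : 0 < half by rewrite divr_gt0.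
have hk : half < kap by rewrite /half; move: k0; lra.
pose seg (x : 'rV[R]_d) (t : R) : 'rV[R]_d := (1 - t) *: x + t *: \row_j half.
have segE x t j : seg x t ord0 j = (1 - t) * x ord0 j + t * half by rewrite !mxE.
have seg_horn x t : horn x -> 0 <= t <= 1 -> horn (seg x t).
  move=> [x0 xN xh x1] /andP[t0 t1]; split.
  - move=> j; rewrite segE; have := x0 j; have [->|tn] := eqVneq t 1.
      by rewrite subrr mul0r add0r mul1r.
    move=> xj; apply: ltr_pwDl; last by rewrite mulr_ge0// ltW.
    by rewrite mulr_gt0// subr_gt0 lt_neqAle tn.
  - rewrite segE; apply: convex_lt => //; first by rewrite t0.
    by apply: (lt_le_trans h1); rewrite lerDr.
  - apply: (@lt_le_trans _ _ (profile N (x ord0 i0))).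
      rewrite segE; apply: convex_lt => //; first by rewrite t0.
      by apply: lt_le_trans (profile_ge N0 _); exact: hk.
    (* Either the segment heads towards smaller [i0], where the horn is wider, or it stays in the
       cube, where the width is 1. *)
    have [hx|xh'] := leP half (x ord0 i0).
      apply: (profile_nonincr N0); rewrite segE.
      have : t * (x ord0 i0 - half) >= 0 by rewrite mulr_ge0// subr_ge0.
      by rewrite mulrBr mulrBl mul1r; lra.
    rewrite [leRHS]profile_eq1 ?profile_le1// segE ltW//.
    by apply: convex_lt => //; [rewrite t0|exact: lt_trans h1].
  - by move=> j ji; rewrite segE; apply: convex_lt; [rewrite t0|exact: x1|].
rewrite (_ : horn = \bigcup_(x in horn) (seg x @` `[0, 1])); last first.
  apply/seteqP; split=> [x hx|y [x hx [t]]].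
    exists x => //; exists 0; first by rewrite /= in_itv/= lexx ler01.
    by apply/rowP => j; rewrite segE subr0 mul1r mul0r addr0.
  by rewrite /= in_itv/= => t01 <-; exact: seg_horn.
apply: bigcup_connected.
  exists (\row_j half) => x hx; exists 1; first by rewrite /= in_itv/= lexx ler01.
  by apply/rowP => j; rewrite segE subrr mul0r add0r mul1r mxE.
move=> x hx; apply: connected_continuous_connected; first exact: segment_connected.
apply: continuous_subspaceT => t.
apply: cvgD; apply: cvgZ; try exact: cvg_cst; last exact: cvg_id.
by apply: cvgB; [exact: cvg_cst|exact: cvg_id].
Qed.

Lemma horn_bounded : bounded_set horn.
Proof.
have : bounded_set [set x : 'rV[R]_d | forall j, `[0, N + 1]%classic (x ord0 j)].
  apply: compact_bounded; apply: (@rV_compact _ _ (fun=> `[0, N + 1]%classic)) => j.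
  exact: segment_compact.
move=> [B [Br HB]]; exists B; split => // y yB x hx; apply: (HB y yB) => j.
by rewrite /= in_itv/=; have /andP[/ltW -> /ltW ->] := horn_bounds hx j.
Qed.

Lemma horn_lipschitz_domain : lipschitz_domain horn.
Proof.
split; [by exists (\row_j half)|exact: horn_bounded|exact: horn_connected|
  exact: horn_open|by move=> x0 _; exact: horn_graph].
Qed.

Lemma horn_diameter : (N%:E <= diameter horn)%E.
Proof.
have k0 : 0 < kap := expR_gt0 _; have k1 := kap_le1.
have h1 : half < 1 by rewrite /half; move: k1; lra.
have h0 : 0 < half by rewrite divr_gt0.
have hk : half < kap by rewrite /half; move: k0; lra.
(* Its coordinate [i1] is below kap, so it fits in the narrowest section; it is at distance N from
   the base point along [i0]. *)
pose y : 'rV[R]_d := upd i0 (N + half) (\row_j half).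
have hy : horn y.
  split.
  - by move=> j; rewrite updE mxE; case: eqP => // _; rewrite ltr_wpDl.
  - by rewrite upd_eq ltrD2l.
  - by rewrite upd_neq// mxE; apply: (lt_le_trans hk); exact: profile_ge.
  - by move=> j ji; rewrite upd_neq// mxE.
apply: (@le_trans _ _ (enorm (y - \row_j half))%:E).
  rewrite lee_fin; apply: le_trans (coord_le_enorm _ i0).
  by rewrite !mxE eqxx addrK ger0_norm.
by apply: ereal_sup_ubound; exists (y, \row_j half).
Qed.

End horn.

(** * The Poincare inequality on the horn *)

(** Young's inequality with parameter 1/8: 9/8 = 1 + 1/8 and 9 = 1 + 8. *)
Lemma weighted_triangle {R : realFieldType} (p a b c : R) : 0 <= p ->
  p * (a - c) ^+ 2 <= 9 / 8 * (p * (b - c) ^+ 2) + 9 * (p * (a - b) ^+ 2).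
Proof.
move=> p0; rewrite -subr_ge0.
have -> : 9 / 8 * (p * (b - c) ^+ 2) + 9 * (p * (a - b) ^+ 2) - p * (a - c) ^+ 2 =
  p * (b - c - 8 * (a - b)) ^+ 2 / 8 by field.
by rewrite divr_ge0// mulr_ge0 ?sqr_ge0.
Qed.

Section horn_poincare.
Context {R : realType} {d : nat}.
Local Notation leb := (lebesgue_rV d : {sigma_finite_measure set 'rV[R]_d -> \bar R}).
Local Notation lam := (@lebesgue_measure R).
Local Notation Z := (measurableTypeR R * 'rV[R]_d)%type.
Local Notation e_ i := (delta_mx ord0 i : 'rV[R]_d).
Variables (N : R) (i0 i1 : 'I_d) (u : 'rV[R]_d -> R) (g : 'I_d -> 'rV[R]_d -> R).
Hypothesis N0 : 0 <= N.
Hypothesis i01 : i1 != i0.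
Local Notation Omega := (horn N i0 i1).
Hypothesis iu : leb.-integrable setT (EFin \o u).
Hypothesis ig : forall i, leb.-integrable setT (EFin \o g i).
Hypothesis g0 : forall i x, ~ Omega x -> g i x = 0.
Hypothesis weak : forall i phi, C1c Omega phi ->
  \int[leb]_x (u x * 'D_(e_ i) phi x) = - \int[leb]_x (g i x * phi x).

Let mu : measurable_fun setT u.
Proof. by apply/measurable_EFinP; exact: measurable_int iu. Qed.

Let N1 : 0 <= N + 1. Proof. by rewrite addr_ge0. Qed.

Let chi (x : 'rV[R]_d) : R := \1_Omega x.

Let mchi : measurable_fun setT chi.
Proof. by apply: measurable_indic; exact: measurable_horn. Qed.

Let chi1 x : Omega x -> chi x = 1.
Proof. by move=> h; rewrite /chi indicE mem_set. Qed.

Let chi0 x : ~ Omega x -> chi x = 0.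
Proof. by move=> h; rewrite /chi indicE memNset. Qed.

Let energy i : \bar R := (\int[leb]_x (g i x ^+ 2)%:E)%E.

Section transfer.
Variables (i : 'I_d) (l : 'rV[R]_d -> R) (p : Z -> R) (A B : 'rV[R]_d -> R) (c : R).
Hypothesis l01 : forall x, 0 < l x <= 1.
Hypothesis ml : measurable_fun setT l.
Hypothesis l_upd : forall s x, l (upd i s x) = l x.
Hypothesis mp : measurable_fun setT p.
Hypothesis p0l : forall z, 0 <= p z <= (l z.2)^-1.
Hypothesis pS : forall s x, p (s, x) != 0 ->
  [/\ Omega x, Omega (upd i s x) & `|s - x ord0 i| <= l x].

Lemma horn_pair_energy : (\int[leb]_x \int[lam]_s
  (p (s, x) * (u x - u (upd i s x)) ^+ 2)%:E <= 8%:E * energy i)%E.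
Proof.
exact (pair_energy (expR_gt0 _) N1 (@horn_bounds _ _ N i0 i1 N0) (@horn_down _ _ N i0 i1 N0)
  (@horn_low _ _ N i0 i1 N0 i01) (@horn_open _ _ N i0 i1 N0) iu (ig i) (g0 i) (weak i) l01 ml l_upd mp p0l pS).
Qed.

Hypothesis mA : measurable_fun setT A.
Hypothesis mB : measurable_fun setT B.
Hypothesis A0 : forall x, 0 <= A x.
(* p couples x with points s of its line: A bounds the first marginal of p from
   below, B the second one from above. *)
Hypothesis pA : forall x, Omega x -> ((A x)%:E <= \int[lam]_s (p (s, x))%:E)%E.
Hypothesis pB : forall x, Omega x ->
  (\int[lam]_s (p (x ord0 i, upd i s x))%:E <= (B x)%:E)%E.

Let f x := (u x - c) ^+ 2 * chi x.

Let f_ge0 x : 0 <= f x. Proof. by rewrite mulr_ge0 ?sqr_ge0. Qed.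

Let mf : measurable_fun setT f.
Proof.
apply: measurable_funM => //; apply: measurable_funX.
by apply: measurable_funB => //; exact: measurable_cst.
Qed.

(** For a pair (x, y) weighted by p, f x is compared with f y by [weighted_triangle]. The first
    marginal gives A, the second one, after the swap, gives B, and 72 = 9 * 8 combines the Young
    factor with [pair_energy]. *)
Lemma transfer : (\int[leb]_x (A x * f x)%:E <=
  (9 / 8)%:E * \int[leb]_x (B x * f x)%:E + 72%:E * energy i)%E.
Proof.
have p0 z : 0 <= p z by case/andP: (p0l z).
have mfst2 : measurable_fun setT (fun z : Z => f z.2).
  by apply: (measurableT_comp mf); exact: measurable_snd.
have mupd : measurable_fun setT (fun z : Z => upd i z.1 z.2).
  by apply: measurable_upd; [exact: measurable_fst|exact: measurable_snd].
pose H1 (z : Z) := (p z * f z.2)%:E.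
pose H2 (z : Z) := (p z * f (upd i z.1 z.2))%:E.
pose H3 (z : Z) := (p z * (u z.2 - u (upd i z.1 z.2)) ^+ 2)%:E.
have mH1 : measurable_fun setT H1 by apply/measurable_EFinP; exact: measurable_funM.
have mH2 : measurable_fun setT H2.
  by apply/measurable_EFinP; apply: measurable_funM => //; exact: (measurableT_comp mf).
have mH3 : measurable_fun setT H3.
  apply/measurable_EFinP; apply: measurable_funM => //; apply: measurable_funX.
  apply: measurable_funB; first by apply: (measurableT_comp mu); exact: measurable_snd.
  exact: (measurableT_comp mu).
have H10 z : (0 <= H1 z)%E by rewrite lee_fin mulr_ge0.
have H20 z : (0 <= H2 z)%E by rewrite lee_fin mulr_ge0.
have H30 z : (0 <= H3 z)%E by rewrite lee_fin mulr_ge0 ?sqr_ge0.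
have mps x : measurable_fun setT (fun s => (p (s, x))%:E).
  by apply/measurable_EFinP; exact: measurable_fun_pair1 mp.
have step1 : (\int[leb]_x (A x * f x)%:E <= \int[lam \x leb]_z H1 z)%E.
  rewrite (fubini_tonelli2 H1)//; apply: ge0_le_integral => //.
  - by move=> x _; rewrite lee_fin mulr_ge0.
  - by apply/measurable_EFinP; exact: measurable_funM.
  - exact: (measurable_fun_fubini_tonelli_G H1).
  move=> x _; rewrite /fubini_G /H1 /=.
  have [Ox|Ox] := pselect (Omega x); last first.
    rewrite /f chi0// !mulr0; apply: integral_ge0 => s _; rewrite mulr0 lexx//.
  under eq_integral do rewrite EFinM.
  rewrite ge0_integralZr//; last 2 first.
  - by move=> s _; rewrite lee_fin.
  - by rewrite lee_fin.
  by rewrite EFinM lee_wpmul2r ?lee_fin//; exact: pA.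
have step2 : (\int[lam \x leb]_z H1 z <=
    (9 / 8)%:E * \int[lam \x leb]_z H2 z + 9%:E * \int[lam \x leb]_z H3 z)%E.
  rewrite -!ge0_integralZl//.
  rewrite -ge0_integralD//; last 4 first.
  - by move=> z _; rewrite mule_ge0// lee_fin.
  - by apply: emeasurable_funM => //; exact: measurable_cst.
  - by move=> z _; rewrite mule_ge0.
  - by apply: emeasurable_funM => //; exact: measurable_cst.
  apply: ge0_le_integral => //.
    by apply: emeasurable_funD; apply: emeasurable_funM => //; exact: measurable_cst.
  move=> [s x] _; rewrite /H1 /H2 /H3 /= -!EFinM -EFinD lee_fin.
  have [->|/pS[Ox Oy _]] := eqVneq (p (s, x)) 0; first by rewrite !mul0r !mulr0 addr0.
  rewrite /f (chi1 Ox) (chi1 Oy) !mulr1; exact: weighted_triangle.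
have step3 : (\int[lam \x leb]_z H2 z <= \int[leb]_x (B x * f x)%:E)%E.
  rewrite (fubini_tonelli2 H2)// -/(fubini_G _ _) .
  rewrite [leLHS](tonelli_swap i (F := H2))//; apply: ge0_le_integral => //.
  - by move=> x _; apply: integral_ge0 => s _; exact: H20.
  - apply: (measurable_fun_fubini_tonelli_G (H2 \o cswap i)).
      by apply: (measurableT_comp mH2); exact: measurable_cswap.
    by move=> z; exact: H20.
  - by apply/measurable_EFinP; exact: measurable_funM.
  move=> x _; rewrite /H2 /=; under eq_integral do rewrite upd_upd upd_id.
  have [Ox|Ox] := pselect (Omega x); last first.
    by rewrite /f chi0// !mulr0; under eq_integral do rewrite mulr0; rewrite integral0.
  under eq_integral do rewrite EFinM.
  rewrite ge0_integralZr//; last 3 first.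
  - apply/measurable_EFinP; apply: (measurableT_comp mp).
    apply: measurable_fun_pair; first exact: measurable_cst.
    by apply: measurable_upd => //; exact: measurable_cst.
  - by move=> s _; rewrite lee_fin.
  - by rewrite lee_fin.
  rewrite (EFinM (B x)); apply: lee_wpmul2r; [by rewrite lee_fin|exact: pB].
have step4 : (\int[lam \x leb]_z H3 z <= 8%:E * energy i)%E.
  by rewrite (fubini_tonelli2 H3)//; exact: horn_pair_energy.
apply: (le_trans step1); apply: (le_trans step2); apply: leeD.
  by apply: lee_wpmul2l; [rewrite lee_fin|exact: step3].
have -> : 72%:E = (9%:E * 8%:E : \bar R)%E by rewrite -EFinM; congr EFin; ring.
by rewrite -muleA; apply: lee_wpmul2l; [rewrite lee_fin|exact: step4].
Qed.

End transfer.

End horn_poincare.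

Lemma natr_bool_ge0 {R : numDomainType} (b : bool) : 0 <= b%:R :> R.
Proof. exact: ler0n. Qed.

Lemma natr_bool_le1 {R : numDomainType} (b : bool) : b%:R <= 1 :> R.
Proof. by rewrite lern1 leq_b1. Qed.

(** * Comparison within the cube, to the left, and upwards *)

Section horn_instances.
Context {R : realType} {d : nat}.
Local Notation leb := (lebesgue_rV d : {sigma_finite_measure set 'rV[R]_d -> \bar R}).
Local Notation lam := (@lebesgue_measure R).
Local Notation Z := (measurableTypeR R * 'rV[R]_d)%type.
Local Notation e_ i := (delta_mx ord0 i : 'rV[R]_d).
Variables (N : R) (i0 i1 : 'I_d) (u : 'rV[R]_d -> R) (g : 'I_d -> 'rV[R]_d -> R).
Hypothesis N0 : 0 <= N.
Hypothesis i01 : i1 != i0.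
Local Notation Omega := (horn N i0 i1).
Hypothesis iu : leb.-integrable setT (EFin \o u).
Hypothesis ig : forall i, leb.-integrable setT (EFin \o g i).
Hypothesis g0 : forall i x, ~ Omega x -> g i x = 0.
Hypothesis weak : forall i phi, C1c Omega phi ->
  \int[leb]_x (u x * 'D_(e_ i) phi x) = - \int[leb]_x (g i x * phi x).

Local Notation chi := (\1_Omega : 'rV[R]_d -> R).
Local Notation pr x := (profile N (x ord0 i0)).

Let energy i : \bar R := (\int[leb]_x (g i x ^+ 2)%:E)%E.

Let mcoord j : measurable_fun setT (fun x : 'rV[R]_d => x ord0 j).
Proof. exact: measurable_coord. Qed.

Let mcoord2 j : measurable_fun setT (fun z : Z => z.2 ord0 j).
Proof. by apply: measurable_coord; exact: measurable_snd. Qed.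

Let mpr : measurable_fun setT (fun x : 'rV[R]_d => pr x).
Proof. by apply: (measurableT_comp (measurable_profile N0)). Qed.

Let mpr2 : measurable_fun setT (fun z : Z => pr z.2).
Proof. by apply: (measurableT_comp (measurable_profile N0)). Qed.

Let mchi : measurable_fun setT chi.
Proof. by apply: measurable_indic; exact: measurable_horn. Qed.

Let mchi2 : measurable_fun setT (fun z : Z => chi z.2).
Proof. by apply: (measurableT_comp mchi); exact: measurable_snd. Qed.

Let chi_neq0 x : chi x != 0 -> Omega x.
Proof. by rewrite indicE; case: (boolP (x \in Omega)) => [/set_mem//|]; rewrite eqxx. Qed.

Lemma cube_energy_horn i : (cube_energy i u <= 8%:E * energy i)%E.
Proof.
have mu : measurable_fun setT u by apply/measurable_EFinP; exact: measurable_int iu.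
pose p (z : Z) := in_cube z.2 * in01 z.1.
have -> : cube_energy i u = (\int[leb]_x \int[lam]_s
    (p (s, x) * (u x - u (upd i s x)) ^+ 2)%:E)%E.
  apply: eq_integral => x _; rewrite /line_energy -ge0_integralZl ?lee_fin ?in_cube_ge0//.
  - by apply: eq_integral => s _; rewrite /p /= -mulrA EFinM.
  - apply/measurable_EFinP; apply: measurable_funM; first exact: measurable_in01.
    apply: measurable_funX; apply: measurable_funB => //.
    by apply: (measurableT_comp mu); apply: measurable_upd => //; exact: measurable_cst.
  - by move=> s _; rewrite lee_fin mulr_ge0 ?sqr_ge0 ?in01_ge0.
refine (horn_pair_energy N0 i01 iu ig g0 weak (l := fun=> 1) _ _ _ _ _ _).
- by move=> _; rewrite ltr01 lexx.
- exact: measurable_cst.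
- by [].
- apply: measurable_funM.
    by apply: (measurableT_comp measurable_in_cube); exact: measurable_snd.
  by apply: (measurableT_comp measurable_in01); exact: measurable_fst.
- move=> z; rewrite invr1 /p mulr_ge0 ?in01_ge0 ?in_cube_ge0//=.
  by rewrite /in_cube /in01 !indicE -natrM mulnb natr_bool_le1.
move=> s x; rewrite /p /= /in_cube /in01 !indicE -natrM mulnb.
case: (boolP (_ && _)) => [/andP[/set_mem xc]|]; last by rewrite eqxx.
rewrite inE/= in_itv/= => /andP[s0 s1] _; split.
- exact: cube_horn.
- apply: cube_horn => // j; rewrite /= in_itv/= updE; case: eqP => [_|_]; first by rewrite s0.
  by have := xc j; rewrite /= in_itv.
have := xc i; rewrite /= in_itv/= => /andP[x0 x1].
by rewrite ler_norml; apply/andP; split; lra.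
Qed.

Let f c x := (u x - c) ^+ 2 * chi x.

(** Every point outside the cube has partners on a stretch of length 1/2. Seen from a partner, the
    sources also fill at most a stretch of length 1/2, and none exist unless the partner is in the
    cube or in the lower half of its section. *)
Lemma transfer_left c : (\int[leb]_x (2^-1 * (1 - (x ord0 i0 < 1)%R%:R) * f c x)%:E <=
  (9 / 8)%:E * \int[leb]_x
     (2^-1 * ((x ord0 i0 < 1)%R%:R + (x ord0 i1 < pr x / 2)%R%:R) * f c x)%:E +
  72%:E * energy i0)%E.
Proof.
pose p (z : Z) : R := chi z.2 * ((1 <= z.2 ord0 i0) &&
  ((z.2 ord0 i0 - 1 < z.1) && (z.1 < z.2 ord0 i0 - 2^-1)))%R%:R.
have mp : measurable_fun setT p.
  apply: measurable_funM => //; apply: measurable_natr_bool.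
  apply: measurable_and; first by apply: measurable_fun_ler => //; exact: measurable_cst.
  apply: measurable_and; apply: measurable_fun_ltr; rewrite /=;
    try exact: measurable_fst; by apply: measurable_funB => //; exact: measurable_cst.
refine (transfer (l := fun=> 1) N0 i01 iu ig g0 weak c _ _ _ mp _ _ _ _ _ _ _).
- by move=> _; rewrite ltr01 lexx.
- exact: measurable_cst.
- by [].
- move=> z; rewrite invr1 /p mulr_ge0 ?natr_bool_ge0 ?indicE//=.
  by rewrite -natrM mulnb natr_bool_le1.
- move=> s x; rewrite /p mulf_eq0 negb_or => /andP[/chi_neq0 Ox].
  rewrite pnatr_eq0 eqb0 negbK => /andP[x1 /andP[/= s0 s1]].
  have xu := horn_bounds N0 Ox i0; split => //.
    apply: (horn_down N0 Ox) => j; rewrite updE; case: eqP => [->|_].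
      by apply/andP; split; lra.
    by have /andP[-> _] := horn_bounds N0 Ox j; rewrite lexx.
  by rewrite ler_norml; apply/andP; split; lra.
- apply: measurable_funM => //; apply: measurable_funB => //.
  by apply: measurable_natr_bool; apply: measurable_fun_ltr => //; exact: measurable_cst.
- apply: measurable_funM => //; apply: measurable_funD.
    by apply: measurable_natr_bool; apply: measurable_fun_ltr => //; exact: measurable_cst.
  apply: measurable_natr_bool; apply: measurable_fun_ltr => //.
  by apply: measurable_funM => //; exact: measurable_cst.
- by move=> x; rewrite mulr_ge0// subr_ge0 natr_bool_le1.
- move=> x Ox; have -> : (\int[lam]_s (p (s, x))%:E = \int[lam]_s
      ((1 - (x ord0 i0 < 1)%R%:R)%:E *
       (\1_(`](x ord0 i0 - 1)%R, (x ord0 i0 - 2^-1)%R[%classic) s)%:E))%E.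
    apply: eq_integral => s _; rewrite -EFinM /p !indicE mem_set//= mul1r; congr EFin.
    rewrite (ltNge (x ord0 i0) 1); case: (1 <= _); rewrite /= ?subr0 ?mul1r ?subrr ?mul0r//.
    by congr (_ : bool)%:R; apply/idP/idP; rewrite inE/= in_itv.
  rewrite ge0_integralZl//; last 2 first.
  - by apply/measurable_EFinP; exact: measurable_indic.
  - by rewrite lee_fin subr_ge0 natr_bool_le1.
  rewrite (integral_indic_itvoo (x ord0 i0 - 1) (x ord0 i0 - 2^-1)).
  rewrite (_ : x ord0 i0 - 2^-1 - (x ord0 i0 - 1) = 2^-1); last by field.
  by rewrite max_r// -EFinM mulrC.
move=> x Ox; set t := 2^-1 * _.
pose K : R := (x ord0 i0 < 1)%R%:R + (x ord0 i1 < pr x / 2)%R%:R.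
have K0 : 0 <= K by rewrite addr_ge0// natr_bool_ge0.
apply: (@le_trans _ _ (\int[lam]_s (K%:E *
   (\1_(`](x ord0 i0 + 2^-1)%R, (x ord0 i0 + 1)%R[%classic) s)%:E))%E); last first.
  rewrite ge0_integralZl ?lee_fin//; last by apply/measurable_EFinP; exact: measurable_indic.
  rewrite (integral_indic_itvoo (x ord0 i0 + 2^-1) (x ord0 i0 + 1)).
  rewrite (_ : x ord0 i0 + 1 - (x ord0 i0 + 2^-1) = 2^-1); last by field.
  by rewrite max_r// -EFinM lee_fin mulrC.
apply: ge0_le_integral => //.
- by move=> s _; rewrite lee_fin /p mulr_ge0// ?natr_bool_ge0// indicE.
- apply/measurable_EFinP; apply: (measurableT_comp mp).
  apply: measurable_fun_pair; first exact: measurable_cst.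
  by apply: measurable_upd => //; exact: measurable_cst.
- apply: emeasurable_funM; first exact: measurable_cst.
  by apply/measurable_EFinP; exact: measurable_indic.
move=> s _; rewrite -EFinM lee_fin /p /= upd_eq.
have [->|] := eqVneq (chi (upd i0 s x)) 0.
  by rewrite mul0r mulr_ge0// indicE.
move=> /chi_neq0 Oy; rewrite indicE mem_set// mul1r.
case: (boolP (_ && _)) => [/andP[s1 /andP[s2 s3]]|_]; last by rewrite mulr_ge0// indicE.
rewrite indicE mem_set ?mulr1/=; last by rewrite in_itv/=; apply/andP; split; lra.
rewrite /K; have [_|x1] := ltP (x ord0 i0) 1; first by rewrite lerDl natr_bool_ge0.
rewrite add0r (_ : _ < _ = true)//.
have [_ yN yh _] := Oy; rewrite upd_eq in yN; rewrite upd_eq upd_neq// in yh.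
(* The source has the same coordinate [i1] and lies at least 1/2 deeper, in a section at most half
   as wide. *)
apply: (lt_le_trans yh); apply: le_trans (profile_half x1 _).
  by apply: profile_nonincr => //; lra.
by lra.
Qed.

(** Each point of the lower half is paired with the whole upper half of its section. Each half has
    length pr / 2, so with density 1 / pr both marginals are 1/2, whatever the width; here l is the
    width itself. *)
Lemma transfer_up c : (\int[leb]_x (2^-1 * (x ord0 i1 < pr x / 2)%R%:R * f c x)%:E <=
  (9 / 8)%:E * \int[leb]_x (2^-1 * (1 - (x ord0 i1 < pr x / 2)%R%:R) * f c x)%:E +
  72%:E * energy i1)%E.
Proof.
pose p (z : Z) : R := chi z.2 * ((z.2 ord0 i1 < pr z.2 / 2) &&
  ((pr z.2 / 2 < z.1) && (z.1 < pr z.2)))%R%:R * (pr z.2)^-1.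
have pr0 (x : 'rV[R]_d) : 0 < pr x by exact: profile_gt0.
have phalf0 (x : 'rV[R]_d) : 0 < pr x / 2 by rewrite divr_gt0.
have mhalf : measurable_fun setT (fun x : 'rV[R]_d => pr x / 2).
  by apply: measurable_funM => //; exact: measurable_cst.
have mhalf2 : measurable_fun setT (fun z : Z => pr z.2 / 2).
  by apply: measurable_funM => //; exact: measurable_cst.
have minv : measurable_fun setT (fun z : Z => (pr z.2)^-1).
  (* The inverse width is rewritten as exp(- ln width), a composition of measurable functions. *)
  rewrite (_ : (fun _ => _) = (fun z : Z => expR (2 * profile_depth N (z.2 ord0 i0)))); last first.
    by apply/funext => z; rewrite /profile -expRN opprK.
  rewrite (_ : (fun _ => _) = (fun z : Z => expR (- ln (pr z.2)))).
    apply: measurableT_comp => //; apply: measurableT_comp => //.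
    exact: (measurableT_comp (@measurable_ln R) mpr2).
  by apply/funext => z; rewrite /profile expRK opprK.
have mp : measurable_fun setT p.
  apply: measurable_funM => //; apply: measurable_funM => //; apply: measurable_natr_bool.
  apply: measurable_and; first exact: measurable_fun_ltr.
  by apply: measurable_and; apply: measurable_fun_ltr => //; exact: measurable_fst.
refine (transfer (l := fun x => pr x) N0 i01 iu ig g0 weak c _ _ _ mp _ _ _ _ _ _ _).
- by move=> x; rewrite pr0 profile_le1.
- exact: mpr.
- by move=> s x; rewrite upd_neq// eq_sym.
- move=> z; have pi0 : 0 <= (pr z.2)^-1 by rewrite invr_ge0 ltW.
  rewrite /p indicE -natrM mulnb mulr_ge0//=.
  by rewrite ler_piMl// natr_bool_le1.
- move=> s x; rewrite /p !mulf_eq0 !negb_or -andbA => /and3P[/chi_neq0 Ox].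
  rewrite pnatr_eq0 eqb0 negbK => /andP[x1 /andP[/= s0 s1]] _.
  have s00 : 0 < s by apply: lt_trans s0; rewrite divr_gt0.
  have [x0 xN xh xx1] := Ox; split => //.
    split.
    - by move=> j; rewrite updE; case: eqP.
    - by rewrite upd_neq// eq_sym.
    - by rewrite upd_eq upd_neq// eq_sym.
    - move=> j ji; rewrite updE; case: eqP => _; last exact: xx1.
      by apply: lt_le_trans s1 _; exact: profile_le1.
  by have := x0 i1; rewrite ler_norml => x00; apply/andP; split; lra.
- apply: measurable_funM => //; apply: measurable_natr_bool; exact: measurable_fun_ltr.
- apply: measurable_funM => //; apply: measurable_funB => //.
  by apply: measurable_natr_bool; exact: measurable_fun_ltr.
- by move=> x; rewrite mulr_ge0// natr_bool_ge0.
- move=> x Ox; have -> : (\int[lam]_s (p (s, x))%:E = \int[lam]_s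
      (((x ord0 i1 < pr x / 2)%R%:R / pr x)%:E *
       (\1_(`](pr x / 2)%R, (pr x)%R[%classic) s)%:E))%E.
    apply: eq_integral => s _; rewrite -EFinM /p !indicE mem_set//= mul1r; congr EFin.
    case: (_ < pr x / 2); rewrite /= ?mul0r//.
    rewrite mulrC !mul1r; congr (_ * (_ : bool)%:R); apply/idP/idP; by rewrite inE/= in_itv.
  rewrite ge0_integralZl//; last 2 first.
  - by apply/measurable_EFinP; exact: measurable_indic.
  - by rewrite lee_fin divr_ge0 ?natr_bool_ge0// ltW.
  rewrite (integral_indic_itvoo (pr x / 2) (pr x)).
  rewrite (_ : pr x - pr x / 2 = pr x / 2); last by field.
  rewrite (max_r (ltW (phalf0 x))) -EFinM lee_fin.
  rewrite le_eqVlt; apply/orP; left; apply/eqP; field; exact: lt0r_neq0.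
move=> x Ox; set K : R := 1 - _.
have K0 : 0 <= K by rewrite subr_ge0 natr_bool_le1.
apply: (@le_trans _ _ (\int[lam]_s ((K / pr x)%:E *
   (\1_(`]0%R, (pr x / 2)%R[%classic) s)%:E))%E); last first.
  rewrite ge0_integralZl ?lee_fin ?divr_ge0 ?(ltW (pr0 x))//; last first.
    by apply/measurable_EFinP; exact: measurable_indic.
  rewrite (integral_indic_itvoo 0 (pr x / 2)) subr0.
  rewrite (max_r (ltW (phalf0 x))) -EFinM lee_fin.
  rewrite le_eqVlt; apply/orP; left; apply/eqP; field; exact: lt0r_neq0.
apply: ge0_le_integral => //.
- by move=> s _; rewrite lee_fin /p !mulr_ge0 ?natr_bool_ge0 ?indicE// invr_ge0 ltW.
- apply/measurable_EFinP; apply: (measurableT_comp mp).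
  apply: measurable_fun_pair; first exact: measurable_cst.
  by apply: measurable_upd => //; exact: measurable_cst.
- apply: emeasurable_funM; first exact: measurable_cst.
  by apply/measurable_EFinP; exact: measurable_indic.
move=> s _; rewrite -EFinM lee_fin /p /= upd_eq upd_neq; last by rewrite eq_sym.
rewrite [leRHS]mulrAC ler_wpM2r ?invr_ge0 ?(ltW (pr0 _))//.
have [->|] := eqVneq (chi (upd i1 s x)) 0.
  by rewrite mul0r mulr_ge0// indicE.
move=> /chi_neq0 Oy; rewrite indicE mem_set// mul1r.
case: (boolP (_ && _)) => [/andP[s1 /andP[s2 s3]]|_]; last by rewrite mulr_ge0// indicE.
have [/(_ i1) y0 _ _ _] := Oy; rewrite upd_eq in y0.
rewrite indicE mem_set ?mulr1/=; last by rewrite in_itv/= y0.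
by rewrite /K ltNge (ltW s2) subr0.
Qed.

End horn_instances.

Section horn_measure.
Context {R : realType} {d : nat}.
Local Notation leb := (lebesgue_rV d : {sigma_finite_measure set 'rV[R]_d -> \bar R}).
Variables (N : R) (i0 i1 : 'I_d).
Hypothesis N0 : 0 <= N.

Lemma horn_finite_measure : (leb (horn N i0 i1) < +oo)%E.
Proof.
have mb : forall i : 'I_d, measurable (`]0%R, (N + 1)%R[%classic : set R) by move=> i; exact: measurable_itv.
have sub : horn N i0 i1 `<=` rbox (fun=> `]0%R, (N + 1)%R[%classic).
  by move=> x hx i; rewrite /= in_itv/=; exact: horn_bounds hx i.
apply: (@le_lt_trans _ _ (leb (rbox (fun=> `]0%R, (N + 1)%R[%classic)))).
  apply: le_measure => //; rewrite inE; first exact: measurable_horn.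
  exact: measurable_rbox.
have -> := lebesgue_rV_box mb.
rewrite (_ : (\prod_(i < d) _)%E = ((N + 1) ^+ d)%:E) ?ltry//.
rewrite (eq_bigr (fun=> (N + 1)%:E)); first by rewrite prodEFin prodr_const card_ord.
move=> i _; transitivity (@lebesgue_measure R `]0%R, (N + 1)%R[%classic); first by [].
rewrite lebesgue_measure_itv/= lte_fin ltr_wpDl// ?sube0//.
Qed.

Lemma integrable_indic_horn :
  leb.-integrable setT (EFin \o (\1_(horn N i0 i1) : 'rV[R]_d -> R)).
Proof.
apply/integrableP; split.
  by apply/measurable_EFinP; apply: measurable_indic; exact: measurable_horn.
rewrite (eq_integral (fun x => (\1_(horn N i0 i1) x)%:E)); last first.
  by move=> x _; rewrite /= ger0_norm// indicE.
rewrite integral_indic ?setIT//; [exact: horn_finite_measure|exact: measurable_horn].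
Qed.

End horn_measure.

(** Eliminating L leaves (1 - 81/136) I <= 17/8 Q plus gradient terms, that is I <= 289/55 Q plus
    gradient terms; 6 and 400 are rounded up. *)
Lemma horn_poincare_arith {R : realFieldType} (I Q L X g0 g1 : R) : 0 <= L -> 0 <= Q ->
  0 <= g0 -> 0 <= g1 ->
  I = Q + X -> 2^-1 * X <= 9 / 8 * (2^-1 * (Q + L)) + 72 * g0 ->
  2^-1 * L <= 9 / 8 * (2^-1 * (I - L)) + 72 * g1 ->
  I <= 6 * Q + 400 * (g0 + g1).
Proof. by move=> ? ? ? ? ? ? ?; lra. Qed.

Lemma horn_poincare_const {R : realFieldType} (I Q h S C : R) :
  I <= 6 * Q + 400 * h -> h <= S -> Q <= C * (8 * S) -> I <= (48 * C + 400) * S.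
Proof. by move=> ? ? ?; lra. Qed.

Section horn_poincare.
Context {R : realType} {d : nat}.
Local Notation leb := (lebesgue_rV d : {sigma_finite_measure set 'rV[R]_d -> \bar R}).
Local Notation e_ i := (delta_mx ord0 i : 'rV[R]_d).

(** [K] is chosen before [N]: the cube contributes a constant depending on d only, and the constants
    of the transfers are absolute. *)
Lemma horn_poincare : exists2 K : R, 0 < K & forall (N : R) (i0 i1 : 'I_d)
    (u : 'rV[R]_d -> R) (g : 'I_d -> 'rV[R]_d -> R), 0 <= N -> i1 != i0 ->
  leb.-integrable setT (EFin \o u) ->
  (\int[leb]_x (u x ^+ 2)%:E < +oo)%E ->
  (forall i, leb.-integrable setT (EFin \o g i)) ->
  (forall i, \int[leb]_x (g i x ^+ 2)%:E < +oo)%E ->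
  (forall i x, ~ horn N i0 i1 x -> g i x = 0) ->
  (forall i phi, C1c (horn N i0 i1) phi ->
    \int[leb]_x (u x * 'D_(e_ i) phi x) = - \int[leb]_x (g i x * phi x)) ->
  exists c, (\int[leb]_x ((u x - c) ^+ 2 * \1_(horn N i0 i1) x)%:E <=
    K%:E * \sum_i \int[leb]_x (g i x ^+ 2)%:E)%E.
Proof.
have [C C0 HC] := cube_poincare_seq (R := R) (enum_uniq 'I_d).
(* 48 = 6 * 8: the factor of the cube mass in [horn_poincare_arith] times the one in
   [cube_energy_horn]. *)
exists (48 * C + 400); first by rewrite ltr_wpDl// mulr_ge0.
move=> N i0 i1 u g N0 i01 iu u2 ig g2 g0 weak.
have mu : measurable_fun setT u by apply/measurable_EFinP; exact: measurable_int iu.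
have [c Hc] := HC u mu (fun j jn => False_ind _ (negP jn (mem_enum _ j))).
exists c; pose f x := (u x - c) ^+ 2 * \1_(horn N i0 i1) x.
have f0 x : 0 <= f x by rewrite mulr_ge0 ?sqr_ge0// indicE.
have mchi : measurable_fun setT (\1_(horn N i0 i1) : 'rV[R]_d -> R).
  by apply: measurable_indic; exact: measurable_horn.
have mf : measurable_fun setT f.
  apply: measurable_funM => //; apply: measurable_funX.
  by apply: measurable_funB => //; exact: measurable_cst.
(* Finiteness of the total mass is what allows absorbing it; it follows from (u - c)^2 <= 2 u^2 + 2
   c^2 and the finite measure of the horn. *)
have if_ : leb.-integrable setT (EFin \o f).
  pose h x := 2 * u x ^+ 2 + 2 * c ^+ 2 * \1_(horn N i0 i1) x.
  have ih : leb.-integrable setT (EFin \o h).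
    rewrite (_ : _ \o _ = fun x => 2%:E * (u x ^+ 2)%:E +
       (2 * c ^+ 2)%:E * (\1_(horn N i0 i1) x)%:E)%E; last first.
      by apply/funext => x; rewrite /h/= EFinD (EFinM 2) (EFinM (2 * _)).
    apply: integrableD => //; apply: integrableZl => //.
      apply/integrableP; split.
        by apply/measurable_EFinP; exact: measurable_funX.
      rewrite (eq_integral (fun x => (u x ^+ 2)%:E))// => x _.
      by rewrite abse_EFin ger0_norm ?sqr_ge0.
    exact: integrable_indic_horn.
  apply: le_integrable ih => //; first exact/measurable_EFinP.
  move=> x _; rewrite !abse_EFin lee_fin ger0_norm// /h ger0_norm; last first.
    rewrite indicE; apply: addr_ge0; first exact: mulr_ge0 (ler0n _ _) (sqr_ge0 _).
    exact: mulr_ge0 (mulr_ge0 (ler0n _ _) (sqr_ge0 _)) (ler0n _ _).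
  rewrite /f indicE; case: (_ \in _); last first.
    by rewrite !mulr0 addr0; exact: mulr_ge0 (ler0n _ _) (sqr_ge0 _).
  by rewrite !mulr1; have := sqr_ge0 (u x + c); rewrite sqrrB sqrrD; lra.
pose J (w : 'rV[R]_d -> R) := \int[leb]_x (w x * f x).
have iw (w : 'rV[R]_d -> R) : measurable_fun setT w -> (forall x, 0 <= w x <= 1) ->
    leb.-integrable setT (EFin \o (fun x => w x * f x)).
  move=> mw w01; apply: le_integrable if_ => //.
    by apply/measurable_EFinP; exact: measurable_funM.
  move=> x _; have /andP[w0 w1] := w01 x.
  rewrite !abse_EFin lee_fin (ger0_norm (f0 x)) (ger0_norm (mulr_ge0 w0 (f0 x))).
  exact: ler_piMl (f0 x) w1.
have JE (w : 'rV[R]_d -> R) : leb.-integrable setT (EFin \o (fun x => w x * f x)) ->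
    (\int[leb]_x (w x * f x)%:E = (J w)%:E)%E.
  by move=> i; rewrite /J /Rintegral fineK//; exact: integrable_fin_num.
have JZ a (w : 'rV[R]_d -> R) : leb.-integrable setT (EFin \o (fun x => w x * f x)) ->
    (\int[leb]_x (a * w x * f x)%:E = (a * J w)%:E)%E.
  move=> i; rewrite EFinM -JE// -integralZl//.
  by apply: eq_integral => x _; rewrite -EFinM -mulrA.
have JD (v w : 'rV[R]_d -> R) : leb.-integrable setT (EFin \o (fun x => v x * f x)) ->
    leb.-integrable setT (EFin \o (fun x => w x * f x)) ->
    leb.-integrable setT (EFin \o (fun x => (v x + w x) * f x)) /\
    J (fun x => v x + w x) = J v + J w.
  move=> iv iw'; split; last first.
    by rewrite /J -RintegralD//; apply: eq_Rintegral => x _; rewrite mulrDl.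
  rewrite (_ : _ \o _ = fun x => (v x * f x)%:E + (w x * f x)%:E)%E; first exact: integrableD.
  by apply/funext => x /=; rewrite mulrDl EFinD.
pose a (x : 'rV[R]_d) : R := (x ord0 i0 < 1)%R%:R.
pose b (x : 'rV[R]_d) : R := (x ord0 i1 < profile N (x ord0 i0) / 2)%R%:R.
have mcoord j : measurable_fun setT (fun x : 'rV[R]_d => x ord0 j).
  exact: measurable_coord.
have ma : measurable_fun setT a.
  by apply: measurable_natr_bool; apply: measurable_fun_ltr => //; exact: measurable_cst.
have mb : measurable_fun setT b.
  apply: measurable_natr_bool; apply: measurable_fun_ltr => //.
  apply: measurable_funM; last exact: measurable_cst.
  exact: (measurableT_comp (measurable_profile N0)).
have a01 x : 0 <= a x <= 1 by rewrite natr_bool_ge0 natr_bool_le1.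
have b01 x : 0 <= b x <= 1 by rewrite natr_bool_ge0 natr_bool_le1.
have compl (w : 'rV[R]_d -> R) : measurable_fun setT w -> (forall x, 0 <= w x <= 1) ->
    leb.-integrable setT (EFin \o (fun x => (1 - w x) * f x)).
  move=> mw w01; apply: iw; first by apply: measurable_funB => //; exact: measurable_cst.
  by move=> x; have /andP[w0 w1] := w01 x; rewrite subr_ge0 w1 gerBl.
have ia := iw a ma a01; have ib := iw b mb b01.
have ia' := compl a ma a01; have ib' := compl b mb b01.
have [_ JaX] := JD _ _ ia ia'; have [_ JbX] := JD _ _ ib ib'; have [iab JabE] := JD _ _ ia ib.
have IE (w : 'rV[R]_d -> R) : J (fun x => w x + (1 - w x)) = \int[leb]_x f x.
  by apply: eq_Rintegral => x _; rewrite subrKC mul1r.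
rewrite IE in JaX; rewrite IE in JbX.
pose G i := fine (\int[leb]_x (g i x ^+ 2)%:E)%E.
have GE i : (\int[leb]_x (g i x ^+ 2)%:E = (G i)%:E)%E.
  rewrite fineK// ge0_fin_numE//.
  by apply: integral_ge0 => x _; rewrite lee_fin sqr_ge0.
have G0 i : 0 <= G i.
  by rewrite -lee_fin -GE; apply: integral_ge0 => x _; rewrite lee_fin sqr_ge0.
have TL := transfer_left N0 i01 iu ig g0 weak c.
have TU := transfer_up N0 i01 iu ig g0 weak c.
rewrite -/f !JZ// GE JabE -!EFinM -EFinD lee_fin in TL.
rewrite -/f !JZ// GE -!EFinM -EFinD lee_fin in TU.
(* The part of the horn with x_i0 < 1 is exactly the unit cube, and c was chosen there. *)
have TQ : J a <= C * (8 * \sum_i G i).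
  rewrite -lee_fin -JE//; have <- : (\int[leb]_x (in_cube x * (u x - c) ^+ 2)%:E =
      \int[leb]_x (a x * f x)%:E)%E.
    apply: eq_integral => x _; rewrite /f (mulrC (in_cube x)) (mulrCA (a x)); congr EFin; congr (_ * _).
    rewrite /in_cube /a !indicE -natrM mulnb; congr (_ : bool)%:R.
    apply/idP/andP => [/set_mem xc|[x1 /set_mem xh]]; last first.
      by apply/mem_set; exact: horn_cube xh x1.
    by have := xc i0; rewrite /= in_itv/= => /andP[_ ->]; split => //; apply/mem_set/cube_horn.
  apply: (le_trans Hc); rewrite EFinM; apply: lee_wpmul2l; first by rewrite lee_fin.
  rewrite big_enum/= mulr_sumr -sumEFin; apply: lee_sum => i _.
  rewrite EFinM -GE; exact (cube_energy_horn N0 i01 iu ig g0 weak i).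
rewrite [leLHS](_ : _ = (\int[leb]_x f x)%:E); last first.
  by rewrite /Rintegral fineK//; exact: integrable_fin_num.
rewrite (eq_bigr (fun i => (G i)%:E))// sumEFin -EFinM lee_fin.
have J0 (w : 'rV[R]_d -> R) : (forall x, 0 <= w x <= 1) -> 0 <= J w.
  move=> w01; apply: Rintegral_ge0 => x _; apply: mulr_ge0 => //.
  by case/andP: (w01 x).
have JbE : J (fun x => 1 - b x) = \int[leb]_x f x - J b by rewrite JbX addrAC subrr add0r.
have TU' : 2^-1 * J b <= 9 / 8 * (2^-1 * (\int[leb]_x f x - J b)) + 72 * G i1.
  by rewrite -JbE; exact: TU.
have := horn_poincare_arith (J0 _ b01) (J0 _ a01) (G0 i0) (G0 i1) JaX TL TU'.
have SG : G i0 + G i1 <= \sum_i G i.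
  rewrite (bigD1 i0)//= (bigD1 i1)//= addrA lerDl; exact: sumr_ge0.
by move=> h; exact: horn_poincare_const h SG TQ.
Qed.


End horn_poincare.

(** * The spectral gap *)

(** V and B stand for the squared norm and the Dirichlet energy of a u0 + b u1. If l0 = l1 then B =
    l1 V; otherwise s01 = 0 and the cross terms vanish. In both cases B <= t V, so V <= K t V. *)
Lemma gap_arith {R : realFieldType} (K t l0 l1 a b s00 s01 s11 B : R) : 0 <= K ->
  l0 <= t -> l1 <= t -> 0 <= s00 -> 0 <= s11 -> l0 * s01 = l1 * s01 ->
  B = a ^+ 2 * (l0 * s00) + 2 * a * b * (l0 * s01) + b ^+ 2 * (l1 * s11) ->
  let V := a ^+ 2 * s00 + 2 * a * b * s01 + b ^+ 2 * s11 in
  0 < V -> V <= K * B -> 1 <= K * t.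
Proof.
move=> K0 l0t l1t s00p s11p E -> V V0 VB.
have : a ^+ 2 * (l0 * s00) + 2 * a * b * (l0 * s01) + b ^+ 2 * (l1 * s11) <= t * V.
  rewrite -subr_ge0 /V; have [e|ne] := eqVneq l0 l1.
    have -> : t * V - (a ^+ 2 * (l0 * s00) + 2 * a * b * (l0 * s01) + b ^+ 2 * (l1 * s11)) =
      (t - l1) * V by rewrite /V e; ring.
    by rewrite mulr_ge0 ?subr_ge0// ltW.
  have -> : s01 = 0.
    apply/eqP; have /eqP : (l0 - l1) * s01 = 0 by rewrite mulrBl E subrr.
    by rewrite mulf_eq0 subr_eq0 (negbTE ne).
  have -> : t * (a ^+ 2 * s00 + 2 * a * b * 0 + b ^+ 2 * s11) -
     (a ^+ 2 * (l0 * s00) + 2 * a * b * (l0 * 0) + b ^+ 2 * (l1 * s11)) =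
     a ^+ 2 * ((t - l0) * s00) + b ^+ 2 * ((t - l1) * s11) by ring.
  by apply: addr_ge0; apply: mulr_ge0; rewrite ?sqr_ge0// mulr_ge0// subr_ge0.
move=> /(ler_wpM2l K0) /(le_trans VB).
by rewrite mulrA ler_pMl.
Qed.

(** * Square-integrable functions on a domain *)

Section L2.
Context {R : realType} {d : nat}.
Local Notation leb := (lebesgue_rV d : {sigma_finite_measure set 'rV[R]_d -> \bar R}).
Local Notation e_ i := (delta_mx ord0 i : 'rV[R]_d).
Variable Omega : set 'rV[R]_d.
Hypothesis mO : measurable Omega.
Implicit Types u v : 'rV[R]_d -> R.

Lemma L2_measurable_sqr u : L2 Omega u ->
  measurable_fun Omega (EFin \o (fun x => u x ^+ 2)).
Proof. by move=> [mu _]; apply/measurable_EFinP; exact: measurable_funX. Qed.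

Lemma L2_integrableM u v : L2 Omega u -> L2 Omega v ->
  leb.-integrable Omega (EFin \o (fun x => u x * v x)).
Proof.
move=> Lu Lv; have [mu u2] := Lu; have [mv v2] := Lv.
have m2u := L2_measurable_sqr Lu; have m2v := L2_measurable_sqr Lv.
apply/integrableP; split; first by apply/measurable_EFinP; exact: measurable_funM.
apply: (@le_lt_trans _ _ (\int[leb]_(x in Omega) ((u x ^+ 2)%:E + (v x ^+ 2)%:E)%E)%E).
  apply: ge0_le_integral => //.
  - by apply: measurableT_comp => //; apply/measurable_EFinP; exact: measurable_funM.
  - exact: emeasurable_funD.
  move=> x _; rewrite abse_EFin -EFinD lee_fin normrM.
  rewrite -[u x ^+ 2]real_normK ?num_real// -[v x ^+ 2]real_normK ?num_real//.
  have h1 := sqr_ge0 (`|u x| - `|v x|); have h2 := normr_ge0 (u x); have h3 := normr_ge0 (v x).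
  have h4 := mulr_ge0 h2 h3; rewrite sqrrB in h1; lra.
rewrite ge0_integralD//.
- by apply: lte_add_pinfty; [exact: u2|exact: v2].
- by move=> x _; rewrite lee_fin sqr_ge0.
- by move=> x _; rewrite lee_fin sqr_ge0.
Qed.

Lemma L2_lincomb u v (a b : R) : L2 Omega u -> L2 Omega v ->
  L2 Omega (fun x => a * u x + b * v x).
Proof.
move=> Lu Lv; have [mu u2] := Lu; have [mv v2] := Lv.
have m2u := L2_measurable_sqr Lu; have m2v := L2_measurable_sqr Lv.
have mw : measurable_fun Omega (fun x => a * u x + b * v x).
  by apply: measurable_funD; apply: measurable_funM => //; exact: measurable_cst.
split => //.
apply: (@le_lt_trans _ _ (\int[leb]_(x in Omega)
   ((2 * a ^+ 2)%:E * (u x ^+ 2)%:E + (2 * b ^+ 2)%:E * (v x ^+ 2)%:E)%E)%E).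
  apply: ge0_le_integral => //.
  - by move=> x _; rewrite lee_fin sqr_ge0.
  - by apply/measurable_EFinP; exact: measurable_funX.
  - by apply: emeasurable_funD; apply: emeasurable_funM => //; exact: measurable_cst.
  move=> x _; rewrite -!EFinM -EFinD lee_fin -subr_ge0.
  rewrite (_ : _ - _ = (a * u x - b * v x) ^+ 2) ?sqr_ge0//; ring.
have a0 : 0 <= 2 * a ^+ 2 := mulr_ge0 (ler0n _ _) (sqr_ge0 _).
have b0 : 0 <= 2 * b ^+ 2 := mulr_ge0 (ler0n _ _) (sqr_ge0 _).
rewrite ge0_integralD//.
- rewrite !ge0_integralZl ?lee_fin//.
  + apply: lte_add_pinfty; apply: lte_mul_pinfty; rewrite ?lee_fin//.
  + by move=> x _; rewrite lee_fin sqr_ge0.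
  + by move=> x _; rewrite lee_fin sqr_ge0.
- by move=> x _; rewrite mule_ge0// lee_fin ?sqr_ge0.
- by apply: emeasurable_funM => //; exact: measurable_cst.
- by move=> x _; rewrite mule_ge0// lee_fin ?sqr_ge0.
- by apply: emeasurable_funM => //; exact: measurable_cst.
Qed.

Hypothesis fO : (leb Omega < +oo)%E.

Lemma L2_cst (a : R) : L2 Omega (fun=> a).
Proof.
split; first exact: measurable_cst.
rewrite integral_cst//; apply: lte_mul_pinfty => //.
by rewrite lee_fin sqr_ge0.
Qed.

Lemma L2_integrable u : L2 Omega u -> leb.-integrable Omega (EFin \o u).
Proof.
move=> Lu; have := L2_integrableM (L2_cst 1) Lu.
by congr (_.-integrable _ _); apply/funext => x /=; rewrite mul1r.
Qed.

End L2.

Section measurable_continuous_rV.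
Context {R : realType} {d : nat}.

(** An open set is the union of the countably many boxes with rational corners that it contains. *)
Lemma open_measurable_rV (U : set 'rV[R]_d) : open U -> measurable U.
Proof.
move=> oU; pose B (p : {ffun 'I_d -> rat * rat}) : set 'rV[R]_d :=
  rbox (fun j => `](ratr (p j).1 : R), ratr (p j).2[%classic).
have -> : U = \bigcup_p (if `[< B p `<=` U >] then B p else set0).
  apply/seteqP; split => [x Ux|x [p _]]; last by case: asboolP => // BU /BU.
  have /nbhs_ballP[e /= e0 be] : nbhs x U by move: oU; rewrite openE => /(_ x Ux).
  have /choice[p2 p2P] j : exists q : rat, x ord0 j < ratr q < x ord0 j + e.
    have /rat_in_itvoo[q] : x ord0 j < x ord0 j + e by rewrite ltrDl.
    by rewrite in_itv; exists q.
  have /choice[p1 p1P] j : exists q : rat, x ord0 j - e < ratr q < x ord0 j.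
    have /rat_in_itvoo[q] : x ord0 j - e < x ord0 j by rewrite gtrBl.
    by rewrite in_itv; exists q.
  exists [ffun j => (p1 j, p2 j)] => //; case: asboolP => [_ j|[]].
    rewrite /= ffunE/= in_itv/=.
    by case/andP: (p1P j) => _ ->; case/andP: (p2P j) => ->.
  move=> y By; apply: be; split => // i' j; rewrite ord1 /ball/=.
  have := By j; rewrite /= ffunE/= in_itv/= => /andP[y1 y2].
  case/andP: (p1P j) => h1 h2; case/andP: (p2P j) => h3 h4.
  by rewrite ltr_norml; apply/andP; split; lra.
apply: countable_bigcupT_measurable => [|p]; first exact: countableP.
case: asboolP => _ //; apply: measurable_rbox => j; exact: measurable_itv.
Qed.

Lemma continuous_measurable_rV (f : 'rV[R]_d -> R) : continuous f -> measurable_fun setT f.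
Proof.
move=> /continuousP cf; apply: (measurability _ (RGenOInfty.measurableE R)).
move=> /= _ [_ [x ->] <-]; rewrite setTI; apply: open_measurable_rV.
by apply: cf; exact: interval_open.
Qed.

End measurable_continuous_rV.

Section spectral_gap.
Context {R : realType} {d : nat}.
Local Notation leb := (lebesgue_rV d : {sigma_finite_measure set 'rV[R]_d -> \bar R}).
Local Notation e_ i := (delta_mx ord0 i : 'rV[R]_d).
Variable Omega : set 'rV[R]_d.
Hypothesis mO : measurable Omega.
Hypothesis fO : (leb Omega < +oo)%E.
Hypothesis bO : exists2 B : set 'rV[R]_d, compact B & Omega `<=` B.
Implicit Types u v : 'rV[R]_d -> R.

Lemma Rintegral_lincomb (a b : R) u v : leb.-integrable Omega (EFin \o u) ->
  leb.-integrable Omega (EFin \o v) ->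
  \int[leb]_(x in Omega) (a * u x + b * v x) =
  a * \int[leb]_(x in Omega) u x + b * \int[leb]_(x in Omega) v x.
Proof.
move=> iu iv; have iZ (c : R) w : leb.-integrable Omega (EFin \o w) ->
    leb.-integrable Omega (EFin \o (fun x => c * w x)).
  move=> iw; rewrite (_ : _ \o _ = fun x => c%:E * (w x)%:E)%E; first exact: integrableZl.
  by apply/funext => x /=; rewrite EFinM.
by rewrite (RintegralD mO (iZ a u iu) (iZ b v iv)) !RintegralZl.
Qed.

(** Meant for test functions and their derivatives: their products with L^2 functions become
    integrable, so that the weak formulation can be combined linearly. *)
Lemma L2_continuous u : continuous u -> L2 Omega u.
Proof.
move=> cu; have mu := measurable_funS measurableT (@subsetT _ Omega) (continuous_measurable_rV cu).
have [B cB OB] := bO.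
have [D uD] : exists D, forall x, Omega x -> `|u x| <= D.
  have /compact_bounded[M [_ HM]] : compact (u @` B).
    by apply: continuous_compact => //; exact: continuous_subspaceT.
  exists (M + 1) => x /OB Bx; apply: (HM (M + 1)); first by rewrite ltrDl.
  by exists x.
split => //; apply: le_lt_trans (L2_cst mO fO D).2; apply: ge0_le_integral => //.
- by move=> x _; rewrite lee_fin sqr_ge0.
- by apply/measurable_EFinP; exact: measurable_funX.
move=> x Ox; rewrite lee_fin -[u x ^+ 2]real_normK ?num_real//.
by apply: lerXn2r; rewrite ?nnegrE ?uD// (le_trans _ (uD _ Ox)).
Qed.

Lemma L2_integrable_dotp (g h : 'rV[R]_d -> 'rV[R]_d) :
  (forall i, L2 Omega (fun x => g x ord0 i)) ->
  (forall i, L2 Omega (fun x => h x ord0 i)) ->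
  leb.-integrable Omega (EFin \o (fun x => dotp (g x) (h x))).
Proof.
move=> Lg Lh; rewrite (_ : _ \o _ =
    fun x => \sum_(i <- index_enum 'I_d) (g x ord0 i * h x ord0 i)%:E)%E.
  by apply: integrable_sum => // i _; exact: (L2_integrableM mO (Lg i) (Lh i)).
by apply/funext => x /=; rewrite sumEFin.
Qed.

Lemma H1_grad_lincomb (a b : R) u v (g h : 'rV[R]_d -> 'rV[R]_d) :
  H1_grad Omega u g -> H1_grad Omega v h ->
  H1_grad Omega (fun x => a * u x + b * v x) (fun x => a *: g x + b *: h x).
Proof.
move=> [Lu Lg wu] [Lv Lh wv]; split; first exact: L2_lincomb.
  move=> i; rewrite (_ : (fun x => _) = fun x => a * g x ord0 i + b * h x ord0 i).
    exact: L2_lincomb.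
  by apply/funext => x; rewrite !mxE.
move=> phi Cphi i; have [cphi dphi _] := Cphi.
have Lp := L2_continuous cphi; have Ld := L2_continuous (dphi i).2.
transitivity (\int[leb]_(x in Omega)
    (a * (u x * 'D_(e_ i) phi x) + b * (v x * 'D_(e_ i) phi x))).
  by apply: eq_Rintegral => x _; rewrite mulrDl !mulrA.
rewrite (Rintegral_lincomb a b (L2_integrableM mO Lu Ld) (L2_integrableM mO Lv Ld)).
rewrite wu// wv// !mulrN -opprD; congr (- _).
rewrite -(Rintegral_lincomb a b (L2_integrableM mO (Lg i) Lp) (L2_integrableM mO (Lh i) Lp)).
by apply: eq_Rintegral => x _; rewrite !mxE mulrDl !mulrA.
Qed.

Lemma L2_ae_eq0 u : L2 Omega u -> \int[leb]_(x in Omega) (u x * u x) = 0 ->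
  {ae leb, forall x, Omega x -> u x = 0}.
Proof.
move=> Lu u0; have iu := L2_integrableM mO Lu Lu.
have [+ _] := ae_eq_integral_abs leb mO (measurable_int _ iu).
have -> : (\int[leb]_(x in Omega) `|(u x * u x)%:E| = 0)%E.
  rewrite (eq_integral (fun x => (u x * u x)%:E)); last first.
    by move=> x _; rewrite /= ger0_norm// -expr2 sqr_ge0.
  by rewrite -[LHS]fineK ?(integrable_fin_num _ iu)// -[fine _]/(Rintegral _ _ _) u0.
move=> /(_ erefl); apply: filterS => x /= H Ox; have [] := H Ox.
by move/eqP; rewrite mulf_eq0 orbb => /eqP.
Qed.

Variable K : R.
Hypothesis K0 : 0 < K.
Hypothesis poincare : forall u g, H1_grad Omega u g -> \int[leb]_(x in Omega) u x = 0 ->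
  \int[leb]_(x in Omega) (u x * u x) <= K * \int[leb]_(x in Omega) dotp (g x) (g x).

(** Two independent eigenfunctions span a plane, which contains a nonzero function of mean 0, to
    which the Poincare inequality applies. *)
Lemma eigenfunctions_gap (t l0 l1 : R) (u0 u1 : 'rV[R]_d -> R) : l0 <= t -> l1 <= t ->
  neumann_eigenspace Omega l0 u0 -> neumann_eigenspace Omega l1 u1 ->
  (forall a b : R, {ae leb, forall x, Omega x -> a * u0 x + b * u1 x = 0} ->
    a = 0 /\ b = 0) ->
  1 <= K * t.
Proof.
move=> l0t l1t [Lf0 [g0 H0 E0]] [Lf1 [g1 H1 E1]] indep.
have [Lu0 Lg0 _] := H0; have [Lu1 Lg1 _] := H1.
have i00 := L2_integrableM mO Lu0 Lu0; have i01 := L2_integrableM mO Lu0 Lu1.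
have i11 := L2_integrableM mO Lu1 Lu1.
pose m0 := \int[leb]_(x in Omega) u0 x; pose m1 := \int[leb]_(x in Omega) u1 x.
pose s00 := \int[leb]_(x in Omega) (u0 x * u0 x).
pose s01 := \int[leb]_(x in Omega) (u0 x * u1 x).
pose s11 := \int[leb]_(x in Omega) (u1 x * u1 x).
have EB (l : R) f v w : leb.-integrable Omega (EFin \o (fun x => v x * w x)) ->
    f = (fun x => l * v x) ->
    \int[leb]_(x in Omega) (f x * w x) = l * \int[leb]_(x in Omega) (v x * w x).
  move=> ivw ->; rewrite -RintegralZl//.
  by apply: eq_Rintegral => x _; rewrite mulrA.
have B00 : \int[leb]_(x in Omega) dotp (g0 x) (g0 x) = l0 * s00.
  by rewrite (E0 _ _ H0); exact: EB.
have B01 : \int[leb]_(x in Omega) dotp (g0 x) (g1 x) = l0 * s01.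
  by rewrite (E0 _ _ H1); exact: EB.
have B11 : \int[leb]_(x in Omega) dotp (g1 x) (g1 x) = l1 * s11.
  by rewrite (E1 _ _ H1); exact: EB.
(* Symmetry of the Dirichlet form: orthogonality of eigenfunctions for distinct eigenvalues. *)
have B10 : l0 * s01 = l1 * s01.
  rewrite -B01; transitivity (\int[leb]_(x in Omega) dotp (g1 x) (g0 x)).
    by apply: eq_Rintegral => x _; apply: eq_bigr => i _; rewrite mulrC.
  rewrite (E1 _ _ H0) (EB l1 _ u1 u0)//; last exact: L2_integrableM.
  by congr (_ * _); apply: eq_Rintegral => x _; rewrite mulrC.
(* The pair (m1, - m0) works unless both means vanish, and then (1, 0) does. *)
have [a [b [ab0 mab]]] : exists a b : R, (a != 0 \/ b != 0) /\ a * m0 + b * m1 = 0.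
  have [m00|m00] := eqVneq m0 0.
    have [m10|m10] := eqVneq m1 0.
      by exists 1, 0; rewrite m00 m10 !mulr0 addr0; split => //; left; rewrite oner_neq0.
    by exists m1, (- m0); split; [left|rewrite mulrC mulNr addrN].
  by exists m1, (- m0); split; [right; rewrite oppr_eq0|rewrite mulrC mulNr addrN].
have H := H1_grad_lincomb a b H0 H1; have [Lv Lh _] := H.
have := poincare H; rewrite (Rintegral_lincomb a b (L2_integrable mO fO Lu0) (L2_integrable mO fO Lu1)).
move=> /(_ mab).
pose V := a ^+ 2 * s00 + 2 * a * b * s01 + b ^+ 2 * s11.
have lin3 (f0 f1 f2 : 'rV[R]_d -> R) : leb.-integrable Omega (EFin \o f0) ->
    leb.-integrable Omega (EFin \o f1) -> leb.-integrable Omega (EFin \o f2) ->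
    \int[leb]_(x in Omega) (a ^+ 2 * f0 x + 2 * a * b * f1 x + b ^+ 2 * f2 x) =
    a ^+ 2 * \int[leb]_(x in Omega) f0 x + 2 * a * b * \int[leb]_(x in Omega) f1 x +
    b ^+ 2 * \int[leb]_(x in Omega) f2 x.
  move=> if0 if1 if2; rewrite -(Rintegral_lincomb (a ^+ 2) (2 * a * b) if0 if1).
  rewrite -[X in X + _]mul1r.
  rewrite -(Rintegral_lincomb 1 (b ^+ 2) _ if2).
    by apply: eq_Rintegral => x _; rewrite mul1r.
  rewrite (_ : _ \o _ = fun x => (a ^+ 2)%:E * (f0 x)%:E + (2 * a * b)%:E * (f1 x)%:E)%E.
    by apply: integrableD => //; exact: integrableZl.
  by apply/funext => x /=; rewrite EFinD (EFinM (a ^+ 2)) (EFinM (2 * a * b)).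
have VE : \int[leb]_(x in Omega) ((a * u0 x + b * u1 x) * (a * u0 x + b * u1 x)) = V.
  apply: etrans (lin3 _ _ _ i00 i01 i11); apply: eq_Rintegral => x _; ring.
have BE : \int[leb]_(x in Omega) dotp (a *: g0 x + b *: g1 x) (a *: g0 x + b *: g1 x) =
    a ^+ 2 * (l0 * s00) + 2 * a * b * (l0 * s01) + b ^+ 2 * (l1 * s11).
  rewrite -B00 -B01 -B11.
  apply: etrans (lin3 _ _ _ (L2_integrable_dotp Lg0 Lg0) (L2_integrable_dotp Lg0 Lg1)
    (L2_integrable_dotp Lg1 Lg1)).
  apply: eq_Rintegral => x _; rewrite /dotp !big_distrr -!big_split/=.
  by apply: eq_bigr => i _; rewrite !mxE; ring.
rewrite VE BE => VK.
have s00p : 0 <= s00 by apply: Rintegral_ge0 => x _; rewrite -expr2 sqr_ge0.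
have s11p : 0 <= s11 by apply: Rintegral_ge0 => x _; rewrite -expr2 sqr_ge0.
apply: (gap_arith (ltW K0) l0t l1t s00p s11p B10 erefl _ VK).
rewrite lt_neqAle; apply/andP; split; last first.
  by rewrite -/V -VE; apply: Rintegral_ge0 => x _; rewrite -expr2 sqr_ge0.
apply/eqP => /esym V0; have [a0 b0] := indep a b (L2_ae_eq0 Lv (etrans VE V0)).
by case: ab0; rewrite ?a0 ?b0 eqxx.
Qed.

(** Every competitor t in the infimum comes with at least two independent eigenfunctions; a relation
    between the first two is extended by zeros to all of them. *)
Lemma neumann_eigenvalue_ge (k : nat) : (1 <= k)%N ->
  ((K^-1)%:E <= neumann_eigenvalue Omega k)%E.
Proof.
case: k => // k _; apply: le_ereal_inf_tmp => _ [t [l [u [lu indep]]] <-].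
rewrite lee_fin -(ler_pM2l K0) divff ?gt_eqF//.
pose j0 : 'I_k.+2 := ord0; pose j1 : 'I_k.+2 := lift ord0 ord0.
have [l0t E0] := lu j0; have [l1t E1] := lu j1.
apply: (eigenfunctions_gap l0t l1t E0 E1) => a b ab.
pose c j : R := if j == j0 then a else if j == j1 then b else 0.
have c0 : forall j, c j = 0.
  apply: indep; apply: filterS ab => x H Ox.
  rewrite (bigD1 j0)//= (bigD1 j1)//= big1 => [|j /andP[h0 h1]].
    by rewrite addr0 /c eqxx; exact: H.
  by rewrite /c (negbTE h0) (negbTE h1) mul0r.
by have := c0 j0; have := c0 j1; rewrite /c !eqxx.
Qed.

End spectral_gap.

Section horn_gap.
Context {R : realType} {d : nat}.
Local Notation leb := (lebesgue_rV d : {sigma_finite_measure set 'rV[R]_d -> \bar R}).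
Local Notation e_ i := (delta_mx ord0 i : 'rV[R]_d).

Lemma restrict_EFin (Omega : set 'rV[R]_d) (f : 'rV[R]_d -> R) x :
  ((f \_ Omega) x)%:E = ((EFin \o f) \_ Omega) x.
Proof. by rewrite !patchE; case: ifP. Qed.

Lemma integral_EFin_restrict (Omega : set 'rV[R]_d) (f h : 'rV[R]_d -> R) :
  (forall x, Omega x -> h x = f x) -> (forall x, ~ Omega x -> h x = 0) ->
  (\int[leb]_x (h x)%:E = \int[leb]_(x in Omega) (f x)%:E)%E.
Proof.
move=> hf h0; rewrite [RHS]integral_mkcond; apply: eq_integral => x _; rewrite patchE.
by case: (boolP (x \in Omega)) => [/set_mem/hf->//|/negP xO]; rewrite h0// => /mem_set.
Qed.

(** [horn_poincare] is applied to the extensions of u and g by 0; the constant c it provides can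
    then be replaced by the mean. *)
Lemma horn_poincare_mean0 : exists2 K : R, 0 < K & forall (N : R) (i0 i1 : 'I_d) u g,
  0 <= N -> i1 != i0 -> H1_grad (horn N i0 i1) u g ->
  \int[leb]_(x in horn N i0 i1) u x = 0 ->
  \int[leb]_(x in horn N i0 i1) (u x * u x) <=
    K * \int[leb]_(x in horn N i0 i1) dotp (g x) (g x).
Proof.
have [K K0 HK] := horn_poincare (R := R) (d := d); exists K => // N i0 i1 u g N0 i01.
move=> [Lu Lg wk] u0; set Omega := horn N i0 i1 in Lu Lg wk u0 *.
have mO : measurable Omega by exact: measurable_horn.
have fO : (leb Omega < +oo)%E by exact: horn_finite_measure.
have ext v : L2 Omega v -> leb.-integrable setT (EFin \o (v \_ Omega)) /\
    (\int[leb]_x ((v \_ Omega) x ^+ 2)%:E = \int[leb]_(x in Omega) (v x * v x)%:E)%E.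
  move=> Lv; split.
    rewrite (_ : _ \o _ = (EFin \o v) \_ Omega); last first.
      by apply/funext => x; exact: restrict_EFin.
    by apply/(integrable_mkcond _ mO); exact: L2_integrable.
  apply: integral_EFin_restrict => x Ox; rewrite patchE; first by rewrite mem_set.
  by rewrite memNset// expr2 mulr0.
have L2_lt v : L2 Omega v -> (\int[leb]_x ((v \_ Omega) x ^+ 2)%:E < +oo)%E.
  move=> Lv; rewrite (ext v Lv).2; case: Lv => _.
  by under eq_integral do rewrite expr2.
pose gi i x := g x ord0 i.
have [||i x Ox|i phi Cphi|c Hc] := HK N i0 i1 (u \_ Omega) (fun i => gi i \_ Omega) N0 i01
   (ext u Lu).1 (L2_lt u Lu).
- by move=> i; have [] := ext _ (Lg i).
- by move=> i; exact: L2_lt (Lg i).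
- by rewrite patchE memNset.
- have := wk phi Cphi i; rewrite [X in X = _]Rintegral_mkcond [X in _ = - X]Rintegral_mkcond.
  move=> E; transitivity (\int[leb]_x ((fun x => u x * 'D_(e_ i) phi x) \_ Omega) x).
    by apply: eq_Rintegral => x _; rewrite !patchE; case: ifP; rewrite ?mul0r.
  rewrite E; congr (- _).
  by apply: eq_Rintegral => x _; rewrite !patchE; case: ifP; rewrite ?mul0r.
have iuu := L2_integrableM mO Lu Lu; have iu := L2_integrable mO fO Lu.
have Lc : L2 Omega (fun x => u x - c).
  have := L2_lincomb mO 1 (- c) Lu (L2_cst mO fO 1).
  by congr (L2 Omega _); apply/funext => x; rewrite mul1r mulr1.
have icc := L2_integrableM mO Lc Lc.
(* As u has mean 0, the integral of u^2 equals that of u^2 - 2 c u, which is pointwise at most (u -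
   c)^2. *)
have le1 : \int[leb]_(x in Omega) (u x * u x) <=
    \int[leb]_(x in Omega) ((u x - c) * (u x - c)).
  apply: (@le_trans _ _ (\int[leb]_(x in Omega) (1 * (u x * u x) + (- (2 * c)) * u x))).
    by rewrite (Rintegral_lincomb mO 1 (- (2 * c)) iuu iu) u0 mulr0 addr0 mul1r.
  apply: le_Rintegral => //.
    rewrite (_ : _ \o _ = fun x => (u x * u x)%:E + (- (2 * c))%:E * (u x)%:E)%E.
      by apply: integrableD => //; exact: integrableZl.
    by apply/funext => x /=; rewrite mul1r EFinD (EFinM (- (2 * c))).
  by move=> x _; rewrite -subr_ge0 (_ : _ - _ = c ^+ 2) ?sqr_ge0//; ring.
apply: (le_trans le1); rewrite -lee_fin.
have RE (f : 'rV[R]_d -> R) : leb.-integrable Omega (EFin \o f) ->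
    (\int[leb]_(x in Omega) f x)%:E = (\int[leb]_(x in Omega) (f x)%:E)%E.
  by move=> i; rewrite /Rintegral fineK//; exact: integrable_fin_num.
rewrite EFinM RE// RE; last exact: L2_integrable_dotp.
have <- : (\int[leb]_x (((u \_ Omega) x - c) ^+ 2 * \1_Omega x)%:E =
    \int[leb]_(x in Omega) ((u x - c) * (u x - c))%:E)%E.
  apply: integral_EFin_restrict => x Ox; rewrite indicE.
    by rewrite mem_set// mulr1 patchE mem_set.
  by rewrite memNset// mulr0.
have <- : (\sum_i \int[leb]_x ((gi i \_ Omega) x ^+ 2)%:E =
    \int[leb]_(x in Omega) (dotp (g x) (g x))%:E)%E.
  transitivity (\int[leb]_(x in Omega) \sum_(i < d) (gi i x * gi i x)%:E)%E; last first.
    by apply: eq_integral => x _; rewrite sumEFin.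
  rewrite integral_sum//; last by move=> i; exact: (L2_integrableM mO (Lg i) (Lg i)).
  by apply: eq_bigr => i _; exact: (ext _ (Lg i)).2.
exact: Hc.
Qed.

Lemma horn_neumann_eigenvalue_ge : exists2 K : R, 0 < K &
  forall (N : R) (i0 i1 : 'I_d) k, 0 <= N -> i1 != i0 -> (1 <= k)%N ->
  (K%:E <= neumann_eigenvalue (horn N i0 i1) k)%E.
Proof.
have [K K0 HK] := horn_poincare_mean0; exists K^-1; first by rewrite invr_gt0.
move=> N i0 i1 k N0 i01 k1; apply: neumann_eigenvalue_ge => //.
- exact: measurable_horn.
- exact: horn_finite_measure.
- exists [set x : 'rV[R]_d | forall j, `[0, N + 1]%classic (x ord0 j)].
    apply: (@rV_compact _ _ (fun=> `[0, N + 1]%classic)) => j; exact: segment_compact.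
  by move=> x hx j; rewrite /= in_itv/=; have /andP[/ltW -> /ltW ->] := horn_bounds N0 hx j.
- by move=> u g; exact: HK.
Qed.

End horn_gap.

Theorem mainTheorem4 (R : realType) (d k : nat) (hd : (2 <= d)%N)
    (hk : (1 <= k)%N) :
  ereal_sup [set (diameter Omega ^+ 2 * neumann_eigenvalue Omega k)%E
            | Omega in @lipschitz_domain R d]%classic = +oo%E.
Proof.
have [K K0 HK] := horn_neumann_eigenvalue_ge (R := R) (d := d).
pose i0 : 'I_d := Ordinal (ltnW hd); pose i1 : 'I_d := Ordinal hd.
have i01 : i1 != i0 by [].
(* Adding 1 gives N >= 1, hence N^2 >= N >= A / K. *)
apply/eqyP => A A0; pose N := A / K + 1.
have N1 : 1 <= N by rewrite lerDr divr_ge0// ltW.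
have N0 : 0 <= N := le_trans ler01 N1.
apply: (@le_trans _ _ (N%:E ^+ 2 * K%:E)%E).
  rewrite -EFin_expe -EFinM lee_fin -ler_pdivrMr//.
  apply: (@le_trans _ _ N); first by rewrite lerDl.
  by rewrite expr2 ler_peMr.
apply: (@le_trans _ _ (diameter (horn N i0 i1) ^+ 2 * neumann_eigenvalue (horn N i0 i1) k)%E).
  have DN := horn_diameter N0 i01; have KE := HK N i0 i1 k N0 i01 hk.
  have N0E : (0 <= N%:E)%E by rewrite lee_fin.
  apply: lee_pmul => //; first by rewrite expe_ge0.
    by rewrite lee_fin ltW.
  by rewrite !expe2; exact: lee_pmul.
apply: ereal_sup_ubound; exists (horn N i0 i1) => //.
exact: horn_lipschitz_domain.
Qed.
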